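(* Let $[\boldsymbol T,\boldsymbol o]$ be a unimodular eternal Galton-Watson tree (nontrivial, i.e. excluding the case where each vertex has exactly one offspring), endowed with the graph-distance metric. If the offspring distribution has finite variance, then $$\mathrm{udim}_M(\boldsymbol T)=\mathrm{udim}_H(\boldsymbol T)=2.$$
   Context: Trees. In a one-ended locally finite tree, each vertex $v$ starts a unique infinite simple path; the next vertex on it is the parent $F(v)$ of $v$ (and $v$ is an offspring of $F(v)$). The descendants of $v$ are the vertices of the (finite) component of $v$ after deleting $F(v)$. Unimodular eternal Galton-Watson trees (in the nontrivial case) are characterized as the unimodular one-ended trees in which the subtree of descendants of the root is a Galton-Watson tree; the latter is then necessarily critical. The offspring distribution is the distribution $(p_0,p_1,\dots)$ of the number of offspring in that Galton-Watson tree. Discrete spaces. A discrete space is a metric space $(D,d)$ in which every ball of finite radius is finite (e.g. a connected locally finite graph with graph distance). A pointed discrete space $(D,o)$ has a distinguished point $o$ (origin or root); doubly-pointed ones have two. A marked discrete space carries a function $m:D\times D\to\Xi$ with $\Xi$ a complete separable metric space; $m(x):=m(x,x)$. Isomorphisms are isometries preserving origins and marks. $\mathcal D_*,\mathcal D_{**}$ (resp. $\mathcal D'_*,\mathcal D'_{**}$) are the sets of isomorphism classes of pointed and doubly-pointed discrete spaces (resp. marked ones), with classes in brackets, and the Borel $\sigma$-field of the following metric: $1\wedge$ the infimum of $\epsilon>0$ such that, in both directions, there is an injection from the closed ball of radius $1/\epsilon$ around the origin of one space into the other, preserving origins and changing distances and marks by at most $\epsilon$. A unimodular discrete space is a random element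 $[\boldsymbol D,\boldsymbol o]$ of $\mathcal D_*$ such that $\mathbb E[\sum_{v\in\boldsymbol D}g[\boldsymbol D,\boldsymbol o,v]]=\mathbb E[\sum_{v\in\boldsymbol D}g[\boldsymbol D,v,\boldsymbol o]]$ for all measurable $g:\mathcal D_{**}\to[0,\infty)$. Equivariant processes. An equivariant process with values in $\Xi$ assigns to every deterministic discrete space $D$ a random element $\boldsymbol Z_D$ of $\Xi^{D\times D}$ (extra randomness allowed) such that (i) for every isometry $\rho:D_1\to D_2$, $\boldsymbol Z_{D_1}\circ\rho^{-1}$ has the same distribution as $\boldsymbol Z_{D_2}$; (ii) for every measurable $A\subseteq\mathcal D'_*$, $[D,o]\mapsto\mathbb P[[D,o;\boldsymbol Z_D]\in A]$ is measurable. It suffices that it be defined for almost all realizations of $\boldsymbol D$. An equivariant subset is the set of points with mark 1 in a $\{0,1\}$-valued equivariant process; its intensity is $\mathbb P[\boldsymbol o\in\boldsymbol S_{\boldsymbol D}]$. Dimensions. $N_r(v)=\{u:d(u,v)\le r\}$ for $r\ge1$ and $N_0(v):=\emptyset$. An equivariant $r$-covering is an equivariant subset $\boldsymbol R$ such that the balls $N_r(v)$, $v\in\boldsymbol R_{\boldsymbol D}$, cover $\boldsymbol D$ a.s.; $\lambda_r$ is the infimum of their intensities; $\mathrm{udim}_M(\boldsymbol D):=\lim_{r\to\infty}\frac{-\log\lambda_r}{\log r}$ when the limit exists (the statement includes existence). An equivariant covering is an equivariant process $\boldsymbol R$ with values in $\{0\}\cup[1,\infty)$ on points such that the balls $N_{\boldsymbol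 R(v)}(v)$ cover $\boldsymbol D$ a.s.; $\mathcal H^\alpha_1(\boldsymbol D):=\inf_{\boldsymbol R}\mathbb E[\boldsymbol R(\boldsymbol o)^\alpha]$ over all of them ($0^0:=0$), and $\mathrm{udim}_H(\boldsymbol D):=\sup\{\alpha\ge0:\mathcal H^\alpha_1(\boldsymbol D)=0\}$, $\sup\emptyset:=0$. *)

(* Defs.v *)
Set Warnings "-notation-overridden,-ambiguous-paths,-notation-incompatible-prefix,-redundant-canonical-projection".
From HB Require Import structures.
From mathcomp Require Import all_boot all_order all_algebra.
From mathcomp Require Import all_classical all_reals all_analysis.
From mathcomp Require Import measurable_realfun lra zify.

Set Implicit Arguments.
Unset Strict Implicit.
Unset Printing Implicit Defensive.

Import Order.TTheory GRing.Theory Num.Theory.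
Import numFieldNormedType.Exports.

Local Open Scope classical_set_scope.
Local Open Scope quotient_scope.
Local Open Scope ring_scope.

(** A [metricType] lives in a universe above that of [choiceType]: pointed
    spaces over it could not form a [choiceType], hence no [measurableType].
    For the same reason the carriers of discrete spaces and of mark spaces
    belong to distinct records. *)

Record is_distance (R : realType) (T : Type) (d : T -> T -> R) : Prop :=
  IsDistance {
    distance_eq0 : forall x y, d x y = 0 <-> x = y;
    distance_sym : forall x y, d x y = d y x;
    distance_triangle : forall x y z, d x z <= d x y + d y z
  }.

Record discrete_space (R : realType) := DiscreteSpace {
  carrier :> Type;
  dist : carrier -> carrier -> R;
  dist_distance : is_distance dist;
  finite_dist_ball : forall (x : carrier) (r : R),
    finite_set [set y | dist x y <= r]
}.

HB.instance Definition _ (R : realType) (D : discrete_space R) :=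
  gen_eqMixin (carrier D).
HB.instance Definition _ (R : realType) (D : discrete_space R) :=
  gen_choiceMixin (carrier D).

Lemma sub_distance (R : realType) (T : Type) (d : T -> T -> R) (A : set T) :
  is_distance d -> is_distance (fun x y : {x | A x} => d (sval x) (sval y)).
Proof.
move=> [d0 ds dt]; split=> // x y; split; last by move=> ->; exact/d0.
case: x y => [x Ax] [y Ay] /d0/= xy; exact: eq_exist.
Qed.

Section subspace.
Variables (R : realType) (D : discrete_space R) (A : set D).

Definition subspace_dist (x y : {x | A x}) : R := dist (sval x) (sval y).

Lemma finite_subspace_ball (x : {x | A x}) (r : R) :
  finite_set [set y | subspace_dist x y <= r].
Proof.
apply: (@finite_preimage _ _ [set y : D | dist (sval x) y <= r] sval).
  by move=> [a Aa] [b Ab] _ _ /= ab; exact: eq_exist.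
exact: finite_dist_ball.
Qed.

Definition subspace : discrete_space R :=
  DiscreteSpace (sub_distance A (dist_distance D)) finite_subspace_ball.

End subspace.

Definition complete (R : realType) (T : Type) (d : T -> T -> R) : Prop :=
  forall x : nat -> T,
    (forall e : R, 0 < e -> exists n0 : nat, forall m n : nat,
       (n0 <= m)%N -> (n0 <= n)%N -> d (x m) (x n) < e) ->
    exists l, forall e : R, 0 < e -> exists n0 : nat, forall n : nat,
       (n0 <= n)%N -> d (x n) l < e.

Definition separable (R : realType) (T : Type) (d : T -> T -> R) : Prop :=
  exists2 A : set T, countable A &
    forall x (e : R), 0 < e -> exists2 a, A a & d x a < e.

Record mark_space (R : realType) := MarkSpace {
  mark_carrier :> Type;
  mark_point : mark_carrier;
  mark_dist : mark_carrier -> mark_carrier -> R;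
  mark_distance : is_distance mark_dist;
  mark_complete : complete mark_dist;
  mark_separable : separable mark_dist
}.

Definition mark_open (R : realType) (Xi : mark_space R) (U : set Xi) : Prop :=
  forall x, U x -> exists2 e : R, 0 < e & forall y, mark_dist x y < e -> U y.

Section mark_spaces.
Variable R : realType.

Definition unit_dist (x y : unit) : R := 0.
Lemma unit_distance : is_distance unit_dist.
Proof. by split=> // [[] []|x y z] //; rewrite /unit_dist addr0. Qed.
Lemma unit_complete : complete unit_dist.
Proof. by move=> x _; exists tt => e e0; exists 0%N. Qed.
Lemma unit_separable : separable unit_dist.
Proof.
by exists [set tt]; [exact: countable1 | move=> x e e0; exists tt].
Qed.

(** The one-point space: a space with these marks is an unmarked space. *)
Definition no_mark : mark_space R :=
  MarkSpace tt unit_distance unit_complete unit_separable.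

Definition bool_dist (x y : bool) : R := (x != y)%:R.
Lemma bool_distance : is_distance bool_dist.
Proof.
rewrite /bool_dist; split=> [x y|x y|x y z].
- split; last by move=> ->; rewrite eqxx.
  by case: eqVneq => //= _ /eqP; rewrite oner_eq0.
- by rewrite eq_sym.
- by case: x; case: y; case: z => //=; lra.
Qed.
Lemma bool_complete : complete bool_dist.
Proof.
move=> x /(_ 1 ltr01)[n0 xn0]; exists (x n0) => e e0; exists n0 => n n0n.
have := xn0 _ _ n0n (leqnn n0); rewrite /bool_dist.
by case: eqVneq => //=; rewrite ltxx.
Qed.
Lemma bool_separable : separable bool_dist.
Proof.
exists setT; first exact: (@countableP _ (setT : set bool)).
by move=> x e e0; exists x => //=; rewrite /bool_dist eqxx.
Qed.

Definition bool_mark : mark_space R :=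
  MarkSpace false bool_distance bool_complete bool_separable.

Definition radii : set R := [set x | x = 0 \/ 1 <= x].
Definition radius_dist (x y : {x | radii x}) : R := `|sval x - sval y|.
Lemma radius_distance : is_distance radius_dist.
Proof.
apply: (@sub_distance R R (fun x y => `|x - y|)); split=> [x y|x y|x y z].
- split; first by move=> /normr0_eq0/eqP; rewrite subr_eq0 => /eqP.
  by move=> ->; rewrite subrr normr0.
- exact: distrC.
- exact: ler_distD.
Qed.
Definition radius_point : {x | radii x} := exist _ 0 (or_introl erefl).

Lemma radius_complete : complete radius_dist.
Proof.
move=> x xC; pose u (n : nat) : R := sval (x n).
have /cauchy_cvgP/cvg_ex[l ul] : cauchy (u @ \oo).
  apply: cauchy_exP => e e0; have [n0 n0P] := xC e e0.
  by exists (u n0), n0 => // n /= n0n; exact: n0P.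
have ulP (e : R) : 0 < e -> exists n0 : nat, forall n, (n0 <= n)%N ->
    `|u n - l| < e.
  move=> e0; have /cvgrPdist_lt/(_ e e0)[n0 _ n0P] := ul.
  by exists n0 => n n0n; rewrite distrC; exact: n0P.
have lA : radii l.
  have [->|l0] := eqVneq l 0; first by left.
  right; rewrite leNgt; apply/negP => l1.
  pose e := Num.min `|l| (1 - l).
  have e0 : 0 < e by rewrite lt_min normr_gt0 l0 subr_gt0.
  have [n0 /(_ _ (leqnn n0))] := ulP e e0.
  rewrite lt_min => /andP[].
  have : radii (u n0) by exact: svalP.
  by case=> [->|un]; rewrite ?sub0r ?normrN ?ltxx// => _ /ltr_normlW; lra.
by exists (exist _ l lA) => e /ulP.
Qed.

Lemma radius_separable : separable radius_dist.
Proof.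
pose near_q (qn : rat * nat) (a : {x | radii x}) : Prop :=
  `|ratr qn.1 - sval a| < qn.2.+1%:R^-1.
have /choice[f fP] : forall qn, exists y, forall a, near_q qn a -> near_q qn y.
  move=> qn; have [[a aP]|nP] := pselect (exists a, near_q qn a).
    by exists a.
  by exists radius_point => a aP; case: nP; exists a.
exists (range f).
  by exact/(card_le_trans (card_image_le _ _))/countableP.
move=> x e e0.
have e20 : 0 < e / 2 by rewrite divr_gt0.
have [n ne] : exists n : nat, n.+1%:R^-1 < e / 2 :> R.
  have [n _ /(_ _ (leqnn n))/=] := near_infty_natSinv_lt (PosNum e20).
  by exists n.
have [q] : exists q : rat, `|ratr q - sval x| < n.+1%:R^-1 :> R.
  have n0 : 0 < n.+1%:R^-1 :> R by rewrite invr_gt0.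
  have /rat_in_itvoo[q] : (sval x : R) < sval x + n.+1%:R^-1 by rewrite ltrDl.
  rewrite in_itv/= => /andP[xq qx]; exists q.
  by rewrite ger0_norm ?subr_ge0 ?(ltW xq)// ltrBlDl.
move=> qx; exists (f (q, n)); first by exists (q, n).
have fq : `|ratr q - sval (f (q, n))| < n.+1%:R^-1 := fP (q, n) x qx.
rewrite /radius_dist.
apply: le_lt_trans (ler_distD (ratr q) _ _) _.
rewrite (distrC _ (ratr q)); apply: lt_trans (ltrD qx fq) _.
by rewrite [ltRHS]splitr ltrD.
Qed.

Definition radius_mark : mark_space R :=
  MarkSpace radius_point radius_distance radius_complete radius_separable.

Definition radius (x : radius_mark) : R := sval x.

End mark_spaces.

(** The first of the [k.+1] points is the origin: pointed spaces have [k = 0]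
    and doubly-pointed ones [k = 1]. *)
Record pointed_space (R : realType) (k : nat) (Xi : mark_space R) :=
  PointedSpace {
    space :> discrete_space R;
    points : k.+1.-tuple space;
    mark : space -> space -> Xi
  }.

HB.instance Definition _ (R : realType) (k : nat) (Xi : mark_space R) :=
  gen_eqMixin (pointed_space k Xi).
HB.instance Definition _ (R : realType) (k : nat) (Xi : mark_space R) :=
  gen_choiceMixin (pointed_space k Xi).

Section isomorphism_classes.
Variables (R : realType) (k : nat) (Xi : mark_space R).
Implicit Types S : pointed_space k Xi.

Definition origin S : S := thead (points S).

Definition isomorphic S1 S2 : Prop := exists f : S1 -> S2,
  [/\ bijective f,
      forall x y, dist (f x) (f y) = dist x y,
      map f (points S1) = points S2 :> seq S2 &
      forall x y, mark (f x) (f y) = mark x y].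

Definition isomorphicb S1 S2 : bool := `[< isomorphic S1 S2 >].

Lemma isomorphic_refl : reflexive isomorphicb.
Proof.
move=> S; apply/asboolP; exists id; split=> //; last by rewrite map_id.
by exists id.
Qed.

Lemma isomorphic_sym : symmetric isomorphicb.
Proof.
suff sym S1 S2 : isomorphic S1 S2 -> isomorphic S2 S1.
  by move=> S1 S2; apply/asboolP/asboolP; exact: sym.
move=> [f [[g fK gK] fd fp fm]]; exists g; split; first by exists f.
- by move=> x y; rewrite -fd !gK.
- by rewrite -fp mapK.
- by move=> x y; rewrite -fm !gK.
Qed.

Lemma isomorphic_trans : transitive isomorphicb.
Proof.
move=> S2 S1 S3 /asboolP[f [fb fd fp fm]] /asboolP[g [gb gd gp gm]].
apply/asboolP; exists (g \o f); split; first exact: bij_comp.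
- by move=> x y /=; rewrite gd fd.
- by rewrite map_comp fp gp.
- by move=> x y /=; rewrite gm fm.
Qed.

Definition isomorphism : equiv_rel (pointed_space k Xi) :=
  EquivRel isomorphicb isomorphic_refl isomorphic_sym isomorphic_trans.

Definition iso_class := {eq_quot isomorphism}.

HB.instance Definition _ := Choice.on iso_class.

(** Distinguished points outside of the ball are not constrained; this does not
    change the topology. *)
Definition approximates (e : R) S1 S2 : Prop := exists f : S1 -> S2,
  let B := [set x | dist (origin S1) x <= e^-1] in
  [/\ set_inj B f,
      forall i, B (tnth (points S1) i) ->
        f (tnth (points S1) i) = tnth (points S2) i,
      forall x y, B x -> B y -> `|dist (f x) (f y) - dist x y| <= e &
      forall x y, B x -> B y -> mark_dist (mark (f x) (f y)) (mark x y) <= e].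

Definition class_dist (c1 c2 : iso_class) : \bar R :=
  mine 1%E (ereal_inf [set e%:E | e in [set e : R | [/\ 0 < e,
    approximates e (repr c1) (repr c2) &
    approximates e (repr c2) (repr c1)]]]).

Definition class_open (U : set iso_class) : Prop :=
  forall c, U c -> exists2 e : R, 0 < e &
    forall c', (class_dist c c' < e%:E)%E -> U c'.

Lemma finite_unit_ball (x : unit) (r : R) :
  finite_set [set y | unit_dist R x y <= r].
Proof. by apply: (@sub_finite_set _ _ [set tt]) => // -[]. Qed.

Definition one_point_space : pointed_space k Xi :=
  @PointedSpace R k Xi (DiscreteSpace (unit_distance R) finite_unit_ball)
    (nseq_tuple k.+1 tt) (fun _ _ => mark_point Xi).

HB.instance Definition _ :=
  isPointed.Build iso_class (\pi_iso_class one_point_space)%qT.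

Definition spaces := g_sigma_algebraType class_open.

Definition class (S : pointed_space k Xi) : spaces := (\pi_iso_class S)%qT.

Definition representative (c : spaces) : pointed_space k Xi :=
  repr (c : iso_class).

End isomorphism_classes.

Section pointed_spaces.
Variables (R : realType) (D : discrete_space R).

Definition pointed1 (o : D) : pointed_space 0 (no_mark R) :=
  @PointedSpace R 0 (no_mark R) D [tuple o] (fun _ _ => tt).

Definition pointed2 (o v : D) : pointed_space 1 (no_mark R) :=
  @PointedSpace R 1 (no_mark R) D [tuple o; v] (fun _ _ => tt).

Definition marked (Xi : mark_space R) (o : D) (z : D -> D -> Xi) :
    pointed_space 0 Xi :=
  @PointedSpace R 0 Xi D [tuple o] z.

End pointed_spaces.

Notation D_star R := (@spaces R 0 (no_mark R)).
Notation D_star_star R := (@spaces R 1 (no_mark R)).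
Notation D'_star Xi := (@spaces _ 0 Xi).

Definition unimodular (R : realType) (d : measure_display)
    (Omega : measurableType d) (P : probability Omega R)
    (X : {RV P >-> D_star R}) : Prop :=
  forall g : D_star_star R -> R, measurable_fun setT g ->
    (forall c, 0 <= g c) ->
    (\int[P]_w (let S := representative (X w) in
       \esum_(v in [set: S]) (g (class (pointed2 (origin S) v)))%:E) =
     \int[P]_w (let S := representative (X w) in
       \esum_(v in [set: S]) (g (class (pointed2 v (origin S))))%:E))%E.

Section marking.
Variables (R : realType) (D : discrete_space R) (Xi : mark_space R).

Definition marking := D -> D -> Xi.

HB.instance Definition _ := gen_eqMixin marking.
HB.instance Definition _ := gen_choiceMixin marking.
HB.instance Definition _ :=
  isPointed.Build marking (fun _ _ => mark_point Xi).

Definition cylinders : set (set marking) :=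
  [set C | exists x y (U : set Xi),
     mark_open U /\ C = [set z | U (z x y)]].

Definition markings := g_sigma_algebraType cylinders.

End marking.

(** The random marking of each deterministic space is represented by its law. *)
Record equivariant_process (R : realType) (Xi : mark_space R) :=
  EquivariantProcess {
    law : forall D : discrete_space R, probability (markings D Xi) R;
    law_isometry : forall (D1 D2 : discrete_space R)
      (rho : D1 -> D2) (rho' : D2 -> D1),
      cancel rho rho' -> cancel rho' rho ->
      (forall x y, dist (rho x) (rho y) = dist x y) ->
      forall B : set (markings D2 Xi), measurable B ->
        law D1 [set z | B (fun x y => z (rho' x) (rho' y))] = law D2 B;
    law_measurable : forall A : set (D'_star Xi), measurable A ->
      measurable_fun [set: D_star R] (fun c : D_star R =>
        law (representative c)
          [set z | A (class (marked (origin (representative c)) z))])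
  }.

Section dimensions.
Variable R : realType.

Definition dist_ball (D : discrete_space R) (r : R) (v : D) : set D :=
  if r == 0 then set0 else [set u | dist u v <= r].

Variables (d : measure_display) (Omega : measurableType d).
Variables (P : probability Omega R) (X : {RV P >-> D_star R}).

Local Notation D w := (representative (X w)).

Definition intensity (S : equivariant_process (bool_mark R)) : \bar R :=
  (\int[P]_w law S (D w) [set z | z (origin (D w)) (origin (D w)) = true])%E.

Definition is_r_covering (r : R)
    (S : equivariant_process (bool_mark R)) : Prop :=
  {ae P, forall w, {ae law S (D w), forall z, forall u : D w,
    exists2 v : D w, z v v = true & dist_ball r v u}}.

Definition lambda (r : R) : \bar R :=
  ereal_inf [set intensity S | S in is_r_covering r].

Definition has_udimM (l : \bar R) : Prop :=
  (- lne (lambda r) * ((ln r)^-1)%:E)%E @[r --> +oo%R] --> l.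

Definition is_covering (S : equivariant_process (radius_mark R)) : Prop :=
  {ae P, forall w, {ae law S (D w), forall z, forall u : D w,
    exists v : D w, dist_ball (radius (z v v)) v u}}.

Definition cover_pow (alpha x : R) : R := if x == 0 then 0 else x `^ alpha.

Definition mean_pow (alpha : R) (S : equivariant_process (radius_mark R)) :
    \bar R :=
  (\int[P]_w \int[law S (D w)]_z
     (cover_pow alpha (radius (z (origin (D w)) (origin (D w)))))%:E)%E.

Definition H1 (alpha : R) : \bar R :=
  ereal_inf [set mean_pow alpha S | S in is_covering].

Definition udimH : \bar R :=
  let A := [set alpha%:E | alpha in [set a : R | 0 <= a /\ H1 a = 0%E]] in
  if A == set0 then 0%E else ereal_sup A.

End dimensions.

Section trees.
Variables (R : realType) (D : discrete_space R).

Definition adjacent : rel D := fun u v => dist u v == 1.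

Definition is_graph_distance : Prop := forall u v : D,
  (exists p, [/\ path adjacent u p, last u p = v &
                 dist u v = (size p)%:R]) /\
  (forall p, path adjacent u p -> last u p = v -> dist u v <= (size p)%:R).

Definition acyclic : Prop :=
  forall c : seq D, ucycle adjacent c -> (size c <= 2)%N.

(** [D] is a tree with its graph distance; local finiteness is
    [finite_dist_ball]. *)
Definition is_tree : Prop := is_graph_distance /\ acyclic.

Definition is_ray (f : nat -> D) : Prop :=
  injective f /\ forall n, adjacent (f n) (f n.+1).

Definition same_end (f g : nat -> D) : Prop :=
  finite_set (range f `\` range g) /\ finite_set (range g `\` range f).

Definition one_ended : Prop :=
  (exists f, is_ray f) /\
  (forall f g, is_ray f -> is_ray g -> same_end f g).

Definition is_parent (w v : D) : Prop :=
  exists f, [/\ is_ray f, f 0%N = v & f 1%N = w].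

Definition descendants (v : D) : set D := [set u | exists p,
  [/\ path adjacent v p, last v p = u &
      forall w, is_parent w v -> w \notin p]].

Lemma descendants_root (v : D) : descendants v v.
Proof. by exists [::]. Qed.

Definition descendant_tree (v : D) : pointed_space 0 (no_mark R) :=
  @pointed1 R (subspace (descendants v)) (exist _ v (descendants_root v)).

End trees.

(** Ulam-Harris encoding: vertices are the words over [nat], the offspring of
    [v] are the words [rcons v i], and [N v] is the number of those that are
    kept. *)

Fixpoint common_prefix (u v : seq nat) : nat :=
  match u, v with
  | i :: u', j :: v' => if i == j then (common_prefix u' v').+1 else 0
  | _, _ => 0
  end.

(** [|u| + |v| - 2 |u /\ v|], with [u /\ v] the longest common prefix *)
Definition word_dist (u v : seq nat) : nat :=
  (size u - common_prefix u v) + (size v - common_prefix u v).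

Definition gw_vertex (N : seq nat -> nat) (w : seq nat) : Prop :=
  forall v i u, w = rcons v i ++ u -> (i < N v)%N.

Section galton_watson_tree.
Variables (R : realType) (N : seq nat -> nat).

Lemma common_prefixC u v : common_prefix u v = common_prefix v u.
Proof.
by elim: u v => [|i u IH] [|j v] //=; rewrite eq_sym IH.
Qed.

Lemma common_prefix_le u v : (common_prefix u v <= size u)%N.
Proof.
by elim: u v => [|i u IH] [|j v] //=; case: eqP => // _; rewrite ltnS.
Qed.

Lemma common_prefix_ge u v w :
  (minn (common_prefix u v) (common_prefix v w) <= common_prefix u w)%N.
Proof.
elim: u v w => [|i u IH] [|j v] [|k w] //=; rewrite ?min0n ?minn0 //.
case: eqVneq => [->|_]; last by rewrite min0n.
by case: eqVneq => // _; rewrite minnSS ltnS.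
Qed.

Lemma common_prefix_full u v :
  common_prefix u v = size u -> common_prefix u v = size v -> u = v.
Proof.
elim: u v => [|i u IH] [|j v] //=; case: eqVneq => // -> [uE] [vE].
by rewrite (IH v).
Qed.

Lemma word_distance :
  is_distance (fun u v : seq nat => (word_dist u v)%:R : R).
Proof.
rewrite /word_dist; split=> [u v|u v|u v w].
- split=> [/eqP|->].
    rewrite pnatr_eq0 addn_eq0 !subn_eq0 => /andP[uv vu].
    apply: common_prefix_full; apply/eqP; rewrite eqn_leq ?uv ?vu andbT.
      exact: common_prefix_le.
    by rewrite common_prefixC; exact: common_prefix_le.
  suff -> : common_prefix v v = size v by rewrite subnn.
  by elim: v => //= i v ->; rewrite eqxx.
- by rewrite (common_prefixC v u) addnC.
- rewrite -natrD ler_nat.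
  have := common_prefix_ge u v w.
  have := common_prefix_le u v; have := common_prefix_le v w.
  have := common_prefix_le u w; have := common_prefix_le v u.
  have := common_prefix_le w v; have := common_prefix_le w u.
  rewrite (common_prefixC w u) (common_prefixC w v) (common_prefixC v u).
  lia.
Qed.

Definition gw_dist (u v : {w | gw_vertex N w}) : R := (word_dist (sval u) (sval v))%:R.

Lemma finite_generation n : finite_set [set w | gw_vertex N w /\ size w = n].
Proof.
elim: n => [|n IH].
  by apply: (@sub_finite_set _ _ [set [::]]) => // w [_ /size0nil].
apply: (@sub_finite_set _ _ (\bigcup_(v in [set w | gw_vertex N w /\ size w = n])
    (rcons v @` `I_(N v)))).
  move=> w; case/lastP: w => [[]//|v i] [Nvi]; rewrite size_rcons => -[vn].
  exists v; last first.
    by exists i => //=; apply: (Nvi _ _ [::]); rewrite cats0.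
  split=> // v' j u vE; apply: (Nvi v' j (rcons u i)).
  by rewrite vE rcons_cat.
by apply: bigcup_finite => // v _; exact/finite_image/finite_II.
Qed.

Lemma finite_gw_ball (x : {w | gw_vertex N w}) (r : R) :
  finite_set [set y | gw_dist x y <= r].
Proof.
pose n := (size (sval x) + Num.truncn `|r|).+1.
apply: (@sub_finite_set _ _
    (sval @^-1` (\bigcup_(i in `I_n) [set w | gw_vertex N w /\ size w = i]))).
  move=> y /=; rewrite /gw_dist => xyr.
  exists (size (sval y)); last by split=> //; exact: svalP.
  have : (word_dist (sval x) (sval y) <= Num.truncn `|r|)%N.
    by rewrite truncn_ge_nat// (le_trans xyr)// ler_norm.
  rewrite /= /n /word_dist; have := common_prefix_le (sval x) (sval y).
  lia.
apply: finite_preimage.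
  by move=> [a Aa] [b Ab] _ _ /= ab; exact: eq_exist.
by apply: bigcup_finite; [exact: finite_II|move=> i _; exact: finite_generation].
Qed.

Definition gw_space : discrete_space R :=
  DiscreteSpace (sub_distance (gw_vertex N) word_distance) finite_gw_ball.

Lemma gw_vertex_root : gw_vertex N [::].
Proof. by move=> v i u; case: v. Qed.

Definition gw_tree : pointed_space 0 (no_mark R) :=
  @pointed1 R gw_space (exist _ [::] gw_vertex_root).

End galton_watson_tree.

Section eternal_galton_watson.
Variable R : realType.

(** A singleton [s] gives the common distribution [p] of the [N v]. *)
Definition iid_offspring (d : measure_display) (Omega : measurableType d)
    (Q : probability Omega R) (p : probability nat R)
    (N : seq nat -> Omega -> nat) : Prop :=
  (forall v, measurable_fun setT (N v)) /\
  (forall (s : seq (seq nat)) (B : seq nat -> set nat), uniq s ->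
     Q (\bigcap_(v in [set` s]) (N v @^-1` B v)) =
     (\prod_(v <- s) p (B v))%E).

Definition is_galton_watson (d : measure_display) (Omega : measurableType d)
    (P : probability Omega R) (p : probability nat R)
    (Y : {RV P >-> D_star R}) : Prop :=
  exists (d' : measure_display) (Omega' : measurableType d')
    (Q : probability Omega' R) (N : seq nat -> Omega' -> nat),
    iid_offspring Q p N /\
    forall A : set (D_star R), measurable A ->
      P (Y @^-1` A) = Q [set w | A (class (gw_tree R (N ^~ w)))].

(** This characterizes the nontrivial eternal Galton-Watson trees only: if each
    vertex has exactly one offspring, the tree is a bi-infinite path, which has
    two ends. [Y] is a measurable version of the subtree of descendants of the
    root. *)
Definition is_eternal_galton_watson (d : measure_display)
    (Omega : measurableType d) (P : probability Omega R)
    (p : probability nat R) (X : {RV P >-> D_star R}) : Prop :=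
  [/\ unimodular X,
      {ae P, forall w, is_tree (representative (X w)) /\
                       one_ended (representative (X w))} &
      exists2 Y : {RV P >-> D_star R},
        {ae P, forall w, Y w =
          class (descendant_tree (origin (representative (X w))))} &
        is_galton_watson p Y].

End eternal_galton_watson.

(* Main.v *)
(** A one-ended tree has a height function [b] along its end, defined up to a
    constant, with [b (F x) = b x - 1].

    Upper bounds: choose at random one of the [n + 1] residue classes of heights
    modulo [n + 1] and keep its vertices that have descendants [n] generations
    below. Each vertex [u] has such an ancestor at distance between [n] and [2 n].
    The intensity is [q n / (n + 1)], where [q n] is the probability that the
    descendant tree of the root reaches generation [n]. That tree is critical (by
    mass transport) and [c = p (1, oo) > 0], hence [q n <= 1 / (1 + c n)], and the
    intensity is of order [n ^ -2].

    Lower bounds: the ball of radius [r] around the root lies below its [r]-th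
    ancestor, so mass transport bounds its mean size by the second moments of the
    first [2 r] generations, that is by [C r ^ 2] if the variance is finite. Fix
    [alpha > 2] and call a point light if for all [j] its ball of radius [B ^ j] has
    at most [4 C B ^ (2 j) 2 ^ j] points. By Markov's
    inequality the root is light with probability at least [1 / 2], while each ball
    of radius [r >= 1] contains at most [K r ^ alpha] light points if [B] is large.
    When every light point receives a unit mass from a point whose ball covers it,
    mass transport yields [1 / 2 <= K E (R o) ^ alpha] for all coverings [R]. *)

Require Import Defs.
Set Warnings "-notation-overridden,-ambiguous-paths,-notation-incompatible-prefix,-redundant-canonical-projection".
From HB Require Import structures.
From mathcomp Require Import all_boot all_order all_algebra.
From mathcomp Require Import all_classical all_reals all_analysis.
From mathcomp Require Import finmap measurable_realfun ring lra zify.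
Import Defs.

Set Implicit Arguments.
Unset Strict Implicit.
Unset Printing Implicit Defensive.

Import Order.TTheory GRing.Theory Num.Theory.
Import numFieldNormedType.Exports.

Local Open Scope classical_set_scope.
Local Open Scope ring_scope.

(** The main obstacle is measurability. The sigma-field on classes only sees finite balls up to
    small errors, while heights and ancestors depend on the end of the tree. They are therefore
    expressed by Busemann differences: [ndist x w - ndist y w] is the same for all but finitely many
    [w], so it can be read on a large sphere, and each predicate on heights is an eventual limit of
    predicates on balls, hence measurable. Busemann differences also need no ray and no origin. The
    height itself is known up to a constant only; since shifting it permutes the residue classes, a
    uniform residue has a law that does not depend on the base point, as equivariance requires. This
    law must exist on every discrete space, hence a default on those without Busemann differences.
    Finally, sums over a chosen representative are not known to be measurable in the random point,
    so the integrals on the probability space are compared as lower integrals; mass transport is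
    only applied to kernels that are measurable on classes. *)

Lemma measurable_EFin_indic (d : measure_display) (T : measurableType d) (R : realType)
    (A : set T) : measurable A -> measurable_fun setT (fun x => (\1_A x)%:E : \bar R).
Proof. by move=> mA; apply/measurable_EFinP; exact: measurable_indic. Qed.

(** * Integrals of functions not known to be measurable *)

Section lower_integral.
Import HBNNSimple.
Local Open Scope ereal_scope.
Variables (d : measure_display) (T : measurableType d) (R : realType).
Variable mu : {measure set T -> \bar R}.

(* Not assuming measurability: the integral of a nonnegative function is a lower integral. *)
Lemma ge0_ae_le_integralT (f g : T -> \bar R) :
  (forall x, 0 <= f x) -> (forall x, 0 <= g x) ->
  {ae mu, forall x, f x <= g x} -> \int[mu]_x f x <= \int[mu]_x g x.
Proof.
move=> f0 g0 [N [mN N0 fgN]].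
rewrite [leLHS]ge0_integralTE// [leRHS]ge0_integralTE//.
apply: ge_ereal_sup => _ [h hf <-].
have mCN : measurable (~` N) by exact: measurableC.
(* Setting [h] to 0 on the null set [N] keeps its integral and puts it below [g] everywhere. *)
have -> : sintegral mu h = sintegral mu (proj_nnsfun h mCN).
  rewrite -!integralT_nnsfun.
  apply: ge0_ae_eq_integral => //.
  - by apply/measurable_EFinP; exact: measurable_funP.
  - by apply/measurable_EFinP; exact: measurable_funP.
  - by move=> x _; rewrite lee_fin; exact: fun_ge0.
  - by move=> x _; rewrite lee_fin; exact: fun_ge0.
  exists N; split=> // x /= /not_implyP[_]; apply: contra_notP => Nx.
  rewrite /= /proj_nnsfun/= /mindic indicE mem_set ?mulr1//.
apply: ereal_sup_ubound; exists (proj_nnsfun h mCN) => //= x.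
have [Nx|Nx] := pselect (N x).
  by rewrite /= /mindic indicE memNset ?mulr0//; exact.
rewrite /= /mindic indicE mem_set ?mulr1//.
apply: le_trans (hf x) _; apply: contrapT => fgx; exact/Nx/fgN.
Qed.

Lemma ge0_le_integralT (f g : T -> \bar R) :
  (forall x, 0 <= f x) -> (forall x, f x <= g x) ->
  \int[mu]_x f x <= \int[mu]_x g x.
Proof.
move=> f0 fg; apply: ge0_ae_le_integralT => //; last exact: aeW.
by move=> x; exact: le_trans (f0 x) (fg x).
Qed.

Lemma ge0_ae_eq_integralT (f g : T -> \bar R) :
  (forall x, 0 <= f x) -> (forall x, 0 <= g x) ->
  {ae mu, forall x, f x = g x} -> \int[mu]_x f x = \int[mu]_x g x.
Proof.
move=> f0 g0 fg; apply/eqP; rewrite eq_le; apply/andP; split.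
  by apply: ge0_ae_le_integralT => //; apply: filterS fg => x ->.
by apply: ge0_ae_le_integralT => //; apply: filterS fg => x ->.
Qed.

(** Division by [c] maps the simple functions below [c * f] to simple functions below [f]; this
    replaces linearity when [f] is arbitrary. *)
Lemma ge0_integralZl_le (c : R) (f : T -> \bar R) : (0 < c)%R -> (forall x, 0 <= f x) ->
  \int[mu]_x (c%:E * f x) <= c%:E * \int[mu]_x f x.
Proof.
move=> c0 f0; have ci0 : (0 <= c^-1)%R by rewrite invr_ge0 ltW.
rewrite [leLHS]ge0_integralTE; last by move=> x; rewrite mule_ge0// lee_fin ltW.
apply: ge_ereal_sup => _ [h hf <-].
have -> : sintegral mu h = c%:E * \int[mu]_x (scale_nnsfun h ci0 x)%:E.
  have mh : measurable_fun setT (fun x => (scale_nnsfun h ci0 x)%:E).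
    by apply/measurable_EFinP; exact: measurable_funP.
  rewrite -integralT_nnsfun -ge0_integralZl//; last 2 first.
  - by move=> x _; rewrite lee_fin.
  - by rewrite lee_fin ltW.
  by apply: eq_integral => x _; rewrite -EFinM mulrA mulfV ?mul1r// lt0r_neq0.
rewrite lee_wpmul2l ?lee_fin ?(ltW c0)//; apply: ge0_le_integralT => x.
  by rewrite lee_fin.
have := hf x; rewrite /= EFinM => hfx.
have := lee_wpmul2l (y := c%:E * f x) (_ : 0 <= c^-1%:E) hfx.
by rewrite muleA -(EFinM c^-1 c) mulVf ?lt0r_neq0// mul1e; apply; rewrite lee_fin.
Qed.

End lower_integral.

(** * One-ended trees *)

Section integral_spaces.
Variables (R : realType) (D : discrete_space R).
Implicit Types x y z : D.

Lemma distxx x : dist x x = 0.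
Proof. by case: (dist_distance D) => d0 _ _; apply/d0. Qed.

Lemma dist_eq0 x y : dist x y = 0 -> x = y.
Proof. by case: (dist_distance D) => d0 _ _ /d0. Qed.

Lemma distC x y : dist x y = dist y x.
Proof. by case: (dist_distance D). Qed.

Lemma dist_tri y x z : dist x z <= dist x y + dist y z.
Proof. by case: (dist_distance D). Qed.

Lemma dist_ge0 x y : 0 <= dist x y.
Proof.
have := dist_tri y x x; rewrite distxx (distC y x) -mulr2n.
by rewrite pmulrn_lge0.
Qed.

Lemma finite_closed_ball x (r : R) : finite_set [set y | dist x y <= r].
Proof. exact: finite_dist_ball. Qed.

(** Truncation makes this total; it is the true distance on integral spaces, in particular on
    trees. *)
Definition ndist x y : nat := Num.truncn (dist x y).

Definition integral_space : Prop := forall x y, dist x y = (ndist x y)%:R.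

Hypothesis intD : integral_space.

Lemma ndistxx x : ndist x x = 0%N.
Proof. by rewrite /ndist distxx truncn0. Qed.

Lemma ndistC x y : ndist x y = ndist y x.
Proof. by rewrite /ndist distC. Qed.

Lemma ndist_eq0 x y : ndist x y = 0%N -> x = y.
Proof. by move=> xy; apply: dist_eq0; rewrite intD xy. Qed.

Lemma ndist_tri y x z : (ndist x z <= ndist x y + ndist y z)%N.
Proof. by have := dist_tri y x z; rewrite !intD -natrD ler_nat. Qed.

Lemma finite_nball x (n : nat) : finite_set [set y | (ndist x y <= n)%N].
Proof.
apply: sub_finite_set (finite_closed_ball x n%:R) => y /=.
by rewrite intD ler_nat.
Qed.

End integral_spaces.

Section trees.
Variables (R : realType) (D : discrete_space R).
Hypothesis treeD : is_tree D.
Implicit Types x y z u v w : D.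

Lemma tree_integral : integral_space D.
Proof.
move=> x y; have [[p [_ _ xy]] _] := treeD.1 x y.
by rewrite /ndist xy natrK.
Qed.

Local Notation nd := (@ndist R D).

Lemma adjacentE x y : adjacent x y = (nd x y == 1%N).
Proof. by rewrite /adjacent tree_integral pnatr_eq1. Qed.

Lemma ndist_path u p : path (@adjacent R D) u p -> (nd u (last u p) <= size p)%N.
Proof.
move=> up; have [_ /(_ p up erefl)] := treeD.1 u (last u p).
by rewrite tree_integral ler_nat.
Qed.

Lemma ndist_step x u n : nd x u = n.+1 -> exists2 y, nd x y = 1%N & nd y u = n.
Proof.
move=> xu; have [[p [xp pu xuE]] _] := treeD.1 x u.
have {xuE} : nd x u = size p by rewrite /ndist xuE natrK.
rewrite xu; case: p xp pu => //= y p /andP[]; rewrite adjacentE => /eqP xy yp pu [np].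
exists y => //; apply/eqP; rewrite eqn_leq; apply/andP; split.
  by rewrite np -pu; exact: ndist_path.
by have := ndist_tri tree_integral y x u; rewrite xu xy add1n ltnS.
Qed.

Lemma geodesic_path x u : exists p, [/\ path (@adjacent R D) x p, last x p = u &
  forall z, z \in p -> (nd z u < nd x u)%N].
Proof.
have [n] := ubnP (nd x u); elim: n x => // n IH x.
case xu: (nd x u) => [|m]; first by exists [::]; split=> //; exact: (ndist_eq0 tree_integral).
rewrite ltnS => mn; have [y xy yu] := ndist_step xu.
have [|p [yp pu pP]] := IH y; first by rewrite yu.
exists (y :: p); split=> //=; first by rewrite adjacentE xy.
move=> z; rewrite inE => /orP[/eqP->|/pP]; first by rewrite yu.
by rewrite yu => /ltnW zm; rewrite ltnS.
Qed.

Let reach v y z : Prop := exists p,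
  [/\ path (@adjacent R D) y p, last y p = z & v \notin y :: p].

Let reach_sym v y z : reach v y z -> reach v z y.
Proof.
case=> p [yp pz vp]; exists (rev (belast y p)); split.
- rewrite -pz rev_path; apply: sub_path yp => a b.
  by rewrite !adjacentE ndistC.
- by rewrite -pz; case: (p) => [|a q] /=; rewrite ?rev_cons ?last_rcons.
- move: vp; apply: contra; rewrite inE mem_rev => /orP[/eqP->|].
    by rewrite -pz mem_last.
  exact: mem_belast.
Qed.

Let reach_trans v x y z : reach v x y -> reach v y z -> reach v x z.
Proof.
case=> p [xp py vp] [q [yq qz vq]]; exists (p ++ q); split.
- by rewrite cat_path xp py.
- by rewrite last_cat py.
- move: vp vq; rewrite !inE mem_cat !negb_or => /andP[-> ->] /=.
  by move=> /andP[].
Qed.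

(** A geodesic from [y] to [u] continues through points closer to [u] than [y], so it cannot meet
    [v], which is at least as far. *)
Let reach_closer v u y : nd v y = 1%N -> (nd u y <= nd u v)%N -> reach v y u.
Proof.
move=> vy; rewrite !(ndistC u) => yv.
have [p [yp pu pP]] := geodesic_path y u.
exists p; split=> //; rewrite inE negb_or; apply/andP; split.
  by apply/eqP => vyE; move: vy; rewrite vyE ndistxx.
by apply/negP => /pP; rewrite ltnNge yv.
Qed.

(* Two such neighbours, joined by a path avoiding [v], would close a cycle through [v]. *)
Lemma closer_neighbour_unique v u y y' : nd v y = 1%N -> nd v y' = 1%N ->
  (nd u y <= nd u v)%N -> (nd u y' <= nd u v)%N -> y = y'.
Proof.
move=> vy vy' uy uy'; apply: contrapT => yy'.
have [p [yp py' vp]] : reach v y y'.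
  by apply: reach_trans (reach_closer vy uy) (reach_sym (reach_closer vy' uy')).
case/shortenP: yp py' => q yq uq qp qy'.
have : ucycle (@adjacent R D) (v :: y :: q).
  rewrite /ucycle /= rcons_path yq/= qy' !adjacentE vy ndistC vy' /=.
  have -> : (y \notin q) && uniq q by [].
  rewrite andbT inE negb_or.
  move: vp; rewrite inE negb_or => /andP[-> /=].
  by apply: contra; exact: qp.
move=> /(treeD.2); case: q {yq uq qp} qy' => //= /yy'.
Qed.

Lemma ray_shift (g : nat -> D) k : is_ray g -> is_ray (fun n => g (k + n)%N).
Proof.
move=> [gI gA]; split; first by move=> m n /gI/addnI.
by move=> n; rewrite addnS.
Qed.

(** A ray cannot turn back: otherwise [g n] and [g n.+2] would be two neighbours of [g n.+1],
    neither farther from [g 0] than [g n.+1], hence equal. *)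
Lemma ray_geodesic0 (g : nat -> D) n : is_ray g -> nd (g 0%N) (g n) = n.
Proof.
move=> [gI gA].
elim/ltn_ind: n => -[|[|n]] IH; first by rewrite ndistxx.
  by apply/eqP; rewrite -adjacentE.
have n0 := IH n (leqnSn _); have n1 := IH n.+1 (ltnSn _).
have e1 : nd (g n.+1) (g n) = 1%N by apply/eqP; rewrite ndistC -adjacentE.
have e2 : nd (g n.+1) (g n.+2) = 1%N by apply/eqP; rewrite -adjacentE.
have : ~ (nd (g 0%N) (g n.+2) <= n.+1)%N.
  move=> le2; have /gI : g n = g n.+2.
    by apply: (@closer_neighbour_unique (g n.+1) (g 0%N)) => //; rewrite ?n0 n1.
  by lia.
have := ndist_tri tree_integral (g n.+1) (g 0%N) (g n.+2).
lia.
Qed.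

Lemma ray_geodesic (g : nat -> D) m n : is_ray g -> nd (g m) (g (m + n)%N) = n.
Proof.
by move=> gR; have := ray_geodesic0 n (ray_shift m gR); rewrite addn0.
Qed.

End trees.

Section one_ended_trees.
Variables (R : realType) (D : discrete_space R).
Hypotheses (treeD : is_tree D) (oneD : one_ended D).
Implicit Types x y z u v w : D.
Local Notation nd := (@ndist R D).
Let intD : integral_space D := tree_integral treeD.

Variable f : nat -> D.
Hypothesis rayf : is_ray f.

(** Along the ray, [nd x (f n) - n] is a nonincreasing integer sequence bounded below, hence
    eventually constant. *)
Lemma exists_busemann x :
  exists b : int, exists N, forall n, (N <= n)%N -> (nd x (f n))%:Z = n%:Z + b.
Proof.
(* Adding [nd x (f 0)] makes the sequence natural-valued; its least value [k] is its limit. *)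
pose Q k := `[< exists n, (nd x (f n) + nd x (f 0%N) = n + k)%N >].
have bound n : (n <= nd x (f n) + nd x (f 0%N))%N.
  rewrite -{1}(ray_geodesic0 treeD n rayf) addnC (ndistC x (f 0%N)).
  exact: ndist_tri.
have exQ : exists k, Q k.
  exists (nd x (f 0%N) + nd x (f 0%N))%N; apply/asboolP.
  by exists 0%N; rewrite add0n.
case: (ex_minnP exQ) => k /asboolP[N kN] kmin.
exists (k%:Z - (nd x (f 0%N))%:Z), N => n Nn.
suff : (nd x (f n) + nd x (f 0%N) = n + k)%N by lia.
have : (k <= nd x (f n) + nd x (f 0%N) - n)%N.
  by apply: kmin; apply/asboolP; exists n; rewrite subnKC.
have := ndist_tri intD (f N) x (f n).
have := ray_geodesic treeD N (n - N) rayf; rewrite subnKC//.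
have := bound n; lia.
Qed.

Lemma one_ended_busemann : exists b : D -> int, forall x,
  exists N, forall n, (N <= n)%N -> (nd x (f n))%:Z = n%:Z + b x.
Proof. by have /choice[b bP] := exists_busemann; exists b. Qed.

Variable b : D -> int.
Hypothesis bP : forall x, exists N, forall n, (N <= n)%N ->
  (nd x (f n))%:Z = n%:Z + b x.

Let far2 x y : exists N, forall n, (N <= n)%N ->
  (nd x (f n))%:Z = n%:Z + b x /\ (nd y (f n))%:Z = n%:Z + b y.
Proof.
have [N HN] := bP x; have [M HM] := bP y; exists (maxn N M) => n.
by rewrite geq_max => /andP[/HN ? /HM ?].
Qed.

Lemma b_lip x y : b y - b x <= (nd x y)%:Z.
Proof.
have [N HN] := far2 x y; have [] := HN N (leqnn N).
have := ndist_tri intD x y (f N); rewrite (ndistC y x); lia.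
Qed.

Lemma b_ray n : b (f n) = - n%:Z.
Proof.
have [N HN] := bP (f n); have := HN (n + N)%N (leq_addl _ _).
rewrite ray_geodesic//; lia.
Qed.

(** The first step of a geodesic to a far point of the ray lowers [b] by at least 1, and [b_lip]
    forbids more. *)
Lemma exists_parent x : exists y, nd x y = 1%N /\ b y = b x - 1.
Proof.
have [N HN] := bP x; pose n := (N + `|b x|%N).+1.
have nx : (nd x (f n))%:Z = n%:Z + b x by apply: HN; rewrite /n; lia.
have [m xm] : exists m, nd x (f n) = m.+1.
  by exists (nd x (f n)).-1; rewrite prednK//; move: nx; rewrite /n; lia.
have [y xy ym] := ndist_step treeD xm; exists y; split=> //.
have := b_lip y x; rewrite ndistC xy.
have [M HM] := bP y; pose k := (n + M)%N.
have := HM k (leq_addl _ _).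
have := ndist_tri intD (f n) y (f k); rewrite ray_geodesic// ym /k; lia.
Qed.

Lemma lower_neighbour_unique x y y' : nd x y = 1%N -> nd x y' = 1%N ->
  b y <= b x -> b y' <= b x -> y = y'.
Proof.
move=> xy xy' yx yx'; have [N HN] := far2 x y; have [M HM] := bP y'.
have [Hx Hy] := HN (maxn N M) (leq_maxl _ _).
have Hy' := HM (maxn N M) (leq_maxr _ _).
by apply: (@closer_neighbour_unique _ _ treeD x (f (maxn N M)));
  rewrite // !(ndistC (f _)); lia.
Qed.

Variable F : D -> D.
Hypothesis FP : forall x, nd x (F x) = 1%N /\ b (F x) = b x - 1.

Lemma parent_unique x y : nd x y = 1%N -> b y <= b x -> y = F x.
Proof.
move=> xy yx; have [xF Fx] := FP x.
by apply: (@lower_neighbour_unique x) => //; rewrite Fx; lia.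
Qed.

Lemma neighbourP x y : nd x y = 1%N -> y = F x \/ F y = x.
Proof.
move=> xy; have [yx|yx] := leP (b y) (b x); first by left; exact: parent_unique.
by right; apply/esym/parent_unique; rewrite ?(ltW yx)// ndistC.
Qed.

Lemma b_iter k x : b (iter k F x) = b x - k%:Z.
Proof. by elim: k => [|k IH] /=; rewrite ?subr0// (FP _).2 IH; lia. Qed.

Lemma nd_iter k x : nd x (iter k F x) = k.
Proof.
have := b_lip (iter k F x) x; rewrite b_iter ndistC.
suff : (nd x (iter k F x) <= k)%N by lia.
elim: k => [|k IH] /=; first by rewrite ndistxx.
have := ndist_tri intD (iter k F x) x (F (iter k F x)).
by rewrite (FP _).1; lia.
Qed.

(** Losing [k] units of [b] in [k] steps forces each step of a geodesic to lower [b], hence to be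
    [F]. *)
Lemma upward k x y : nd x y = k -> b y = b x - k%:Z -> y = iter k F x.
Proof.
elim: k x => [x /(ndist_eq0 intD)//|k IH x xy yx].
have [z xz zy] := ndist_step treeD xy.
have zF : z = F x.
  apply: parent_unique => //; have := b_lip y z; rewrite ndistC zy; lia.
by rewrite iterSr -zF; apply: IH => //; rewrite zF (FP _).2; lia.
Qed.

(** The second argument is the descendant; [z] is below itself. *)
Definition below z x : Prop := exists k, iter k F x = z.

Lemma belowE z x : below z x <-> (nd x z)%:Z = b x - b z.
Proof.
split=> [[k <-]|xz]; first by rewrite nd_iter b_iter; lia.
by exists (nd x z); apply/esym/upward => //; rewrite xz; lia.
Qed.

Lemma below_trans x y z : below x y -> below y z -> below x z.
Proof. by move=> [i <-] [j <-]; exists (i + j)%N; rewrite iterD. Qed.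

Lemma common_ancestor x y : exists i j, iter i F x = iter j F y.
Proof.
have [N HN] := far2 x y; have [xN yN] := HN N (leqnn N).
exists (nd x (f N)), (nd y (f N)).
by rewrite -(@upward _ x (f N))// -1?(@upward _ y (f N))// b_ray; lia.
Qed.

(** If [w] does not descend from [x], geodesics from [x] to [w] start with [F x]. *)
Lemma away x w : ~ below x w -> nd x w = (nd (F x) w).+1.
Proof.
move=> nxw; case xw: (nd x w) => [|n].
  by case: nxw; exists 0%N; rewrite /= (ndist_eq0 intD xw).
have [z xz zw] := ndist_step treeD xw.
have [zF|Fz] := neighbourP xz; first by rewrite -zF zw.
(* A geodesic that starts downwards stays downwards: a step up would return to the vertex just
   left. *)
case: nxw; elim: n x z xw xz zw Fz => [|n IH] x z xw xz zw Fz.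
  by exists 1%N; rewrite /= -(ndist_eq0 intD zw).
have [z' zz' z'w] := ndist_step treeD zw.
have [z'F|Fz'] := neighbourP zz'; last first.
  apply: (@below_trans _ z); first by exists 1%N.
  exact: (IH _ z').
by move: z'w; rewrite z'F Fz xw; lia.
Qed.

(** If [u] escaped the [r]-th ancestor, it would escape the earlier ones too, and by [away] a
    geodesic from [o] to [u] would begin with [r.+1] steps up. *)
Lemma below_near r o u : (nd o u <= r)%N -> below (iter r F o) u.
Proof.
move=> our; apply: contrapT => nb.
have nbt t : (t <= r)%N -> ~ below (iter t F o) u.
  move=> tr bt; apply: nb; apply: (below_trans _ bt).
  by exists (r - t)%N; rewrite -iterD subnK.
have dt t : (t <= r.+1)%N -> (nd o u = t + nd (iter t F o) u)%N.
  elim: t => [//|t IH] tr; rewrite IH ?(ltnW tr)//.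
  by rewrite (away (nbt _ _))// addnS.
by have := dt _ (leqnn _); lia.
Qed.

Lemma no_descending_ray (g : nat -> D) :
  is_ray g -> ~ (forall n, b (g n) = b (g 0%N) + n%:Z).
Proof.
move=> gR bg; have [+ _] := (oneD.2 g f gR rayf).
(* From index [K] on, [g] has positive heights, whereas those of [f] are at most 0: an infinite tail
   of [g] misses [f], so the ends differ. *)
pose K := (`|b (g 0%N)|.+1)%N.
pose h n := g (K + n)%N.
have hA : range h `<=` range g `\` range f.
  move=> _ [n _ <-]; split; first by exists (K + n)%N.
  case=> m _ fm; have := bg (K + n)%N.
  by rewrite -/(h n) -fm b_ray /K; lia.
move=> /(sub_finite_set hA) finh.
apply: infinite_nat.
have : finite_set (h @^-1` range h).
  by apply: finite_preimage finh => x y _ _ /gR.1/addnI.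
by apply: sub_finite_set => n _; exists n.
Qed.

(** König's lemma: an infinite set of descendants would, by always moving to a child with infinitely
    many of them, yield a descending ray. *)
Lemma finite_below x : finite_set [set u | below x u].
Proof.
apply: contrapT => infx.
have step y : infinite_set [set u | below y u] ->
    exists z, F z = y /\ infinite_set [set u | below z u].
  move=> infy; apply: contrapT => nz; apply: infy.
  apply: (@sub_finite_set _ _ ([set y] `|`
      \bigcup_(z in [set z | (nd y z <= 1)%N /\ F z = y]) [set u | below z u])).
    move=> u [[|k]]; first by left.
    move=> /= Fk; right; exists (iter k F u); last by exists k.
    by split=> //; rewrite -[in X in (X <= _)%N]Fk ndistC (FP (iter k F u)).1.
  rewrite finite_setU; split; first exact: finite_set1.
  apply: bigcup_finite.
    by apply: sub_finite_set (finite_nball intD y 1) => z [].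
  by move=> z [_ Fz]; apply: contrapT => infz; apply: nz; exists z.
have /choice[c cP] : forall y, exists z, infinite_set [set u | below y u] ->
    F z = y /\ infinite_set [set u | below z u].
  move=> y; have [/step[z zP]|fin] := pselect (infinite_set [set u | below y u]).
    by exists z.
  by exists y.
pose g n := iter n c x.
have infg n : infinite_set [set u | below (g n) u].
  by elim: n => //= n /cP[].
have Fg n : F (g n.+1) = g n by have [] := cP _ (infg n).
have bg n : b (g n) = b (g 0%N) + n%:Z.
  elim: n => [|n IH]; first by rewrite addr0.
  by have := (FP (g n.+1)).2; rewrite Fg IH; lia.
apply: (@no_descending_ray g _ bg); split.
  by move=> m n mn; have := bg m; rewrite mn bg; lia.
by move=> n; have := (FP (g n.+1)).1; rewrite Fg adjacentE// ndistC => ->.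
Qed.

(** Outside the finitely many descendants of a common ancestor of [x] and [y], both distances to [w]
    pass through that ancestor. Height differences are thus recovered from the metric alone. *)
Lemma far_busemann x y :
  finite_set [set w | ~ ((nd x w)%:Z - (nd y w)%:Z = b x - b y)].
Proof.
have [i [j ij]] := common_ancestor x y.
apply: sub_finite_set (finite_below (iter i F x)) => w /=.
apply: contra_notP => nb.
have dz k z : ~ below (iter k F z) w -> (nd z w = k + nd (iter k F z) w)%N.
  elim: k => [//|k IH] nbk.
  rewrite IH => [|bk]; last by apply: nbk; apply: (below_trans _ bk); exists 1%N.
  rewrite (@away (iter k F z)) ?addnS//.
  by move=> bk; apply: nbk; apply: (below_trans _ bk); exists 1%N.
have := dz i x nb; rewrite ij in nb *; have := dz j y nb.
by have := b_iter i x; rewrite ij b_iter; lia.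
Qed.

(** A ray whose first step leads to a child could only go on downwards, which [no_descending_ray]
    excludes. *)
Lemma is_parentE w v : is_parent w v <-> w = F v.
Proof.
split=> [[g [gR g0 g1]]|->]; last first.
  exists (fun n => iter n F v); split=> //; split.
    by move=> m n mn; have := b_iter m v; rewrite mn b_iter; lia.
  by move=> n; rewrite adjacentE//= (FP _).1.
have adjg n : nd (g n) (g n.+1) = 1%N by apply/eqP; rewrite -adjacentE//; exact: gR.2.
have vw : nd v w = 1%N by rewrite -g0 -g1.
have [//|Fw] := neighbourP vw.
have Fg n : F (g n.+1) = g n.
  elim: n => [|n IH]; first by rewrite g1 g0.
  have [gF|//] := neighbourP (adjg n.+1).
  by move: gF; rewrite IH => /gR.1; lia.
case: (no_descending_ray gR) => n; elim: n => [|n IH]; first by rewrite addr0.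
by have := (FP (g n.+1)).2; rewrite Fg IH; lia.
Qed.

(** The only edge by which a path leaves the descendants of [v] is the one from [v] to [F v]. *)
Lemma descendantsE v u : descendants v u <-> below v u.
Proof.
split=> [[p [vp pu Fp]]|[k kv]].
  have {}Fp : F v \notin p by apply: Fp; apply/is_parentE.
  suff : forall y, below v y -> path (@adjacent R D) y p -> below v (last y p).
    by rewrite -pu; apply => //; exists 0%N.
  elim: p Fp {vp pu} => //= z p IH; rewrite inE negb_or => /andP[Fz Fp] y by_ /andP[].
  rewrite adjacentE// => /eqP yz zp; apply: IH => //.
  have [zF|Fzy] := neighbourP yz.
    case: by_ => -[/= yv|k /=]; first by rewrite zF yv eqxx in Fz.
    by rewrite -iterS iterSr -zF; exists k.
  by apply: below_trans by_ _; exists 1%N.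
elim: k u kv => [u /= ->|k IH u kv].
  by exists [::]; split.
have [|p [vp pu Fp]] := IH (F u); first by rewrite -iterSr.
exists (rcons p u); split.
- by rewrite rcons_path vp pu adjacentE// ndistC (FP _).1.
- by rewrite last_rcons.
- move=> w wv; rewrite mem_rcons inE negb_or (Fp w wv) andbT.
  apply/eqP => wu; move: wv => /is_parentE; rewrite wu -kv => uE.
  have := b_iter k.+2 u; rewrite -[iter k.+2 F u]/(F (iter k.+1 F u)) -uE; lia.
Qed.

End one_ended_trees.

(** The interface between the geometry of trees and the probabilistic part. Rays no longer appear in
    it; the fourth clause ties [b], up to a constant, to the metric. *)
Definition end_structure (R : realType) (D : discrete_space R)
    (F : D -> D) (b : D -> int) : Prop :=
  [/\ integral_space D,
      (forall x k, ndist x (iter k F x) = k /\ b (iter k F x) = b x - k%:Z),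
      (forall x y, (ndist x y)%:Z = b x - b y -> y = iter (ndist x y) F x),
      (forall x y, finite_set
         [set w | ~ ((ndist x w)%:Z - (ndist y w)%:Z = b x - b y)]) &
      (forall x y r, (ndist x y <= r)%N ->
         (ndist y (iter r F x))%:Z = b y - b (iter r F x)) /\
      (forall v u, descendants v u <-> (ndist u v)%:Z = b u - b v)].

Lemma one_ended_tree_structure (R : realType) (D : discrete_space R) :
  is_tree D -> one_ended D ->
  exists (F : D -> D) (b : D -> int), end_structure F b.
Proof.
move=> treeD oneD; have [f rayf] := oneD.1.
have [b bP] := one_ended_busemann treeD rayf.
have /choice[F FP] := exists_parent treeD rayf bP.
exists F, b; split.
- exact: tree_integral.
- by move=> x k; split; [exact: nd_iter FP _ _|exact: b_iter FP _ _].
- by move=> x y xy; apply: (upward treeD bP FP) => //; rewrite xy; lia.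
- by move=> x y; exact: (far_busemann treeD oneD rayf bP FP).
- split=> [x y r xy|v u].
    by apply/(belowE treeD bP FP)/(below_near treeD bP FP).
  split=> [/(descendantsE treeD oneD rayf bP FP)/(belowE treeD bP FP)//|uv].
  by apply/(descendantsE treeD oneD rayf bP FP)/(belowE treeD bP FP).
Qed.

(** * Measurable sets of isomorphism classes *)

Section iso_classes.
Local Open Scope quotient_scope.
Variables (R : realType) (k : nat) (Xi : mark_space R).
Implicit Types S : pointed_space k Xi.

Lemma isomorphicS S1 S2 : isomorphic S1 S2 -> isomorphic S2 S1.
Proof.
move=> h; have : isomorphicb S2 S1 by rewrite isomorphic_sym; exact/asboolP.
by move/asboolP.
Qed.

Lemma class_eq S1 S2 : isomorphic S1 S2 -> class S1 = class S2.
Proof. by move=> h; apply/(@eqmodP _ (isomorphism k Xi))/asboolP. Qed.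

Lemma representative_class S : isomorphic S (representative (class S)).
Proof.
apply/asboolP; apply/(@eqmodP _ (isomorphism k Xi)).
by rewrite /representative /class reprK.
Qed.

Lemma class_representative (c : spaces k Xi) : class (representative c) = c.
Proof. exact: reprK. Qed.

Lemma isomorphic_tnth S1 S2 (f : S1 -> S2) i :
  map f (points S1) = points S2 :> seq S2 ->
  f (tnth (points S1) i) = tnth (points S2) i.
Proof.
move=> fp; rewrite !(tnth_nth (origin S2)) -fp.
by rewrite (nth_map (origin S1)) ?size_tuple// -tnth_nth.
Qed.

Lemma isomorphic_origin S1 S2 (f : S1 -> S2) :
  map f (points S1) = points S2 :> seq S2 -> f (origin S1) = origin S2.
Proof. exact: isomorphic_tnth. Qed.

Lemma approximates_iso e S1 S2 S1' S2' : isomorphic S1 S1' -> isomorphic S2 S2' ->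
  approximates e S1 S2 -> approximates e S1' S2'.
Proof.
move=> /isomorphicS[f1 [/bij_inj f1I f1d f1p f1m]] [f2 [/bij_inj f2I f2d f2p f2m]].
case=> f [fI fp fd fm]; exists (f2 \o f \o f1).
have f1B x : dist (origin S1') x <= e^-1 -> dist (origin S1) (f1 x) <= e^-1.
  by rewrite -(isomorphic_origin f1p) f1d.
split.
- move=> x y /set_mem Bx /set_mem By /f2I xy; apply: f1I; apply: fI xy; apply/mem_set; exact: f1B.
- move=> i /f1B; rewrite (isomorphic_tnth _ f1p) => /fp/= fi.
  by rewrite (isomorphic_tnth _ f1p) fi (isomorphic_tnth _ f2p).
- by move=> x y /f1B Bx /f1B By; rewrite /= f2d -f1d; exact: fd.
- by move=> x y /f1B Bx /f1B By; rewrite /= f2m -f1m; exact: fm.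
Qed.

Lemma class_open_class (U : set (iso_class k Xi)) S : class_open U -> U (class S) ->
  exists2 e : R, 0 < e & forall S', approximates e S S' -> approximates e S' S ->
    U (class S').
Proof.
move=> oU /oU[e e0 eU]; exists (e / 2); first by rewrite divr_gt0.
move=> S' SS' S'S; apply: eU; rewrite /class_dist gt_min; apply/orP; right.
apply: (@le_lt_trans _ _ (e / 2)%:E); last by rewrite lte_fin; lra.
apply: ereal_inf_lbound; exists (e / 2) => //; split; first by rewrite divr_gt0.
  by apply: approximates_iso SS'; exact: representative_class.
by apply: approximates_iso S'S; exact: representative_class.
Qed.

Lemma class_openI (U : set (iso_class k Xi)) :
  (forall S, U (class S) -> exists2 e : R, 0 < e & forall S' e', 0 < e' -> e' < e ->
     approximates e' S S' -> approximates e' S' S -> U (class S')) ->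
  class_open U.
Proof.
move=> HU c Uc; have [|e e0 eU] := HU (representative (c : spaces k Xi)).
  by rewrite class_representative.
(* For radii at most 1 the truncation in [class_dist] is inactive. *)
exists (Num.min e 1); first by rewrite lt_min e0 ltr01.
move=> c'; rewrite /class_dist gt_min => /orP[|].
  by rewrite lte_fin lt_min ltxx andbF.
move=> /ereal_inf_lt[_ [e' [e'0 cc' c'c] <-]]; rewrite lte_fin lt_min => /andP[e'e _].
by have := eU _ _ e'0 e'e cc' c'c; rewrite (class_representative (c' : spaces k Xi)).
Qed.

Lemma measurable_class_open (U : set (iso_class k Xi)) :
  class_open U -> measurable (U : set (spaces k Xi)).
Proof. exact: sub_sigma_algebra. Qed.

End iso_classes.

Lemma finite_uniform_pos (R : realType) (T : eqType) (s : seq T) (Q : T -> R -> Prop) :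
  (forall x, x \in s -> exists2 e, 0 < e & forall e', 0 < e' -> e' <= e -> Q x e') ->
  exists2 e, 0 < e & forall e' x, 0 < e' -> e' <= e -> x \in s -> Q x e'.
Proof.
elim: s => [_|x s IH Hs]; first by exists 1.
have [|e e0 eP] := IH; first by move=> y ys; apply: Hs; rewrite inE ys orbT.
have [|r r0 rP] := Hs x; first by rewrite inE eqxx.
exists (Num.min e r); first by rewrite lt_min e0.
move=> e' y e'0; rewrite le_min => /andP[e'e e'r].
by rewrite inE => /orP[/eqP->|ys]; [exact: rP|exact: eP].
Qed.

(** * Open conditions on finite configurations *)

Section open_patterns.
Variables (R : realType) (k : nat) (Xi : mark_space R).
Implicit Types S : pointed_space k Xi.

(** A good enough approximation transports the whole tuple [xs] with small errors, so the existence
    of a tuple with a property stable under small errors is an open condition. *)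
Lemma class_open_pattern (Psi : forall S, seq S -> Prop) :
  (forall S xs, Psi S xs -> exists2 e : R, 0 < e & forall S' (f : S -> S'),
     map f (points S) = points S' :> seq S' ->
     (forall x y, x \in (points S : seq S) ++ xs -> y \in (points S : seq S) ++ xs ->
        `|dist (f x) (f y) - dist x y| <= e /\
        mark_dist (mark (f x) (f y)) (mark x y) <= e) ->
     Psi S' (map f xs)) ->
  class_open [set c : iso_class k Xi |
    exists S (xs : seq S), c = class S /\ Psi S xs].
Proof.
move=> HP; apply: class_openI => S [S1 [xs [SS1 Pxs]]].
have iS : isomorphic S S1.
  have h := representative_class S.
  rewrite SS1 in h; apply/asboolP; apply: isomorphic_trans; apply/asboolP; first exact: h.
  exact/isomorphicS/representative_class.
have [e e0 eP] := HP _ _ Pxs.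
(* The ball of radius [r^-1] must contain the configuration for the approximation to control it. *)
have [|r r0 rP] := @finite_uniform_pos R S1 ((points S1 : seq S1) ++ xs)
  (fun x r => dist (origin S1) x <= r^-1).
  move=> x _; have d0 := dist_ge0 (origin S1) x.
  exists (dist (origin S1) x + 1)^-1; first by rewrite invr_gt0; lra.
  move=> e' e'0 e'r; rewrite -(invrK (dist _ _)) in e'r *.
  rewrite invrK; apply: (@le_trans _ _ (dist (origin S1) x + 1)); first by lra.
  rewrite -[leLHS]invrK lef_pV2 ?posrE ?invr_gt0//; last by lra.
  by move: e'r; rewrite !invrK.
exists (Num.min e r); first by rewrite lt_min e0.
move=> S' e' e'0; rewrite lt_min => /andP[/ltW e'e /ltW e'r] SS' _.
have [f [fI fp fd fm]] : approximates e' S1 S'.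
  apply: approximates_iso SS' => //.
  by exists id; split; [exists id| | rewrite map_id|].
exists S', (map f xs); split=> //; apply: eP.
  apply: (@eq_from_nth _ (origin S')); first by rewrite size_map !size_tuple.
  move=> i; rewrite size_map size_tuple => ik.
  rewrite (nth_map (origin S1)) ?size_tuple//.
  rewrite -(tnth_nth _ _ (Ordinal ik)) -(tnth_nth _ _ (Ordinal ik)) fp//=.
  by apply: rP => //; rewrite mem_cat mem_tnth.
by move=> x y xl yl; split; [apply: le_trans (fd _ _ _ _) e'e|apply: le_trans (fm _ _ _ _) e'e];
  exact: rP.
Qed.

End open_patterns.

Section local_predicates.
Variables (R : realType) (k : nat) (Xi : mark_space R).
Implicit Types S : pointed_space k Xi.

Definition nball S (K : nat) : set S := [set x | (ndist (origin S) x <= K)%N].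

Definition ball_iso (K : nat) S1 S2 : Prop := exists f : S1 -> S2,
  [/\ forall x y, nball K x -> nball K y ->
        ndist (f x) (f y) = ndist x y /\ mark (f x) (f y) = mark x y,
      forall y : S2, nball K y -> exists2 x : S1, nball K x & f x = y &
      map f (points S1) = points S2 :> seq S2].

Definition within (K : nat) S : Prop := forall i, nball K (tnth (points S) i).

Definition local_predicate (K : nat) (phi : pointed_space k Xi -> Prop) : Prop :=
  forall S1 S2, integral_space S1 -> integral_space S2 -> within K S1 -> within K S2 ->
    ball_iso K S1 S2 -> phi S1 -> phi S2.

Lemma isomorphic_ndist S1 S2 (f : S1 -> S2) :
  (forall x y, dist (f x) (f y) = dist x y) ->
  forall x y, ndist (f x) (f y) = ndist x y.
Proof. by move=> fd x y; rewrite /ndist fd. Qed.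

Lemma integral_iso S1 S2 : isomorphic S1 S2 -> integral_space S1 -> integral_space S2.
Proof.
move=> [f [[g fK gK] fd _ _]] I1 x y.
by rewrite -(gK x) -(gK y) fd (isomorphic_ndist fd) I1.
Qed.

Lemma isomorphic_ball_iso K S1 S2 : isomorphic S1 S2 -> ball_iso K S1 S2.
Proof.
move=> [f [[g fK gK] fd fp fm]]; exists f; split=> //.
  by move=> x y _ _; rewrite fm (isomorphic_ndist fd).
move=> y; rewrite /nball /= -(isomorphic_origin fp) -{1}(gK y) (isomorphic_ndist fd).
by exists (g y).
Qed.

Lemma within_iso K S1 S2 : isomorphic S1 S2 -> within K S1 -> within K S2.
Proof.
move=> [f [[g fK gK] fd fp fm]] w1 i.
rewrite /nball /= -(isomorphic_origin fp) -(isomorphic_tnth _ fp).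
by rewrite (isomorphic_ndist fd); exact: w1.
Qed.

End local_predicates.

Lemma nat_gap (R : realType) (r : R) : 0 <= r -> r <> (Num.truncn r)%:R ->
  exists2 e, 0 < e & forall r', `|r' - r| <= e -> r' <> (Num.truncn r')%:R.
Proof.
move=> r0 rn; set n := Num.truncn r in rn *.
have /andP[nr rn1] : n%:R <= r < n.+1%:R by exact: truncn_itv.
have {}nr : n%:R < r by rewrite lt_neqAle nr andbT; apply/eqP => /esym.
exists (Num.min (r - n%:R) (n.+1%:R - r) / 2).
  by rewrite divr_gt0// lt_min !subr_gt0 nr.
move=> r' r'r; suff -> : Num.truncn r' = n.
  move=> r'n; move: r'r; rewrite r'n ler_pdivlMr// le_min => /andP[].
  by rewrite distrC ger0_norm ?subr_ge0 ?(ltW nr)//; lra.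
have : `|r' - r| * 2 <= Num.min (r - n%:R) (n.+1%:R - r) by rewrite -ler_pdivlMr.
rewrite le_min => /andP[h1 h2].
apply: truncn_def; move: h1 h2; have := ler_norm (r' - r); have := ler_norm (- (r' - r)).
by rewrite normrN -(natr1 n) => *; apply/andP; split; lra.
Qed.

Section measurable_local.
Variables (R : realType) (k : nat).
Local Notation X := (no_mark R).
Implicit Types S : pointed_space k X.

Let pts S (xs : seq S) : seq S := (points S : seq S) ++ xs.

(** The complement is open: a non-integral distance stays non-integral after a small change. *)
Lemma measurable_integral : measurable
  [set c : spaces k X | integral_space (representative c)].
Proof.
rewrite -[X in measurable X]setCK; apply: measurableC.
pose Psi S (xs : seq S) := exists x y, xs = [:: x; y] /\ dist x y <> (ndist x y)%:R.
have oP := @class_open_pattern R k X Psi.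
pose U : set (spaces k X) := [set c | exists S (xs : seq S), c = class S /\ Psi S xs].
have {oP}/measurable_class_open mU : class_open U.
  apply: oP => S _ [x [y [-> xy]]].
  have [e e0 eP] := nat_gap (dist_ge0 x y) xy; exists e => // S' f _ fd.
  exists (f x), (f y); split=> //; apply: eP.
  by apply: (fd x y _ _).1; rewrite mem_cat !inE eqxx ?orbT.
suff -> : ~` [set c : spaces k X | integral_space (representative c)] = U by [].
apply/esym/seteqP; split=> c /=.
  move=> [S [xs [-> [x [y [_ xy]]]]]] iS; apply: xy.
  exact: (integral_iso (isomorphicS (representative_class S)) iS).
move=> nI; apply: contrapT => h; apply: nI => x y; apply: contrapT => xy.
apply: h; exists (representative c), [:: x; y].
by split; [rewrite class_representative|exists x, y].
Qed.

(** Rounding to the nearest integer, which is locally constant near integers; truncation is not. *)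
Let rnd (r : R) : nat := Num.truncn (r + 2^-1).

Let rnd_nat n : rnd n%:R = n.
Proof.
by apply: truncn_def; rewrite -(natr1 n); apply/andP; split; lra.
Qed.

Let rnd_stable (r : R) : 0 <= r -> `|r - (rnd r)%:R| < 2^-1 ->
  exists2 e, 0 < e & forall e', 0 < e' -> e' <= e ->
    forall r', `|r' - r| <= e' -> rnd r' = rnd r /\ `|r' - (rnd r)%:R| < 2^-1.
Proof.
set n := rnd r => r0 rn; exists ((2^-1 - `|r - n%:R|) / 2).
  by rewrite divr_gt0// subr_gt0.
move=> e' e'0 e'e r' r'r.
have h : `|r' - n%:R| < 2^-1.
  apply: le_lt_trans (ler_distD r _ _) _.
  by move: e'e r'r rn; set a := `|_|; set b := `|_|; lra.
split=> //; apply: truncn_def; have := ler_norm (r' - n%:R).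
have := ler_norm (- (r' - n%:R)); rewrite normrN -(natr1 n) => *.
by apply/andP; split; lra.
Qed.

Let matrix (S : pointed_space k X) (l : seq S) : seq (seq nat) :=
  [seq [seq rnd (dist x y) | y <- l] | x <- l].

Let matches (M : seq (seq nat)) (S : pointed_space k X) (xs : seq S) : Prop :=
  matrix (pts xs) = M /\
  forall x y, x \in pts xs -> y \in pts xs -> `|dist x y - (rnd (dist x y))%:R| < 2^-1.

Let open_matches M : class_open [set c : iso_class k X |
  exists S (xs : seq S), c = class S /\ matches M xs].
Proof.
apply: class_open_pattern => S xs [MS nS].
have [|e e0 eP] := @finite_uniform_pos R (S * S)%type
    [seq (x, y) | x <- pts xs, y <- pts xs]
    (fun xy e => forall r', `|r' - dist xy.1 xy.2| <= e ->
       rnd r' = rnd (dist xy.1 xy.2) /\ `|r' - (rnd (dist xy.1 xy.2))%:R| < 2^-1).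
  move=> _ /allpairsP[[x y] /= [xl yl ->]] /=.
  exact: rnd_stable (dist_ge0 x y) (nS _ _ xl yl).
exists e => // S' f fp fd.
have fl : pts (map f xs) = map f (pts xs) by rewrite /pts map_cat fp.
have fr x y : x \in pts xs -> y \in pts xs -> rnd (dist (f x) (f y)) = rnd (dist x y) /\
    `|dist (f x) (f y) - (rnd (dist x y))%:R| < 2^-1.
  move=> xl yl; apply: (eP e (x, y)) => //; last exact: (fd _ _ xl yl).1.
  exact: (allpairs_f pair).
split.
  rewrite -MS fl /matrix -!map_comp; apply/eq_in_map => x xl /=.
  by rewrite -map_comp; apply/eq_in_map => y yl /=; rewrite (fr x y xl yl).1.
rewrite fl => _ _ /mapP[x xl ->] /mapP[y yl ->].
by have [-> ] := fr x y xl yl.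
Qed.

(** On an integral space this says that the ball of radius [K] has at least [m] points. The margins
    of 1/2 make it an open condition. *)
Let crowded K m S (xs : seq S) : Prop :=
  [/\ size xs = m, forall x, x \in xs -> dist (origin S) x < K%:R + 2^-1,
      uniq xs & forall x y, x \in xs -> y \in xs -> x != y -> 2^-1 < dist x y].

Let open_crowded K m : class_open [set c : iso_class k X |
  exists S (xs : seq S), c = class S /\ crowded K m xs].
Proof.
apply: class_open_pattern => S xs [sz oxs uxs dxs].
have slack (a b : R) : a < b ->
    exists2 e, 0 < e & forall e', 0 < e' -> e' <= e -> forall r, `|r - a| <= e' -> r < b.
  move=> ab; exists ((b - a) / 2); first by rewrite divr_gt0// subr_gt0.
  by move=> e' _ e'e r ra; have := ler_norm (r - a); lra.
have slack' (a b : R) : a < b ->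
    exists2 e, 0 < e & forall e', 0 < e' -> e' <= e -> forall r, `|r - b| <= e' -> a < r.
  rewrite -ltrN2 => /slack[e e0 h]; exists e => // e' e'0 e'e r rb.
  by rewrite -ltrN2; apply: h e'0 e'e _ _; rewrite -opprD normrN.
have [|e e0 eP] := @finite_uniform_pos R S xs (fun x e => forall r,
    `|r - dist (origin S) x| <= e -> r < K%:R + 2^-1).
  by move=> x xxs; exact: slack (oxs _ xxs).
have [|r r0 rP] := @finite_uniform_pos R (S * S)%type [seq (x, y) | x <- xs, y <- xs]
    (fun xy e => forall r, `|r - dist xy.1 xy.2| <= e -> xy.1 != xy.2 -> 2^-1 < r).
  move=> _ /allpairsP[[x y] /= [xl yl ->]] /=.
  have [->|xy] := eqVneq x y; first by exists 1.
  have [e' ? h] := slack' _ _ (dxs x y xl yl xy); exists e' => // e'' ? ? ? ? _.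
  by apply: h; eassumption.
exists (Num.min e r); first by rewrite lt_min e0.
have m0 : 0 < Num.min e r by rewrite lt_min e0.
have me : Num.min e r <= e by rewrite ge_min lexx.
have mr : Num.min e r <= r by rewrite ge_min lexx orbT.
move=> S' f fp fd.
have inl x : x \in xs -> x \in (points S : seq S) ++ xs by rewrite mem_cat orbC => ->.
have ol : origin S \in (points S : seq S) ++ xs by rewrite mem_cat mem_tnth.
have fdist x y : x \in xs -> y \in xs -> x != y -> 2^-1 < dist (f x) (f y).
  move=> xl yl; apply: (rP (Num.min e r) (x, y)) => //.
    exact: (allpairs_f pair).
  exact: (fd _ _ (inl _ xl) (inl _ yl)).1.
split.
- by rewrite size_map.
- move=> _ /mapP[x xl ->]; rewrite -(isomorphic_origin fp).
  by apply: (eP (Num.min e r) x) => //; exact: (fd _ _ ol (inl _ xl)).1.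
- rewrite map_inj_in_uniq// => x y xl yl fxy; apply: contrapT => /eqP xy.
  by have := fdist _ _ xl yl xy; rewrite fxy distxx; lra.
- move=> _ _ /mapP[x xl ->] /mapP[y yl ->] fxy; apply: fdist => //.
  by apply: contra fxy => /eqP ->.
Qed.

Let rnd_integral (D : discrete_space R) (x y : D) :
  integral_space D -> rnd (dist x y) = ndist x y.
Proof. by move=> ->; rewrite rnd_nat. Qed.

Let matrix_nth S1 S2 (l1 : seq S1) (l2 : seq S2) i j :
  integral_space S1 -> integral_space S2 -> matrix l1 = matrix l2 ->
  (i < size l1)%N -> (j < size l1)%N ->
  ndist (nth (origin S1) l1 i) (nth (origin S1) l1 j) =
  ndist (nth (origin S2) l2 i) (nth (origin S2) l2 j).
Proof.
move=> I1 I2 l12 i1 j1.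
have sz : size l1 = size l2 by have := congr1 size l12; rewrite !size_map.
have := congr1 (fun M => nth 0%N (nth [::] M i) j) l12.
rewrite /= !(nth_map (origin S1)) ?size_map//.
by rewrite !(nth_map (origin S2)) ?size_map -?sz// !rnd_integral.
Qed.

Let matrix_map S1 S2 (l1 : seq S1) (l2 : seq S2) :
  integral_space S1 -> integral_space S2 -> matrix l1 = matrix l2 ->
  exists g : S1 -> S2, map g l1 = l2 /\
    forall x y, x \in l1 -> y \in l1 -> ndist (g x) (g y) = ndist x y.
Proof.
move=> I1 I2 l12.
have sz : size l1 = size l2 by have := congr1 size l12; rewrite !size_map.
exists (fun x => nth (origin S2) l2 (index x l1)); split.
  apply: (@eq_from_nth _ (origin S2)); rewrite size_map// => i i1.
  rewrite (nth_map (origin S1))//; apply: (ndist_eq0 I2).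
  have j1 : (index (nth (origin S1) l1 i) l1 < size l1)%N by rewrite index_mem mem_nth.
  by rewrite -(matrix_nth I1 I2 l12)// nth_index ?mem_nth// ndistxx.
move=> x y xl yl; rewrite -(matrix_nth I1 I2 l12) ?index_mem//.
by rewrite !nth_index.
Qed.

(** A ball of radius [K] of an integral space is described by its size and a matrix of distances,
    which leaves countably many cases. Each is the conjunction of an open condition, a tuple with
    this matrix exists, and a closed one, no further point fits in the ball. *)
Lemma measurable_local K (phi : pointed_space k X -> Prop) : local_predicate K phi ->
  measurable [set c : spaces k X | [/\ integral_space (representative c),
    within K (representative c) & phi (representative c)]].
Proof.
move=> lphi.
pose pattern (mM : nat * seq (seq nat)) : Prop := exists S (xs : seq S),
  [/\ [/\ integral_space S, within K S & phi S], size xs = mM.1, uniq xs,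
      forall x, x \in xs <-> nball K x & matrix (pts xs) = mM.2].
pose F mM : set (spaces k X) := [set c : spaces k X | pattern mM] `&`
  ([set c : spaces k X | integral_space (representative c)] `&`
   [set c : spaces k X | exists S (xs : seq S), c = class S /\ matches mM.2 xs]) `\`
  [set c : spaces k X | exists S (xs : seq S), c = class S /\ crowded K mM.1.+1 xs].
have -> : [set c : spaces k X | [/\ integral_space (representative c),
    within K (representative c) & phi (representative c)]] = \bigcup_mM F mM.
  apply/seteqP; split=> [c [Ic wc phic]|c [mM _ [[[S [xs [[IS wS phiS] szxs uxs bxs Mxs]]] [Ic Mc]] nc]]] /=.
  - pose S := representative c.
    have /finite_seqP[xs0 xs0P] : finite_set (@nball _ _ _ S K) by exact: finite_nball.
    pose xs := undup xs0.
    have bxs x : x \in xs <-> nball K x by rewrite xs0P /= mem_undup.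
    exists (size xs, matrix (pts xs)) => //; split.
      split.
        by exists S, xs; split=> //; exact: undup_uniq.
      split=> //; exists S, xs; split; first by rewrite class_representative.
      split=> // x y _ _; rewrite rnd_integral// Ic.
      by rewrite subrr normr0 invr_gt0.
    move=> [S' [ys [cS' [sz oys uys _]]]].
    have : (size xs < size ys)%N by rewrite sz.
    have [f [/bij_inj fI fd fp _]] : isomorphic S' S.
      by rewrite /S cS'; exact: representative_class.
    apply/negP; rewrite -leqNgt -(size_map f); apply: uniq_leq_size.
      by rewrite map_inj_uniq.
    move=> _ /mapP[y yys ->]; apply/bxs.
    rewrite /nball/= -(isomorphic_origin fp) (isomorphic_ndist fd).
    have := oys y yys; rewrite -fd Ic (isomorphic_ndist fd) => h.
    rewrite -ltnS -(ltr_nat R) -(natr1 K); apply: lt_trans h _.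
    by rewrite ltrD2l invf_lt1// ltr1n.
  - case: Mc => S' [xs' [cS' [M' _]]].
    have iS' : isomorphic S' (representative c) by rewrite cS'; exact: representative_class.
    have IS' : integral_space S' := integral_iso (isomorphicS iS') Ic.
    have [g [gl gd]] := matrix_map IS IS' (etrans Mxs (esym M')).
    have gp : map g (points S) = points S' :> seq S'.
      move: gl; rewrite /pts map_cat => /(congr1 (take k.+1)).
      by rewrite !take_size_cat ?size_map ?size_tuple.
    have gxs : map g xs = xs'.
      move: gl; rewrite /pts map_cat gp => /(congr1 (drop k.+1)).
      by rewrite !drop_size_cat ?size_tuple.
    have inl x : nball K x -> x \in pts xs by move=> /bxs xxs; rewrite mem_cat xxs orbT.
    have ol : origin S \in pts xs by rewrite mem_cat mem_tnth.
    have wS' : within K S'.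
      move=> i; rewrite /nball/= -(isomorphic_tnth _ gp) -(isomorphic_origin gp) gd//.
        exact: wS.
      by rewrite mem_cat mem_tnth.
    have biso : ball_iso K S S'.
      exists g; split=> //.
        by move=> x y /inl xl /inl yl; split; [exact: gd|case: (mark (g x) (g y)); case: (mark x y)].
      (* A point of the ball outside the image of [g] would give one point too many. *)
      move=> y yK; apply: contrapT => ny; apply: nc.
      exists S', (y :: xs'); split=> //; split.
      - by rewrite /= -gxs size_map szxs.
      - move=> x; rewrite inE => xin; rewrite IS'.
        suff : (ndist (origin S') x <= K)%N.
          by rewrite -(ler_nat R) => h; apply: le_lt_trans h _; rewrite ltrDl invr_gt0.
        case/orP: xin => [/eqP->//|]; rewrite -gxs => /mapP[z /bxs zK ->].
        by rewrite -(isomorphic_origin gp) gd// inl.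
      - rewrite /= -gxs map_inj_in_uniq ?uxs ?andbT; last first.
          move=> a b /bxs/inl al /bxs/inl bl gab; apply: (ndist_eq0 IS).
          by rewrite -gd// gab ndistxx.
        by apply/negP => /mapP[z /bxs zK yz]; apply: ny; exists z.
      - move=> a b _ _ ab; rewrite IS'.
        have : (0 < ndist a b)%N.
          by rewrite lt0n; apply: contra ab => /eqP/(ndist_eq0 IS')->.
        by rewrite -(ler_nat R); apply: lt_le_trans; rewrite invf_lt1// ltr1n.
    have phiS' := lphi _ _ IS IS' wS wS' biso phiS.
    split=> //; first exact: within_iso iS' wS'.
    apply: (lphi S') => //; first exact: within_iso iS' wS'.
    exact: isomorphic_ball_iso.
apply: countable_bigcupT_measurable => [|mM]; first exact: countableP.
apply: measurableD; last exact: (measurable_class_open (@open_crowded K mM.1.+1)).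
apply: measurableI.
  have [p|np] := pselect (pattern mM).
    by rewrite (_ : [set c | pattern mM] = setT) ?measurableT//; apply/seteqP; split.
  by rewrite (_ : [set c | pattern mM] = set0) ?measurable0//; apply/seteqP; split.
apply: measurableI; first exact: measurable_integral.
exact: (measurable_class_open (@open_matches mM.2)).
Qed.

End measurable_local.

(** * Change of origin *)

Section recentering.
Variables (R : realType) (k : nat).
Local Notation X := (no_mark R).
Implicit Types S : pointed_space k X.

Lemma pointed1_iso S1 S2 i : isomorphic S1 S2 ->
  isomorphic (pointed1 (tnth (points S1) i)) (pointed1 (tnth (points S2) i)).
Proof.
move=> [f [fb fd fp fm]]; exists f; split=> //=.
by rewrite (isomorphic_tnth i fp).
Qed.

Definition recenter (i : 'I_k.+1) (c : spaces k X) : D_star R :=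
  class (pointed1 (tnth (points (representative c)) i)).

Lemma recenter_class i S :
  recenter i (class S) = class (pointed1 (tnth (points S) i)).
Proof.
by apply: class_eq; apply: pointed1_iso; exact/isomorphicS/representative_class.
Qed.

Lemma approximates_recenter S1 S2 i e e' : 0 < e' -> e' <= e ->
  dist (origin S1) (tnth (points S1) i) + e^-1 <= e'^-1 ->
  approximates e' S1 S2 ->
  approximates e (pointed1 (tnth (points S1) i)) (pointed1 (tnth (points S2) i)).
Proof.
move=> e'0 e'e oe [f [fI fp fd fm]]; exists f.
have e0 : 0 < e := lt_le_trans e'0 e'e.
have B x : dist (tnth (points S1) i) x <= e^-1 -> dist (origin S1) x <= e'^-1.
  by move=> h; have := dist_tri (tnth (points S1) i) (origin S1) x; move=> h2; lra.
have ie0 : 0 < e^-1 by rewrite invr_gt0.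
have Bp : dist (origin S1) (tnth (points S1) i) <= e'^-1 by lra.
split=> /=.
- move=> x y /set_mem Bx /set_mem By; apply: fI; apply/mem_set; exact: B.
- by move=> j _; rewrite (ord1 j) /= /tnth /= fp.
- by move=> x y /B Bx /B By; apply: le_trans (fd _ _ Bx By) e'e.
- by move=> x y /B Bx /B By; apply: le_trans (fm _ _ Bx By) e'e.
Qed.

Lemma measurable_recenter i : measurable_fun [set: spaces k X] (recenter i).
Proof.
refine (@measurability _ _ (spaces k X) (spaces 0 X) setT (recenter i) (@class_open R 0 X) erefl _).
move=> _ [U oU <-]; rewrite setTI; apply: measurable_class_open.
apply: class_openI => S; rewrite /preimage /= recenter_class.
move=> /(class_open_class oU)[e e0 eU].
set r := dist (origin S) (tnth (points S) i).
have r0 : 0 <= r := dist_ge0 _ _.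
have ie0 : 0 < e^-1 by rewrite invr_gt0.
have q0 : 0 < r + 1 + e^-1 by lra.
(* The larger ball has room for the move to the new origin ([r]), for the error on that distance in
   [S'] (at most 1) and for the ball around the new origin ([e^-1]). *)
exists (Num.min (Num.min e 1) (r + 1 + e^-1)^-1).
  by rewrite !lt_min e0 ltr01 invr_gt0 q0.
move=> S' e' e'0; rewrite !lt_min => /andP[/andP[/ltW e'e /ltW e'1] e'q] SS' S'S.
rewrite recenter_class.
have qe' : r + 1 + e^-1 <= e'^-1.
  by rewrite -[leLHS]invrK lef_pV2 ?posrE ?invr_gt0// ltW.
apply: eU; first by apply: (approximates_recenter e'0 e'e) SS'; rewrite -/r; lra.
apply: (approximates_recenter e'0 e'e) S'S.
suff : dist (origin S') (tnth (points S') i) <= r + 1 by lra.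
have [f [_ fp fd _]] := SS'.
have fo : f (origin S) = origin S' by apply: fp; rewrite /= distxx; lra.
have Bi : dist (origin S) (tnth (points S) i) <= e'^-1 by rewrite -/r; lra.
have Bo : dist (origin S) (origin S) <= e'^-1 by rewrite distxx; lra.
have := fd _ _ Bo Bi; rewrite fo (fp _ Bi) -/r => h.
have {}h := le_trans (ler_norm _) h; lra.
Qed.

End recentering.

(** * Busemann differences and their approximation on spheres *)

Section busemann_functions.
Variables (R : realType) (D : discrete_space R).
Implicit Types (x y z w : D) (b c : int).

(* The end-relative height difference: in a one-ended tree, [b] is the number of
   generations by which [y] precedes [x]. *)
Definition busemann x y b : Prop :=
  finite_set [set w | ~ ((ndist x w)%:Z - (ndist y w)%:Z = b)].

(** Nonempty spheres of all radii rule out finite spaces, in which every [b] would satisfy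
    [busemann x y b]. *)
Definition has_busemann : Prop :=
  [/\ integral_space D, forall x n, exists w, ndist x w = n &
      forall x y, exists b, busemann x y b].

(** The difference read at a single point of a sphere: unlike [busemann], it only involves a
    ball. *)
Definition sphere_busemann (m : nat) x y b : Prop :=
  exists w, ndist x w = m /\ m%:Z - (ndist y w)%:Z = b.

Lemma finite_ndist_bound o (A : set D) : finite_set A ->
  exists K, forall x, A x -> (ndist o x < K)%N.
Proof.
move=> /finite_seqP[s ->]; elim: s => [|y s [K KP]]; first by exists 0%N.
exists (maxn K (ndist o y).+1) => x /=; rewrite inE leq_max.
by move=> /orP[/eqP->|xs]; [rewrite ltnSn orbT|rewrite KP].
Qed.

Lemma busemannD x y z b c : busemann x y b -> busemann y z c -> busemann x z (b + c).
Proof.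
move=> fb fc; apply: sub_finite_set (_ : finite_set (_ `|` _)); last first.
  by rewrite finite_setU; split; [exact: fb|exact: fc].
move=> w /=; have [yzw|] := eqVneq ((ndist y w)%:Z - (ndist z w)%:Z) c; last by move/eqP; right.
have [xyw|] := eqVneq ((ndist x w)%:Z - (ndist y w)%:Z) b; last by move/eqP; left.
by case; lia.
Qed.

Lemma busemannN x y b : busemann x y b -> busemann y x (- b).
Proof. by apply: sub_finite_set => w /= h1 h2; apply: h1; lia. Qed.

Lemma busemannxx x : busemann x x 0.
Proof. by apply: (sub_finite_set _ (@finite_set0 D)) => w /=; rewrite subrr. Qed.

Hypothesis goodD : has_busemann.

(** The finite exceptional set misses every large sphere around [x], and these spheres are not
    empty. *)
Lemma sphere_busemann_limit x y b : busemann x y b -> exists M, forall m c,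
  (M <= m)%N -> sphere_busemann m x y c <-> c = b.
Proof.
move=> /(finite_ndist_bound x)[M MP]; exists M => m c Mm.
have val w : ndist x w = m -> (m%:Z - (ndist y w)%:Z) = b.
  by move=> xw; apply: contrapT; rewrite -xw => /MP; rewrite xw; lia.
split; first by case=> w [/val <- <-].
by move=> ->; have [_ /(_ x m)[w xw] _] := goodD; exists w; split=> //; exact: val.
Qed.

Lemma busemann_unique x y b c : busemann x y b -> busemann x y c -> b = c.
Proof.
move=> /sphere_busemann_limit[M HM] /sphere_busemann_limit[N HN].
apply: (HN (maxn M N) _ (leq_maxr _ _)).1.
exact: (HM (maxn M N) _ (leq_maxl _ _)).2.
Qed.

Lemma sphere_busemann_eventually x y : exists M, forall m b,
  (M <= m)%N -> sphere_busemann m x y b <-> busemann x y b.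
Proof.
have [b bP] : exists b, busemann x y b by case: goodD.
have [M HM] := sphere_busemann_limit bP; exists M => m c /HM ->.
by split=> [->//|/busemann_unique]; apply.
Qed.

End busemann_functions.

Section isometries.
Variables (R : realType) (D1 D2 : discrete_space R) (f : D1 -> D2) (g : D2 -> D1).
Hypotheses (fK : cancel f g) (gK : cancel g f).
Hypothesis fd : forall x y, dist (f x) (f y) = dist x y.

Let nd x y : ndist (f x) (f y) = ndist x y.
Proof. by rewrite /ndist fd. Qed.

Lemma busemann_isometry x y b : busemann x y b -> busemann (f x) (f y) b.
Proof.
move=> fin; rewrite /busemann; apply: sub_finite_set (finite_image f fin) => w /=.
by rewrite -{1 2}(gK w) !nd => h; exists (g w).
Qed.

Lemma has_busemann_isometry : has_busemann D1 -> has_busemann D2.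
Proof.
case=> I1 inf1 bus1; split.
- by move=> x y; rewrite -(gK x) -(gK y) fd nd I1.
- move=> x n; have [w wP] := inf1 (g x) n; exists (f w).
  by rewrite -{1}(gK x) nd.
- move=> x y; have [b bP] := bus1 (g x) (g y); exists b.
  by rewrite -(gK x) -(gK y); exact: busemann_isometry.
Qed.

End isometries.

(** * Measurability of limits of local predicates *)

Section measurable_limit.
Variables (R : realType).
Local Notation X := (no_mark R).

Lemma within0 (Xi : mark_space R) K (S : pointed_space 0 Xi) : within K S.
Proof. by move=> i; rewrite /nball/= (ord1 i) /origin ndistxx. Qed.

Lemma measurable_local0 K (phi : pointed_space 0 X -> Prop) : local_predicate K phi ->
  measurable [set c : D_star R | integral_space (representative c) /\ phi (representative c)].
Proof.
move=> /measurable_local; congr (measurable _); apply/seteqP; split=> c /=.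
  by case.
by move=> [? ?]; split=> //; exact: within0.
Qed.

Let spheres Rad n (S : pointed_space 0 X) : Prop :=
  forall x, nball Rad x -> exists w : S, ndist x w = n.

Let stable Rad K n (S : pointed_space 0 X) : Prop :=
  forall x y w w' : S, nball Rad x -> nball Rad y ->
    (K <= ndist (origin S) w)%N -> nball n w -> (K <= ndist (origin S) w')%N -> nball n w' ->
    (ndist x w)%:Z - (ndist y w)%:Z = (ndist x w')%:Z - (ndist y w')%:Z.

Let local_spheres Rad n : local_predicate (Rad + n) (spheres Rad n).
Proof.
move=> S1 S2 I1 I2 _ _ [f [fd fo fp]] s1 y yR.
have [x xR fx] : exists2 x : S1, nball (Rad + n) x & f x = y.
  by apply: fo; apply: leq_trans yR (leq_addr _ _).
have oR : nball (Rad + n) (origin S1) by rewrite /nball/= ndistxx.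
have xr : nball Rad x by rewrite /nball/= -(fd _ _ oR xR).1 fx (isomorphic_origin fp).
have [w xw] := s1 x xr; exists (f w); rewrite -fx (fd _ _ xR _).1//.
by rewrite /nball/=; have := ndist_tri I1 x (origin S1) w; move: xr; rewrite /nball/= xw; lia.
Qed.

Let local_stable Rad K n : local_predicate (Rad + n) (stable Rad K n).
Proof.
move=> S1 S2 I1 I2 _ _ [f [fd fo fp]] s1 x y w w' xR yR wK wn w'K w'n.
have oR : nball (Rad + n) (origin S1) by rewrite /nball/= ndistxx.
have lift z m : (m <= Rad + n)%N -> nball m z ->
    exists x, [/\ nball (Rad + n) x, nball m x, f x = z &
      ndist (origin S1) x = ndist (origin S2) z].
  move=> mR zm; have [|x' x'R fx'] := fo z; first exact: leq_trans zm mR.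
  have E : ndist (origin S1) x' = ndist (origin S2) z.
    by rewrite -(fd _ _ oR x'R).1 fx' (isomorphic_origin fp).
  by exists x'; split=> //; rewrite /nball/= E.
have [x1 [x1R x1r <- _]] := lift x _ (leq_addr _ _) xR.
have [y1 [y1R y1r <- _]] := lift y _ (leq_addr _ _) yR.
have [w1 [w1R w1r fw1 w1o]] := lift w _ (leq_addl _ _) wn.
have [w2 [w2R w2r fw2 w2o]] := lift w' _ (leq_addl _ _) w'n.
rewrite -fw1 -fw2 !(fd _ _ _ _).1//; apply: s1 => //; first by rewrite w1o.
by rewrite w2o.
Qed.

(** The values of the differences are eliminated: they stabilize beyond a radius [K], uniform over
    the finite ball of radius [Rad]. The cutoff [n] makes each condition local, and only countable
    quantifiers remain. *)
Lemma has_busemannE (S : pointed_space 0 X) : has_busemann S <->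
  integral_space S /\ forall Rad, (forall n, spheres Rad n S) /\
    exists K, forall n, stable Rad K n S.
Proof.
split=> [gS|[IS H]].
  have [IS inf bus] := gS; split=> // Rad; split; first by move=> n x _; exact: inf.
  have /choice[b bP] : forall xy : S * S, exists b, busemann xy.1 xy.2 b.
    by move=> xy; exact: bus.
  have /(finite_ndist_bound (origin S))[K KP] : finite_set
      (\bigcup_(xy in @nball _ _ _ S Rad `*` @nball _ _ _ S Rad)
        [set w | ~ ((ndist xy.1 w)%:Z - (ndist xy.2 w)%:Z = b xy)]).
    apply: bigcup_finite => [|xy _]; last exact: bP.
    by apply: finite_setX; exact: finite_nball.
  exists K => n x y w w' xR yR.
  have val v : (K <= ndist (origin S) v)%N -> (ndist x v)%:Z - (ndist y v)%:Z = b (x, y).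
    by move=> Kv; apply: contrapT => h; have := KP v; rewrite ltnNge Kv => /(_ _)/negP; apply;
      [exists (x, y)|].
  by move=> /val -> _ /val -> _.
split=> //.
  by move=> x n; apply: (H (ndist (origin S) x)).1; exact: leqnn.
move=> x y; pose Rad := maxn (ndist (origin S) x) (ndist (origin S) y).
have [_ [K KP]] := H Rad.
have [w0 w0K] : exists w0, ndist (origin S) w0 = K.
  by apply: (H 0%N).1; rewrite /nball/= ndistxx.
exists ((ndist x w0)%:Z - (ndist y w0)%:Z).
apply: sub_finite_set (finite_nball IS (origin S) K) => w /=.
apply: contra_notP => /negP; rewrite -ltnNge => Kw.
apply: (KP (ndist (origin S) w)); rewrite /nball/= ?leq_maxl ?leq_maxr ?w0K//; exact: ltnW.
Qed.

Lemma measurable_has_busemann0 :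
  measurable [set c : D_star R | has_busemann (representative c)].
Proof.
have -> : [set c : D_star R | has_busemann (representative c)] = 
  \bigcap_Rad ((\bigcap_n [set c | integral_space (representative c) /\
       spheres Rad n (representative c)]) `&`
     \bigcup_K \bigcap_n [set c | integral_space (representative c) /\
       stable Rad K n (representative c)]).
  apply/seteqP; split=> c /=.
    move=> /has_busemannE[Ic H] Rad _; have [sph [K KP]] := H Rad.
    by split=> [n _|]; [split|exists K => // n _; split].
  move=> H; apply/has_busemannE; split; first by have [/(_ 0%N I)[]] := H 0%N I.
  move=> Rad; have [sph [K _ KP]] := H Rad I.
  by split=> [n|]; [case: (sph n I)|exists K => n; case: (KP n I)].
apply: bigcapT_measurable => Rad; apply: measurableI.
  by apply: bigcapT_measurable => n; exact: measurable_local0 (@local_spheres Rad n).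
apply: bigcupT_measurable => K; apply: bigcapT_measurable => n.
exact: measurable_local0 (@local_stable Rad K n).
Qed.

Lemma measurable_has_busemann k :
  measurable [set c : spaces k X | has_busemann (representative c)].
Proof.
have := measurable_recenter (@ord0 k) measurableT measurable_has_busemann0.
rewrite setTI; congr (measurable _); apply/seteqP; split=> c; rewrite /preimage/=.
  have [f [[g fK gK] fd _ _]] := representative_class (pointed1 (tnth (points (representative c)) ord0)).
  apply: (@has_busemann_isometry _ _ _ g f fK) => x y.
  by rewrite -fd !gK.
have [f [[g fK gK] fd _ _]] := representative_class (pointed1 (tnth (points (representative c)) ord0)).
exact: has_busemann_isometry gK fd.
Qed.

(** The limit set is the lower limit of the measurable sets given by the local predicates; this is
    how statements on heights and ancestors become measurable. *)
Lemma measurable_limit k (L : nat -> nat) (phi_ : nat -> pointed_space k X -> Prop)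
    (phi : pointed_space k X -> Prop) :
  (forall m, local_predicate (L m) (phi_ m)) ->
  (forall m S, phi_ m S -> within (L m) S) ->
  (forall S : pointed_space k X, has_busemann S ->
    exists M, forall m, (M <= m)%N -> phi_ m S <-> phi S) ->
  measurable [set c : spaces k X |
    has_busemann (representative c) /\ phi (representative c)].
Proof.
move=> lphi wphi limphi.
have -> : [set c : spaces k X | has_busemann (representative c) /\ phi (representative c)] =
  [set c : spaces k X | has_busemann (representative c)] `&`
  \bigcup_M \bigcap_(m in [set m | (M <= m)%N]) [set c : spaces k X |
    [/\ integral_space (representative c), within (L m) (representative c) &
        phi_ m (representative c)]].
  apply/seteqP; split=> c /= [gc H]; split=> //; have [M MP] := limphi _ gc.
    exists M => // m /= Mm; have pm := (MP m Mm).2 H.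
    by split=> //; [case: gc|exact: wphi].
  case: H => N _ NP; apply/(MP (maxn M N) (leq_maxl _ _)).
  by have [] := NP (maxn M N) (leq_maxr _ _).
apply: measurableI; first exact: measurable_has_busemann.
apply: bigcupT_measurable => M; apply: bigcap_measurableType => m _.
exact: measurable_local.
Qed.

End measurable_limit.

(** * Random residue classes of heights *)

Section uniform_dirac.
Variables (d : measure_display) (T : measurableType d) (R : realType) (n : nat).
Variable z : 'I_n.+1 -> T.

Definition uniform_dirac : set T -> \bar R :=
  mscale (n.+1%:R^-1 : R)%:nng (msum (fun i => dirac (z (inord i))) n.+1).

HB.instance Definition _ := Measure.on uniform_dirac.

Lemma uniform_diracE A :
  uniform_dirac A = ((n.+1%:R^-1)%:E * \sum_(i < n.+1) (\1_A (z i))%:E)%E.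
Proof.
rewrite /uniform_dirac /mscale/= /msum; congr (_ * _)%E.
by apply: eq_bigr => i _; rewrite inord_val /dirac.
Qed.

Lemma uniform_dirac_setT : uniform_dirac setT = 1%E.
Proof.
rewrite uniform_diracE.
under eq_bigr do rewrite indicE in_setT.
rewrite sumEFin -EFinM sumr_const card_ord mulVf// pnatr_eq0.
Qed.

HB.instance Definition _ :=
  Measure_isProbability.Build _ _ _ uniform_dirac uniform_dirac_setT.

End uniform_dirac.

Section selected_points.
Variables (R : realType) (n : nat) (D : discrete_space R).
Implicit Types (o x : D) (i : 'I_n.+1) (c : int).

(** The residue of [c] modulo [n.+1]; integer multiples also accommodate negative heights. *)
Definition level c : 'I_n.+1 := Zp1 *~ c.

Lemma levelD c1 c2 : level (c1 + c2) = level c1 + level c2.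
Proof. exact: mulrzDr. Qed.

Lemma level0 : level 0 = 0.
Proof. exact: mulr0z. Qed.

Lemma level_ord i : level (i : nat)%:Z = i.
Proof.
rewrite /level -pmulrn Zp_mulrn; apply/val_inj => /=.
by case: n i => [|m] i; [rewrite ord1 modn1|rewrite modnMml mul1n modn_small].
Qed.

(* [x] has descendants [n] generations below. *)
Definition tall x : Prop := exists2 u, ndist u x = n & busemann u x n%:Z.

Definition selected o i x : Prop :=
  (exists2 c, busemann x o c & level c = i) /\ tall x.

Definition sphere_selected (m : nat) o i x : Prop :=
  (exists2 c, sphere_busemann m x o c & level c = i) /\
  (exists2 u, ndist u x = n & sphere_busemann m u x n%:Z).

Lemma selected_shift o o' c i x : busemann o' o c ->
  selected o' i x <-> selected o (i + level c) x.
Proof.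
move=> o'o; split=> -[[c' xo ci] tx]; split=> //.
  by exists (c' + c); [exact: busemannD o'o|rewrite levelD ci].
exists (c' - c); first exact: busemannD xo (busemannN o'o).
by apply: (addIr (level c)); rewrite -levelD subrK.
Qed.

Lemma sphere_busemann_uniform (A : set D) : has_busemann D -> finite_set A ->
  exists M, forall m, (M <= m)%N -> forall x y c, A x -> A y ->
    sphere_busemann m x y c <-> busemann x y c.
Proof.
move=> gD /finite_seqP[s ->].
have /choice[M MP] : forall xy : D * D, exists M, forall m c, (M <= m)%N ->
    sphere_busemann m xy.1 xy.2 c <-> busemann xy.1 xy.2 c.
  by move=> xy; exact: sphere_busemann_eventually.
exists (\max_(xy <- [seq (x, y) | x <- s, y <- s]) M xy) => m Mm x y c xs ys.
apply: (MP (x, y)); apply: leq_trans Mm.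
by apply: leq_bigmax_seq => //; exact: (allpairs_f pair).
Qed.

Lemma sphere_selected_uniform o K : has_busemann D ->
  exists M, forall m, (M <= m)%N -> forall x i, (ndist o x <= K)%N ->
    sphere_selected m o i x <-> selected o i x.
Proof.
move=> gD; have ID : integral_space D by case: gD.
have [M MP] := sphere_busemann_uniform gD (finite_nball ID o (K + n)).
exists M => m /MP{}MP x i xK.
have Ao : (ndist o o <= K + n)%N by rewrite ndistxx.
have Ax : (ndist o x <= K + n)%N by apply: leq_trans xK (leq_addr _ _).
have Au u : ndist u x = n -> (ndist o u <= K + n)%N.
  by move=> ux; have := ndist_tri ID x o u; rewrite (ndistC x u) ux; lia.
split=> -[[c cP ci] [u ux uP]]; split.
- by exists c => //; apply/MP.
- by exists u => //; apply/MP => //; exact: Au.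
- by exists c => //; apply/MP.
- by exists u => //; apply/MP => //; exact: Au.
Qed.

End selected_points.

Section selected_isometry.
Variables (R : realType) (n : nat) (D1 D2 : discrete_space R) (f : D1 -> D2) (g : D2 -> D1).
Hypothesis gK : cancel g f.
Hypothesis fd : forall x y, dist (f x) (f y) = dist x y.

Lemma selected_isometry o (i : 'I_n.+1) x : selected o i x -> selected (f o) i (f x).
Proof.
move=> [[c cP ci] [u ux uP]]; split.
  by exists c => //; exact: (busemann_isometry gK fd cP).
exists (f u); first by rewrite /ndist fd.
exact: (busemann_isometry gK fd uP).
Qed.

End selected_isometry.

(** * The equivariant process of selected points *)

Section level_process.
Variables (R : realType) (Xi : mark_space R) (n : nat) (a b : Xi).

Definition set_marking (D : discrete_space R) (A : set D) : markings D Xi :=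
  fun x y => if `[< x = y /\ A x >] then a else b.

Lemma eq_set_marking (D : discrete_space R) (A B : set D) :
  (forall x, A x <-> B x) -> set_marking A = set_marking B.
Proof. by move=> AB; congr set_marking; apply/seteqP; split=> x /AB. Qed.

Definition level_marking (D : discrete_space R) (o : D) (i : 'I_n.+1) : markings D Xi :=
  set_marking (selected o i).

(** The base point is an arbitrary choice, which [level_lawE] removes from the law. An empty space,
    or one without Busemann differences, selects no point. *)
Definition chosen_marking (D : discrete_space R) (i : 'I_n.+1) : markings D Xi :=
  if pselect (exists o : D, has_busemann D) is left h then level_marking (sval (cid h)) i
  else set_marking set0.

Definition level_law (D : discrete_space R) : set (markings D Xi) -> \bar R :=
  uniform_dirac R (@chosen_marking D).

HB.instance Definition _ D := Probability.on (@level_law D).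

(* Changing the base point permutes the levels. *)
Lemma level_lawE (D : discrete_space R) (o : D) (B : set (markings D Xi)) :
  has_busemann D ->
  level_law B = ((n.+1%:R^-1)%:E * \sum_(i < n.+1) (\1_B (level_marking o i))%:E)%E.
Proof.
move=> gD; rewrite /level_law uniform_diracE /chosen_marking.
case: pselect => [h|[]]; last by exists o.
set o' := sval _; have [c o'o] : exists c, busemann o' o c by case: gD.
rewrite [in RHS](reindex_inj (addIr (level n c))); congr (_ * _)%E.
apply: eq_bigr => i _; congr (\1_B _)%:E; apply: eq_set_marking => x.
exact: selected_shift.
Qed.

Lemma level_law_default (D : discrete_space R) (B : set (markings D Xi)) :
  ~ has_busemann D -> level_law B = (\1_B (set_marking set0))%:E.
Proof.
move=> gD; rewrite /level_law uniform_diracE /chosen_marking.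
case: pselect => [h|_]; first by case: h.
by rewrite sumEFin -EFinM sumr_const card_ord -[X in _ * X]mulr_natl mulrA mulVf ?mul1r// pnatr_eq0.
Qed.

Lemma level_law_isometry (D1 D2 : discrete_space R) (rho : D1 -> D2) (rho' : D2 -> D1) :
  cancel rho rho' -> cancel rho' rho ->
  (forall x y, dist (rho x) (rho y) = dist x y) ->
  forall B : set (markings D2 Xi), measurable B ->
    level_law (D := D1) [set z | B (fun x y => z (rho' x) (rho' y))] = level_law B.
Proof.
move=> fK gK fd B _.
have gd x y : dist (rho' x) (rho' y) = dist x y by rewrite -fd !gK.
have markE (A1 : set D1) (A2 : set D2) : (forall x, A1 (rho' x) <-> A2 x) ->
    (fun x y => set_marking A1 (rho' x) (rho' y)) = set_marking A2.
  move=> A12; apply/funext => x; apply/funext => y; rewrite /set_marking.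
  congr (if _ then _ else _); apply/asboolP/asboolP => -[xy /A12 Ax]; split=> //.
    exact: (can_inj gK).
  by rewrite xy.
have [g1|ng1] := pselect (has_busemann D1); last first.
  rewrite !level_law_default//; last first.
    by move=> g2; apply: ng1; exact: (has_busemann_isometry fK gd).
  congr (_%:E); rewrite !indicE; congr (_%:R); congr nat_of_bool.
  by apply/idP/idP => /set_mem/= h; apply/mem_set => /=; move: h; rewrite (markE _ set0).
have g2 : has_busemann D2 := has_busemann_isometry gK fd g1.
(* Between empty spaces there is nothing to shift: all markings coincide. *)
have [oP|no] := pselect (exists o : D1, True); last first.
  rewrite /level_law !uniform_diracE; congr (_ * _)%E; apply: eq_bigr => i _.
  rewrite !indicE; congr (_%:R%:E); congr nat_of_bool; apply/idP/idP => /set_mem/= h;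
    apply/mem_set => /=; move: h; congr (B _); apply/funext => x;
    by case: no; exists (rho' x).
case: oP => o _; rewrite (level_lawE o _ g1) (level_lawE (rho o) _ g2); congr (_ * _)%E.
apply: eq_bigr => i _; rewrite !indicE; congr (_%:R%:E); congr nat_of_bool.
have E : (fun x y => level_marking o i (rho' x) (rho' y)) = level_marking (rho o) i.
  apply: markE => x; split=> [/(selected_isometry gK fd)|].
    by rewrite gK.
  by move=> /(selected_isometry fK gd); rewrite fK.
by apply/idP/idP => /set_mem/= h; apply/mem_set => /=; move: h; rewrite E.
Qed.

Local Notation X := (no_mark R).

Let sphere_marking m (D : discrete_space R) (o : D) (i : 'I_n.+1) : markings D Xi :=
  set_marking (sphere_selected m o i).

(** For a fixed [K] this depends on a ball up to a limit in the selection; for an open [U], the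
    class of the marked space is in [U] exactly when [U] is forced for some [K]. *)
Let forced (U : set (iso_class 0 Xi)) K
    (z : forall D : discrete_space R, D -> markings D Xi) (S : pointed_space 0 X) : Prop :=
  forall S' : pointed_space 0 Xi, integral_space S' ->
    ball_iso K (marked (origin S) (z S (origin S))) S' -> U (class S').

(** From a point of the ball of radius [K], the test looks [n] further for the deep descendant and
    [m] further for the witness of a height difference. *)
Lemma sphere_selected_ball K m (i : 'I_n.+1) (S1 S2 : pointed_space 0 X) (f : S1 -> S2) :
  integral_space S1 -> integral_space S2 ->
  (forall x y, nball (K + n + m) x -> nball (K + n + m) y -> ndist (f x) (f y) = ndist x y) ->
  (forall y : S2, nball (K + n + m) y -> exists2 x : S1, nball (K + n + m) x & f x = y) ->
  f (origin S1) = origin S2 -> forall x, nball K x ->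
  sphere_selected m (origin S1) i x <-> sphere_selected m (origin S2) i (f x).
Proof.
set L := (K + n + m)%N => I1 I2 fd fo foo.
have oL : nball L (origin S1) by rewrite /nball/= ndistxx.
have lift (y : S2) k : (k <= L)%N -> nball k y -> exists x : S1, nball k x /\ f x = y.
  move=> kL yk; have [|x xL fx] := fo y; first exact: leq_trans yk kL.
  by exists x; split=> //; rewrite /nball/= -(fd _ _ oL xL) fx foo.
have near (S : pointed_space 0 X) (x y : S) k l : integral_space S -> nball k x ->
    ndist x y = l -> nball (k + l) y.
  by move=> IS xk xy; have := ndist_tri IS x (origin S) y; move: xk; rewrite /nball/= xy; lia.
have sub (S : pointed_space 0 X) (x : S) k : (k <= L)%N -> nball k x -> nball L x.
  by move=> kL xk; exact: leq_trans xk kL.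
have KnL : (K + n <= L)%N by rewrite /L; lia.
have KL : (K <= L)%N by rewrite /L; lia.
have sbE x y c : nball (K + n) x -> nball L y ->
    sphere_busemann m x y c <-> sphere_busemann m (f x) (f y) c.
  move=> xK yL; split=> -[w [xw wc]].
    have wL : nball L w by exact: near xw.
    by exists (f w); rewrite !fd//; exact: sub xK.
  have fxK : nball (K + n) (f x).
    by rewrite /nball/= -foo fd//; exact: sub xK.
  have [w' [w'L fw]] := lift w L (leqnn _) (near _ _ _ _ _ I2 fxK xw).
  by exists w'; rewrite -!fd ?fw//; exact: sub xK.
have wid (S : pointed_space 0 X) (x : S) : nball K x -> nball (K + n) x.
  by move=> xK; apply: leq_trans xK (leq_addr _ _).
move=> x xK; split=> -[[c cP ci] [u ux uP]]; split.
- by exists c => //; rewrite -foo -sbE//; exact: wid.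
- have uK : nball (K + n) u by apply: near xK _; rewrite // ndistC.
  exists (f u); first by rewrite fd//; [exact: sub uK|exact: sub xK].
  by rewrite -sbE//; exact: sub xK.
- by exists c => //; rewrite sbE ?foo//; exact: wid.
- have fxK : nball K (f x) by rewrite /nball/= -foo fd//; exact: sub xK.
  have [v [vK fv]] : exists v : S1, nball (K + n) v /\ f v = u.
    by apply: lift => //; apply: near fxK _; rewrite // ndistC.
  exists v; first by rewrite -fd ?fv//; [exact: sub vK|exact: sub xK].
  by rewrite sbE ?fv//; exact: sub xK.
Qed.

Let local_forced U K m i :
  local_predicate (K + n + m) (forced U K (fun D o => sphere_marking m o i)).
Proof.
move=> S1 S2 I1 I2 _ _ [f [fd fo fp]] F1 S' I' [g [gd go gp]].
have foo : f (origin S1) = origin S2 := isomorphic_origin fp.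
have oL : nball (K + n + m) (origin S1) by rewrite /nball/= ndistxx.
have KL x : @nball _ _ _ S1 K x -> nball (K + n + m) x.
  by move=> xK; apply: leq_trans xK _; lia.
have fK x : nball K x -> nball K (f x).
  by move=> xK; rewrite /nball/= -foo (fd _ _ oL (KL _ xK)).1.
apply: F1 => //; exists (g \o f); split.
- move=> x y xK yK /=; have [gdxy gm] := gd _ _ (fK x xK) (fK y yK).
  split; first by rewrite gdxy (fd _ _ (KL _ xK) (KL _ yK)).1.
  rewrite gm /= /sphere_marking /set_marking; congr (if _ then _ else _).
  have sE := sphere_selected_ball i I1 I2 (fun x y xL yL => (fd x y xL yL).1) fo foo xK.
  apply/asboolP/asboolP => -[xy /sE sx]; split=> //; last by rewrite xy.
  by apply: (ndist_eq0 I1); rewrite -(fd _ _ (KL _ xK) (KL _ yK)).1 xy ndistxx.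
- move=> y yK; have [v vK <-] := go y yK.
  have {}vK : (ndist (origin S2) v <= K)%N by exact: vK.
  have [|x xL fx] := fo v; first by apply: leq_trans vK _; lia.
  exists x; last by rewrite /= fx.
  suff : (ndist (origin S1) x <= K)%N by [].
  by rewrite -(fd _ _ oL xL).1 foo fx.
- by rewrite /= -gp /= -foo.
Qed.

Let forced_limit U K i (S : pointed_space 0 X) : has_busemann S ->
  exists M, forall m, (M <= m)%N ->
    forced U K (fun D o => sphere_marking m o i) S <->
    forced U K (fun D o => level_marking o i) S.
Proof.
move=> gS; have [M MP] := @sphere_selected_uniform _ n _ (origin S) K gS.
have main m (Mm : (M <= m)%N) (S' : pointed_space 0 Xi) :
    ball_iso K (marked (origin S) (sphere_marking m (origin S) i)) S' <->
    ball_iso K (marked (origin S) (level_marking (origin S) i)) S'.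
  have markE x y : nball K x ->
      sphere_marking m (origin S) i x y = level_marking (origin S) i x y.
    move=> xK; rewrite /sphere_marking /level_marking /set_marking.
    congr (if _ then _ else _); have sE := MP m Mm x i xK.
    by apply/asboolP/asboolP => -[xy /sE].
  split=> -[f [fd fo fp]]; exists f; split=> // x y xK yK;
    have [-> ->] := fd x y xK yK; split=> //=; rewrite markE//.
by exists M => m Mm; split=> h S' I' /(main m Mm); exact: h.
Qed.

Lemma ball_iso_approximates (S : pointed_space 0 Xi) (S' : pointed_space 0 Xi) K e :
  integral_space S -> integral_space S' -> 0 < e -> e^-1 <= K%:R ->
  ball_iso K S S' -> approximates e S S' /\ approximates e S' S.
Proof.
move=> IS IS' e0 eK [f [fd fo fp]].
have foo : f (origin S) = origin S' := isomorphic_origin fp.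
have BK (S0 : pointed_space 0 Xi) (x : S0) : integral_space S0 ->
    dist (origin S0) x <= e^-1 -> nball K x.
  by move=> I0; rewrite I0 => h; have := le_trans h eK; rewrite ler_nat.
have mm0 (x : Xi) : mark_dist x x <= e.
  by case: (mark_distance Xi) => h _ _; rewrite ((h x x).2 erefl) ltW.
have fI x y : nball K x -> nball K y -> f x = f y -> x = y.
  by move=> xK yK xy; apply: (ndist_eq0 IS); rewrite -(fd _ _ xK yK).1 xy ndistxx.
split.
  exists f; split.
  - by move=> x y /set_mem/(BK _ _ IS) xK /set_mem/(BK _ _ IS) yK; exact: fI.
  - by move=> i _; exact: isomorphic_tnth.
  - move=> x y /(BK _ _ IS) xK /(BK _ _ IS) yK.
    by rewrite IS' IS (fd _ _ xK yK).1 subrr normr0 ltW.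
  - by move=> x y /(BK _ _ IS) xK /(BK _ _ IS) yK; rewrite (fd _ _ xK yK).2.
have /choice[g gP] : forall y : S', exists x : S, nball K y -> nball K x /\ f x = y.
  move=> y; have [/fo[x xK fx]|] := pselect (nball K y); first by exists x.
  by exists (origin S).
exists g; split.
- move=> x y /set_mem/(BK _ _ IS')/gP[_ {2}<-] /set_mem/(BK _ _ IS')/gP[_ {2}<-].
  by move=> ->.
- move=> i _; rewrite (ord1 i) -!/(origin _).
  have oK : nball K (origin S') by rewrite /nball/= ndistxx.
  have [gK fg] := gP _ oK; apply: fI => //; last by rewrite fg foo.
  by rewrite /nball/= ndistxx.
- move=> x y /(BK _ _ IS')/gP[gx {2}<-] /(BK _ _ IS')/gP[gy {2}<-].
  by rewrite IS' IS (fd _ _ gx gy).1 subrr normr0 ltW.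
- move=> x y /(BK _ _ IS')/gP[gx {2}<-] /(BK _ _ IS')/gP[gy {2}<-].
  by rewrite (fd _ _ gx gy).2.
Qed.

Let level_class i (c : D_star R) : D'_star Xi :=
  class (marked (origin (representative c)) (level_marking (origin (representative c)) i)).

Let default_class (c : D_star R) : D'_star Xi :=
  class (marked (origin (representative c)) (set_marking set0)).

Let measurable_level_class i :
  measurable_fun [set c : D_star R | has_busemann (representative c)] (level_class i).
Proof.
refine (@measurability _ _ (D_star R) (D'_star Xi) _ (level_class i) (@class_open R 0 Xi) erefl _).
move=> _ [U oU <-].
have -> : [set c : D_star R | has_busemann (representative c)] `&` level_class i @^-1` U =
    \bigcup_K [set c : D_star R | has_busemann (representative c) /\
      forced U K (fun D o => level_marking o i) (representative c)].
  apply/seteqP; split=> [c [gc /= Uc]|c [K _ [gc Fc]]] /=.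
    have Ic : integral_space (representative c) by case: gc.
    have [e e0 eU] := class_open_class oU Uc.
    exists (Num.truncn e^-1).+1 => //; split=> // S' I' biso.
    have eK : e^-1 <= (Num.truncn e^-1).+1%:R by exact/ltW/truncnS_gt.
    pose S0 := marked (origin (representative c)) (level_marking (origin (representative c)) i).
    have [h1 h2] := @ball_iso_approximates S0 S' _ _ Ic I' e0 eK biso.
    exact: eU.
  split=> //; apply: Fc; first by case: gc.
  exact/isomorphic_ball_iso/asboolP/isomorphic_refl.
apply: bigcupT_measurable => K.
apply: (@measurable_limit R 0 (fun m => K + n + m)%N).
- by move=> m; exact: local_forced.
- by move=> m S _; exact: within0.
- by move=> S gS; exact: forced_limit.
Qed.

Let measurable_default_class : measurable_fun [set: D_star R] default_class.
Proof.
refine (@measurability _ _ (D_star R) (D'_star Xi) _ default_class (@class_open R 0 Xi) erefl _).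
move=> _ [U oU <-]; rewrite setTI; apply: measurable_class_open.
have dE (S : pointed_space 0 X) : default_class (class S) =
    class (marked (origin S) (set_marking set0)).
  apply: class_eq; have [f [fb fd fp _]] := isomorphicS (representative_class S).
  exists f; split=> //=; first by rewrite (isomorphic_origin fp).
  by move=> x y; rewrite /set_marking; do 2 case: asboolP => [[] //|].
have mm0 (x : Xi) : mark_dist x x = 0.
  by case: (mark_distance Xi) => h _ _; exact/h.
have approx e e' (S1 S2 : pointed_space 0 X) : 0 < e' -> e' <= e -> approximates e' S1 S2 ->
    approximates e (marked (origin S1) (set_marking set0)) (marked (origin S2) (set_marking set0)).
  move=> e'0 e'e [f [fI fp fd _]]; exists f.
  have B x : dist (origin S1) x <= e^-1 -> dist (origin S1) x <= e'^-1.
    by move/le_trans; apply; rewrite lef_pV2 ?posrE ?(lt_le_trans e'0).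
  split.
  - by move=> x y /set_mem/B xB /set_mem/B yB; apply: fI; exact/mem_set.
  - by move=> i /B iB; rewrite (ord1 i) /=; apply: fp; rewrite /= distxx invr_ge0 ltW.
  - by move=> x y /B xB /B yB; apply: le_trans (fd _ _ xB yB) e'e.
  - move=> x y _ _ /=; rewrite /set_marking; do 2 case: asboolP => [[] //|_].
    by rewrite mm0 ltW// (lt_le_trans e'0).
apply: class_openI => S; rewrite /preimage /= dE => /(class_open_class oU)[e e0 eU].
exists e => // S' e' e'0 /ltW e'e SS' S'S; rewrite dE; apply: eU; exact: approx e'e _.
Qed.

Lemma level_law_measurable (A : set (D'_star Xi)) : measurable A ->
  measurable_fun [set: D_star R] (fun c : D_star R =>
    level_law (D := representative c)
      [set z | A (class (marked (origin (representative c)) z))]).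
Proof.
move=> mA.
pose G := [set c : D_star R | has_busemann (representative c)].
have mG : measurable G by exact: measurable_has_busemann.
pose E i := (G `&` level_class i @^-1` A) `|` (~` G `&` default_class @^-1` A).
have mE i : measurable (E i).
  apply: measurableU; first exact: measurable_level_class.
  apply: measurableI; first exact: measurableC.
  by rewrite -[X in measurable X]setTI; exact: measurable_default_class.
rewrite (_ : (fun _ => _) =
    fun c => ((n.+1%:R^-1)%:E * \sum_(i < n.+1) (\1_(E i) c)%:E)%E); last first.
  apply/funext => c; have [gc|ngc] := pselect (G c).
    rewrite (level_lawE (origin (representative c)) _ gc); congr (_ * _)%E.
    apply: eq_bigr => i _; rewrite !indicE; congr (_%:R%:E); congr nat_of_bool.
    apply/idP/idP => /set_mem/= h; apply/mem_set => /=; first by left.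
    by case: h => [[]|[]].
  rewrite level_law_default//.
  rewrite (eq_bigr (fun=> (\1_[set z | A (class (marked (origin (representative c)) z))]
    (set_marking set0 : markings (representative c) Xi))%:E)).
    by rewrite sumEFin -EFinM sumr_const card_ord -[X in _ * X]mulr_natl mulrA mulVf ?mul1r// pnatr_eq0.
  move=> i _; rewrite !indicE; congr (_%:R%:E); congr nat_of_bool.
  apply/idP/idP => /set_mem/= h; apply/mem_set => /=; last by right.
  by case: h => [[]|[]].
apply: emeasurable_funM => //.
apply: emeasurable_sum => i _.
exact: measurable_EFin_indic.
Qed.

Definition level_process : equivariant_process Xi :=
  EquivariantProcess level_law_isometry level_law_measurable.

End level_process.

(** * Sums over countable sets *)

Section countable_sums.
Local Open Scope ereal_scope.
Variable R : realType.

(** A single enumeration, padded with [None], serves all [a]; results on series of functions thus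
    carry over to [esum]. *)
Lemma esum_nneseries (T : choiceType) (J : set T) : countable J ->
  exists u : nat -> option T, forall a : T -> \bar R, (forall x, 0 <= a x) ->
    \esum_(x in J) a x = \sum_(n <oo) oapp a 0 (u n).
Proof.
move=> /countable_injP[e eI].
pose u n := if pselect (exists x, J x /\ e x = n) is left h then Some (sval (cid h)) else None.
have uP x : J x -> u (e x) = Some x.
  move=> Jx; rewrite /u; case: pselect => [h|[]]; last by exists x.
  by congr Some; have [Jy yx] := svalP (cid h); apply: eI => //; exact/mem_set.
exists u => a a0; rewrite nneseries_esumT; last by move=> n; case: (u n) => /=.
rewrite -(@eq_esum _ _ J (fun x => oapp a 0 (u (e x)))); last by move=> x /uP ->.
rewrite -(esum_image _ e (fun n => oapp a 0 (u n)))//.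
rewrite esum_mkcond; apply: eq_esum => n _; case: ifPn => // /negP nJ.
rewrite /u; case: pselect => //= -[x [Jx xn]]; case: nJ; apply/mem_set.
by exists x.
Qed.

Lemma esumZl (T : choiceType) (J : set T) (c : R) (a : T -> \bar R) :
  countable J -> (0 <= c)%R -> (forall x, 0 <= a x) ->
  \esum_(x in J) (c%:E * a x) = c%:E * \esum_(x in J) a x.
Proof.
move=> /esum_nneseries[u uP] c0 a0; rewrite !uP//; last by move=> x; rewrite mule_ge0.
rewrite -nneseriesZl//; last by move=> n _; case: (u n) => /=.
by apply: eq_eseriesr => n _; case: (u n) => //=; rewrite mule0.
Qed.

Lemma exchange_esum (T1 T2 : choiceType) (I : set T1) (J : set T2) (a : T1 -> T2 -> \bar R) :
  (forall i j, 0 <= a i j) ->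
  \esum_(i in I) \esum_(j in J) a i j = \esum_(j in J) \esum_(i in I) a i j.
Proof.
move=> a0; rewrite !esum_esum//.
rewrite (reindex_esum (J `*` I) _ (fun x => (x.2, x.1)))//; split=> //=.
- by move=> [i j] [].
- by move=> [i1 i2] [j1 j2] /= _ _ [] -> ->.
- by move=> [i1 i2] [Pi1 Qi2] /=; exists (i2, i1).
Qed.

Lemma integral_esum d (T : measurableType d) (mu : {measure set T -> \bar R})
    (I : choiceType) (J : set I) (f : I -> T -> \bar R) :
  countable J -> (forall i, measurable_fun setT (f i)) -> (forall i x, 0 <= f i x) ->
  \int[mu]_x (\esum_(i in J) f i x) = \esum_(i in J) \int[mu]_x f i x.
Proof.
move=> /esum_nneseries[u uP] mf f0.
under eq_integral do rewrite uP//.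
rewrite integral_nneseries//.
- rewrite uP; last by move=> i; exact: integral_ge0.
  by apply: eq_eseriesr => n _; case: (u n) => //=; rewrite integral0.
- by move=> n; case: (u n) => //=; exact: measurable_cst.
- by move=> n x _; case: (u n) => /=.
Qed.

Lemma measurable_esum d (T : measurableType d) (I : choiceType) (J : set I)
    (f : I -> T -> \bar R) :
  countable J -> (forall i, measurable_fun setT (f i)) -> (forall i x, 0 <= f i x) ->
  measurable_fun setT (fun x => \esum_(i in J) f i x).
Proof.
move=> /esum_nneseries[u uP] mf f0.
rewrite (_ : (fun _ => _) = fun x => \sum_(n <oo) oapp (f ^~ x) 0 (u n)); last first.
  by apply/funext => x; rewrite uP.
apply: ge0_emeasurable_sum => n; first by move=> x _; case: (u n) => /=.
by case: (u n) => //= _; exact: measurable_cst.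
Qed.

Lemma esum_delta (T : choiceType) (i : T) (x : \bar R) : 0 <= x ->
  \esum_(j in [set: T]) (if j == i then x else 0) = x.
Proof.
move=> x0; rewrite -[RHS](@esum_set1 _ _ i (fun=> x))// [RHS]esum_mkcond.
by apply: eq_esum => j _; rewrite in_set1.
Qed.

Lemma esum_card (T : choiceType) (A : set T) : finite_set A ->
  \esum_(x in A) 1 = (#|` fset_set A|%fset)%:R%:E :> \bar R.
Proof.
move=> fA; rewrite esum_fset// fsbig_finite//= sumEFin.
by rewrite big_const_seq count_predT iter_addr addr0.
Qed.

End countable_sums.

Lemma fset_card_gt0 (T : choiceType) (A : set T) : finite_set A ->
  (0 < #|` fset_set A|%fset)%N <-> exists x, A x.
Proof.
move=> fA; rewrite cardfs_gt0; split.
  by move=> /fset0Pn[x]; rewrite in_fset_set// => /set_mem Ax; exists x.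
move=> [x Ax]; apply/fset0Pn; exists x; rewrite in_fset_set//; exact/mem_set.
Qed.

(** * Independence of generated sigma-algebras *)

Section independence.
Local Open Scope ereal_scope.
Variables (d : measure_display) (T : measurableType d) (R : realType).
Variable Q : probability T R.

(** Dynkin's argument in one variable: for fixed [A], the events independent of [A] form a
    lambda-system. Using it once on each side gives [independent_sigma]. *)
Let indep_dynkin (G : set (set T)) (A : set T) : setI_closed G ->
  G `<=` measurable -> measurable A -> (forall B, G B -> Q (A `&` B) = Q A * Q B) ->
  forall B, <<s G >> B -> measurable B /\ Q (A `&` B) = Q A * Q B.
Proof.
move=> GI Gm mA GA; have fQ B : measurable B -> Q B \is a fin_num.
  exact: fin_num_measure.
apply: (@lambda_system_subset _ G GI setT); [|by move=> B GB; split; [exact: Gm|exact: GA]|by []].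
apply/dynkin_lambda_system; split=> /=.
- by split; [exact: measurableT|rewrite setIT probability_setT mule1].
- move=> B [mB QB]; split; first exact: measurableC.
  rewrite -setDE measureD//; last by rewrite ltey_eq fQ.
  rewrite [X in _ - X]QB probability_setC// muleBr ?mule1 ?fQ// fin_num_adde_defr// fQ//.
- move=> F tF HF; split; first by apply: bigcup_measurable => k _; exact: (HF k).1.
  rewrite setI_bigcupr measure_bigcup//; last 2 first.
    by move=> i _; apply: measurableI => //; exact: (HF i).1.
    by apply: trivIset_setIl.
  rewrite measure_bigcup//; last by move=> i _; exact: (HF i).1.
  rewrite -[Q A in RHS](fineK (fQ _ mA)) -nneseriesZl// (fineK (fQ _ mA)).
  by apply: eq_eseriesr => i _; exact: (HF i).2.
Qed.

Lemma independent_sigma (G1 G2 : set (set T)) : setI_closed G1 -> setI_closed G2 ->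
  G1 `<=` measurable -> G2 `<=` measurable ->
  (forall A B, G1 A -> G2 B -> Q (A `&` B) = Q A * Q B) ->
  forall A B, <<s G1 >> A -> <<s G2 >> B -> Q (A `&` B) = Q A * Q B.
Proof.
move=> I1 I2 m1 m2 G12 A B sA sB.
have h1 A' : G1 A' -> forall B, <<s G2 >> B -> measurable B /\ Q (A' `&` B) = Q A' * Q B.
  by move=> GA'; apply: indep_dynkin => // [|B' GB']; [exact: m1|exact: G12].
have mB : measurable B.
  by apply: (smallest_sub _ m2 sB); exact: sigma_algebra_measurable.
rewrite setIC muleC; apply: (indep_dynkin I1 m1 mB _ sA).2 => A' GA'.
by rewrite setIC muleC; exact: (h1 A' GA' B sB).2.
Qed.

End independence.

(** * Critical Galton-Watson trees *)

Lemma gw_vertex_cons (N : seq nat -> nat) i u :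
  gw_vertex N (i :: u) <-> (i < N [::])%N /\ gw_vertex (fun w => N (i :: w)) u.
Proof.
split=> [Niu|[i0 Nu] [|k v] j u' /= [] <- uE].
- split; first exact: (Niu [::] i u).
  by move=> v j u' uE; apply: (Niu (i :: v) j u'); rewrite uE.
- by [].
- exact: (Nu v j u').
Qed.

Definition words (n : nat) : set (seq nat) := [set u | size u = n].

Lemma words0 : words 0 = [set [::]].
Proof. by apply/seteqP; split=> u; rewrite /words /=; [move/size0nil|move=> ->]. Qed.

Lemma countable_words n : countable (words n).
Proof. exact: (sub_countable (subset_card_le (@subsetT _ (words n))) (@countableP _ setT)). Qed.

Lemma esum_words (R : realType) n (f : seq nat -> \bar R) : (forall u, 0 <= f u)%E ->
  (\esum_(u in words n.+1) f u = \esum_(i in [set: nat]) \esum_(u in words n) f (i :: u))%E.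
Proof.
move=> f0; rewrite esum_esum//; apply: reindex_esum; split.
- by move=> [i u] [_ /= un]; rewrite /words /= un.
- by move=> [i u] [j v] _ _ [/= -> ->].
- by move=> [|i u] //= [un]; exists (i, u).
Qed.

Section galton_watson.
Local Open Scope ereal_scope.
Variables (R : realType) (d : measure_display) (Omega : measurableType d).
Variables (Q : probability Omega R) (p : probability nat R).
Variable N : seq nat -> Omega -> nat.
Hypothesis iidN : iid_offspring Q p N.
Implicit Types (S : set (seq nat)) (v u : seq nat) (i j n : nat).

Let cylinder S : set (set Omega) := [set C | exists (s : seq (seq nat)) (B : seq nat -> set nat),
  [/\ uniq s, forall v, v \in s -> S v & C = \bigcap_(v in [set` s]) (N v @^-1` B v)]].

Let mN v (B : set nat) : measurable (N v @^-1` B).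
Proof. by rewrite -[X in measurable X]setTI; apply: (iidN.1 v). Qed.

Let cylinderI S : setI_closed (cylinder S).
Proof.
move=> _ _ [s [B [us sS ->]]] [s' [B' [us' s'S ->]]].
exists (undup (s ++ s')), (fun v => (if v \in s then B v else setT) `&`
  (if v \in s' then B' v else setT)); split; first exact: undup_uniq.
  by move=> v; rewrite mem_undup mem_cat => /orP[/sS|/s'S].
apply/seteqP; split=> w /= h.
  by move=> v /= _; split; case: ifPn => // vs; [exact: (h.1 v vs)|exact: (h.2 v vs)].
split=> v /= vs; have [|hB hB'] := h v; rewrite /= ?mem_undup ?mem_cat ?vs ?orbT//.
  by move: hB; rewrite vs.
by move: hB'; rewrite vs.
Qed.

Let cylinder_measurable S : cylinder S `<=` measurable.
Proof.
move=> _ [s [B [_ _ ->]]]; apply: fin_bigcap_measurable => // v _; exact: mN.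
Qed.

Let cylinder_indep S S' A B : (forall v, S v -> ~ S' v) -> cylinder S A -> cylinder S' B ->
  Q (A `&` B) = Q A * Q B.
Proof.
move=> SS' [s [C [us sS ->]]] [s' [C' [us' s'S ->]]].
have ss' v : v \in s' -> v \in s = false.
  by move=> vs'; apply/negP => /sS/SS'; apply; exact: s'S.
pose C'' v := if v \in s then C v else C' v.
have -> : \bigcap_(v in [set` s]) (N v @^-1` C v) `&` \bigcap_(v in [set` s']) (N v @^-1` C' v)
    = \bigcap_(v in [set` s ++ s']) (N v @^-1` C'' v).
  apply/seteqP; split=> w /=.
    move=> [h h'] v; rewrite /= mem_cat /C'' => vss; case: ifPn => vs; first exact: (h v vs).
    by move: vss; rewrite (negbTE vs) => /h'.
  move=> h; split=> v /= vs; have := h v; rewrite /= mem_cat vs ?orbT /C'' ?vs ?ss'//.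
    exact.
  exact.
rewrite !iidN.2 ?cat_uniq ?us ?us' ?andbT//; last first.
  by apply/hasPn => v /ss' ->.
rewrite big_cat /=; congr (_ * _); rewrite [LHS]big_seq [RHS]big_seq; apply: eq_bigr => v vs.
  by rewrite /C'' vs.
by rewrite /C'' ss'.
Qed.

(** The sigma-algebra generated by the variables [N v] with [v] in [S]. *)
Definition determined S : set (set Omega) := <<s cylinder S >>.

Lemma determined_measurable S A : determined S A -> measurable A.
Proof.
move=> sA; apply: (smallest_sub _ (@cylinder_measurable S) sA).
exact: sigma_algebra_measurable.
Qed.

Lemma independent_determined S S' A B : (forall v, S v -> ~ S' v) ->
  determined S A -> determined S' B -> Q (A `&` B) = Q A * Q B.
Proof.
move=> SS'; apply: independent_sigma.
- exact: cylinderI.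
- exact: cylinderI.
- exact: cylinder_measurable.
- exact: cylinder_measurable.
- by move=> ? ?; exact: cylinder_indep.
Qed.

Lemma determined_sub S S' A : (forall v, S v -> S' v) -> determined S A -> determined S' A.
Proof.
move=> SS'; move: A; apply: smallest_sub; first exact: smallest_sigma_algebra.
move=> C CC; apply: sub_gen_smallest; move: C CC.
by move=> _ [s [B [us sS ->]]]; exists s, B; split=> // v /sS/SS'.
Qed.

Lemma determinedU S (F : nat -> set Omega) :
  (forall i, determined S (F i)) -> determined S (\bigcup_i F i).
Proof. by have [_ _ h] := smallest_sigma_algebra setT (cylinder S); exact: h. Qed.

Lemma determinedC S A : determined S A -> determined S (~` A).
Proof.
have [_ h _] := smallest_sigma_algebra setT (cylinder S); rewrite -setTD; exact: h.
Qed.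

Lemma determinedI S A B : determined S A -> determined S B -> determined S (A `&` B).
Proof.
move=> sA sB; rewrite -[_ `&` _]setCK setCI; apply: determinedC.
rewrite -bigcup2E; apply: determinedU => -[|[|i]] /=; try exact: determinedC.
by have [h _ _] := smallest_sigma_algebra setT (cylinder S).
Qed.

Lemma determinedT S : determined S setT.
Proof.
rewrite -setC0; apply: determinedC.
by have [h _ _] := smallest_sigma_algebra setT (cylinder S).
Qed.

Definition offspring_gt v i : set Omega := [set w | (i < N v w)%N].

Definition prob_gt i : \bar R := p [set k | (i < k)%N].

Lemma determined_offspring v i : determined [set v] (offspring_gt v i).
Proof.
apply: sub_gen_smallest; exists [:: v], (fun=> [set k | (i < k)%N]); split=> //.
  by move=> u; rewrite inE => /eqP.
by rewrite set_cons1 bigcap_set1.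
Qed.

Lemma prob_offspring v i : Q (offspring_gt v i) = prob_gt i.
Proof.
have := iidN.2 [:: v] (fun=> [set k | (i < k)%N]) erefl.
by rewrite big_seq1 set_cons1 bigcap_set1.
Qed.

(** Survival relative to [v], whether or not [v] itself is in the tree; this keeps disjoint subtrees
    independent. *)
Definition alive v u : set Omega := [set w | gw_vertex (fun x => N (v ++ x) w) u].

Definition below_word v : set (seq nat) := [set x | exists u, x = v ++ u].

Lemma alive_nil v : alive v [::] = setT.
Proof. by apply/seteqP; split=> // w _; exact: gw_vertex_root. Qed.

Lemma alive_cons v i u : alive v (i :: u) = offspring_gt v i `&` alive (rcons v i) u.
Proof.
have E w : (fun x => N (v ++ i :: x) w) = (fun x => N (rcons v i ++ x) w).
  by apply/funext => x; rewrite cat_rcons.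
apply/seteqP; split=> w; rewrite /alive /offspring_gt /=.
  by move=> /gw_vertex_cons; rewrite cats0 E.
by rewrite -E => h; apply/gw_vertex_cons; rewrite cats0.
Qed.

Lemma below_rcons v i : below_word (rcons v i) `<=` below_word v.
Proof. by move=> _ [u ->]; exists (i :: u); rewrite cat_rcons. Qed.

Lemma below_rcons_self v i : below_word (rcons v i) v -> False.
Proof. by move=> [u /(congr1 size)]; rewrite size_cat size_rcons; lia. Qed.

Lemma below_disjoint v i j x : i != j -> below_word (rcons v i) x ->
  below_word (rcons v j) x -> False.
Proof.
move=> ij [u ->] [u']; rewrite !cat_rcons => /eqP.
by rewrite eqseq_cat// eqxx /= eqseq_cons (negbTE ij).
Qed.

Lemma determined_alive v u : determined (below_word v) (alive v u).
Proof.
elim: u v => [|i u IH] v; first by rewrite alive_nil; exact: determinedT.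
rewrite alive_cons; apply: determinedI.
  by apply: (determined_sub _ (@determined_offspring v i)) => _ ->; exists [::]; rewrite cats0.
exact: (determined_sub (@below_rcons v i) (IH _)).
Qed.

Definition reaches v n : set Omega := \bigcup_(u in words n) alive v u.

Lemma reachesS v n :
  reaches v n.+1 = \bigcup_i (offspring_gt v i `&` reaches (rcons v i) n).
Proof.
apply/seteqP; split=> w.
  move=> [[|i u] //= [un]]; rewrite alive_cons => -[Ni Au].
  by exists i => //; split=> //; exists u.
move=> [i _ [Ni [u un Au]]]; exists (i :: u); first by rewrite /words /= un.
by rewrite alive_cons.
Qed.

Lemma determined_reaches v n : determined (below_word v) (reaches v n).
Proof.
elim: n v => [|n IH] v.
  by rewrite /reaches words0 bigcup_set1 alive_nil; exact: determinedT.
rewrite reachesS; apply: determinedU => i; apply: determinedI.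
  by apply: (determined_sub _ (@determined_offspring v i)) => _ ->; exists [::]; rewrite cats0.
exact: (determined_sub (@below_rcons v i) (IH _)).
Qed.

Lemma prob_offspringI v i A : determined (below_word (rcons v i)) A ->
  Q (offspring_gt v i `&` A) = prob_gt i * Q A.
Proof.
move=> dA; rewrite -(prob_offspring v); apply: independent_determined (@determined_offspring v i) dA.
by move=> _ ->; exact: below_rcons_self.
Qed.

(** Both children exist exactly when the one of larger index does; given distinct indices, their
    subtrees and the offspring number of [v] involve disjoint sets of words. *)
Lemma prob_offspringII v i j A B : i != j ->
  determined (below_word (rcons v i)) A -> determined (below_word (rcons v j)) B ->
  Q ((offspring_gt v i `&` A) `&` (offspring_gt v j `&` B)) =
  prob_gt (maxn i j) * (Q A * Q B).
Proof.
move=> ij dA dB.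
have -> : (offspring_gt v i `&` A) `&` (offspring_gt v j `&` B) =
    offspring_gt v (maxn i j) `&` (A `&` B).
  rewrite setIACA; congr (_ `&` _); apply/seteqP; split=> w; rewrite /offspring_gt /= gtn_max.
    by move=> [-> ->].
  by move=> /andP[].
rewrite -(prob_offspring v) -(independent_determined _ dA dB); last first.
  by move=> x; exact: below_disjoint ij.
apply: (@independent_determined [set v] (below_word (rcons v i) `|` below_word (rcons v j))).
- by move=> _ -> [] /below_rcons_self.
- exact: determined_offspring.
- by apply: determinedI; [apply: (determined_sub _ dA)|apply: (determined_sub _ dB)] => x; [left|right].
Qed.

Hypothesis critical : \esum_(i in [set: nat]) prob_gt i = 1.

Let prob_gt_fin i : prob_gt i \is a fin_num.
Proof. exact: fin_num_measure. Qed.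

Lemma first_moment n v : \esum_(u in words n) Q (alive v u) <= 1.
Proof.
elim: n v => [|n IH] v.
  by rewrite words0 esum_set1// alive_nil probability_setT.
rewrite esum_words// -critical; apply: le_esum => i _.
rewrite (@eq_esum _ _ _ _ (fun u => (fine (prob_gt i))%:E * Q (alive (rcons v i) u))); last first.
  by move=> u _; rewrite alive_cons prob_offspringI ?fineK//; exact: determined_alive.
rewrite esumZl//; [|exact: countable_words|by rewrite fine_ge0].
by rewrite fineK// -[leRHS]mule1 lee_wpmul2l.
Qed.

(** This is the second moment of [p]: [k ^ 2] counts the pairs [(i, j)] with [maxn i j < k]. *)
Definition second_moment_gt : \bar R :=
  \esum_(i in [set: nat]) \esum_(j in [set: nat]) prob_gt (maxn i j).

(** Pairs of words are split by their first letters. Equal letters reproduce the bound for [n],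
    weighted by probabilities of total mass 1; distinct ones have independent subtrees of mean at
    most 1 and add at most [second_moment_gt]. The growth is therefore linear in [n]. *)
Lemma second_moment n v : second_moment_gt \is a fin_num ->
  \esum_(u in words n) \esum_(u' in words n) Q (alive v u `&` alive v u') <=
  1 + n%:R%:E * second_moment_gt.
Proof.
move=> Vfin; have V0 : 0 <= second_moment_gt by do 2 (apply: esum_ge0 => ? _).
elim: n v => [|n IH] v.
  by rewrite words0 !esum_set1 ?alive_nil ?setIT ?probability_setT ?mul0e ?adde0//.
rewrite esum_words; last by move=> u; exact: esum_ge0.
pose M := 1 + n%:R%:E * second_moment_gt.
have M0 : 0 <= M by rewrite adde_ge0// mule_ge0.
have Mfin : M \is a fin_num by rewrite fin_numD fin_numM.
apply: (@le_trans _ _ (\esum_(i in [set: nat]) \esum_(j in [set: nat])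
    ((if j == i then prob_gt i * M else 0) + prob_gt (maxn i j)))); last first.
  rewrite (@eq_esum _ _ _ _ (fun i => (fine M)%:E * prob_gt i +
      \esum_(j in [set: nat]) prob_gt (maxn i j))); last first.
    move=> i _; rewrite esumD//; last by move=> j _; case: ifPn => // _; rewrite mule_ge0.
    by rewrite esum_delta ?mule_ge0// fineK// muleC.
  rewrite esumD//; last 2 first.
    by move=> i _; rewrite mule_ge0// lee_fin fine_ge0.
    by move=> i _; exact: esum_ge0.
  rewrite esumZl ?countableP ?fine_ge0// critical mule1 fineK// /M -addeA leeD2l//.
  rewrite -[X in _ + X]/second_moment_gt -(fineK Vfin) -!EFinM -EFinD lee_fin.
  by rewrite -natr1 mulrDl mul1r.
apply: le_esum => i _.
rewrite (@eq_esum _ _ _ _ (fun u => \esum_(j in [set: nat]) \esum_(u' in words n)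
    Q (alive v (i :: u) `&` alive v (j :: u')))); last first.
  by move=> u _; rewrite esum_words.
rewrite exchange_esum; last by move=> u j; exact: esum_ge0.
apply: le_esum => j _; have [->|ji] := eqVneq j i.
  apply: (@le_trans _ _ (prob_gt i * M)); last by rewrite leeDl.
  rewrite (@eq_esum _ _ _ _ (fun u => (fine (prob_gt i))%:E * \esum_(u' in words n)
      Q (alive (rcons v i) u `&` alive (rcons v i) u'))); last first.
    move=> u _; rewrite -esumZl ?fine_ge0//; last exact: countable_words.
    apply: eq_esum => u' _; rewrite !alive_cons fineK// -(@prob_offspringI v); last first.
      by apply: determinedI; exact: determined_alive.
    by rewrite setIACA setIid.
  rewrite esumZl ?fine_ge0//; [|exact: countable_words|by move=> u; exact: esum_ge0].
  by rewrite fineK// lee_wpmul2l//; exact: IH.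
rewrite add0e.
rewrite (@eq_esum _ _ _ _ (fun u => (fine (prob_gt (maxn i j)) * fine (Q (alive (rcons v i) u)))%:E *
    \esum_(u' in words n) Q (alive (rcons v j) u'))); last first.
  move=> u _; have Qfin : Q (alive (rcons v i) u) \is a fin_num.
    by apply: fin_num_measure; exact: determined_measurable (@determined_alive _ _).
  rewrite -esumZl; [|exact: countable_words|by rewrite mulr_ge0 ?fine_ge0|by []].
  apply: eq_esum => u' _; rewrite !alive_cons prob_offspringII 1?eq_sym//;
    [|exact: determined_alive|exact: determined_alive].
  by rewrite EFinM !fineK// muleA.
apply: (@le_trans _ _ (\esum_(u in words n) (fine (prob_gt (maxn i j)))%:E * Q (alive (rcons v i) u))).
  apply: le_esum => u _; have Qfin : Q (alive (rcons v i) u) \is a fin_num.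
    by apply: fin_num_measure; exact: determined_measurable (@determined_alive _ _).
  rewrite EFinM !fineK// -[leRHS]mule1; apply: lee_wpmul2l; last exact: first_moment.
  by rewrite mule_ge0.
rewrite esumZl ?fine_ge0//; last exact: countable_words.
by rewrite fineK// -[leRHS]mule1 lee_wpmul2l// first_moment.
Qed.

(* Inclusion-exclusion on the first two children only: it makes the survival
   probability decrease by at least [c q_n ^ 2] at each generation. *)
Lemma survival_bound n v :
  Q (reaches v n) <= ((1 + n%:R * fine (prob_gt 1))^-1)%:E.
Proof.
set c := fine _; have c0 : (0 <= c)%R by rewrite fine_ge0.
have Qle1 A : measurable A -> Q A <= 1 by move=> mA; exact: probability_le1.
have c1 : (c <= 1)%R by rewrite -lee_fin fineK// probability_le1.
have mr u k : measurable (reaches u k) := determined_measurable (@determined_reaches u k).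
elim: n v => [|n IH] v; first by rewrite mul0r addr0 invr1 Qle1.
pose A i := offspring_gt v i `&` reaches (rcons v i) n.
have mo i : measurable (offspring_gt v i) by exact: (mN v [set k | (i < k)%N]).
have mA i : measurable (A i) by exact: measurableI.
pose x i := fine (Q (reaches (rcons v i) n)).
pose B := ((1 + n%:R * c)^-1)%R.
have D0 : (0 < 1 + n%:R * c)%R by rewrite ltr_pwDl// mulr_ge0.
have B0 : (0 <= B)%R by rewrite invr_ge0 ltW.
have B1 : (B <= 1)%R by rewrite invf_le1// lerDl mulr_ge0.
have xE i : Q (reaches (rcons v i) n) = (x i)%:E by rewrite fineK// fin_num_measure.
have x0 i : (0 <= x i)%R by rewrite fine_ge0.
have xB i : (x i <= B)%R by rewrite -lee_fin -xE.
have QA i : Q (A i) = prob_gt i * (x i)%:E.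
  by rewrite prob_offspringI ?xE//; exact: determined_reaches.
have QA01 : Q (A 0%N `&` A 1%N) = (c * (x 0%N * x 1%N))%:E.
  rewrite prob_offspringII//; try exact: determined_reaches.
  by rewrite !xE (_ : maxn 0 1 = 1%N)// -[prob_gt 1]fineK// -!EFinM.
pose a := fine (prob_gt 0).
have ca : (c <= a)%R.
  rewrite -lee_fin /c /a !fineK//; apply: le_measure => [||k /=]; [exact/mem_set|exact/mem_set|exact: ltnW].
have Q0 : Q (A 0%N) = (a * x 0%N)%:E by rewrite QA EFinM (fineK (prob_gt_fin 0)).
have Q1 : Q (A 1%N) = (c * x 1%N)%:E by rewrite QA EFinM (fineK (prob_gt_fin 1)).
have tail : prob_gt 0 + (prob_gt 1 + \sum_(i <oo) prob_gt i.+2) = 1.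
  rewrite -critical -nneseries_esumT// [RHS](nneseries_split 0 2)//.
  rewrite !big_nat_recl// big_geq// adde0 addeA; congr (_ + _ + _).
  by rewrite -[RHS]nneseries_addn//; apply: eq_eseriesr => i _; congr prob_gt; lia.
have tfin : \sum_(i <oo) prob_gt i.+2 \is a fin_num.
  rewrite ge0_fin_numE ?nneseries_ge0//; apply: (@le_lt_trans _ _ 1); last by rewrite ltry.
  by rewrite -tail addeA leeDr// adde_ge0.
pose s := fine (\sum_(i <oo) prob_gt i.+2).
have acs : (a + c + s = 1)%R.
  by apply: EFin_inj; rewrite !EFinD !fineK// -addeA.
apply: (@le_trans _ _ (Q (A 0%N `|` A 1%N) + \sum_(i <oo) Q (A i.+2))).
  rewrite reachesS.
  apply: (@le_trans _ _ (Q ((A 0%N `|` A 1%N) `|` \bigcup_i A i.+2))).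
    apply: le_measure.
    - by apply/mem_set; exact: bigcupT_measurable.
    - by apply/mem_set; apply: measurableU; [exact: measurableU|exact: bigcupT_measurable].
    - by move=> w [[|[|i]] _ Aw]; [left; left|left; right|right; exists i].
  apply: le_trans (measureU2 _ _ _) _ => //.
  - exact: measurableU.
  - exact: bigcupT_measurable.
  - apply: leeD2l; apply: measure_sigma_subadditive => //.
    exact: bigcupT_measurable.
have QU : Q (A 0%N `|` A 1%N) = (a * x 0%N + c * x 1%N - c * (x 0%N * x 1%N))%:E.
  transitivity (Q (A 0%N) + Q (A 1%N) - Q (A 0%N `&` A 1%N)).
    by apply: measureUfinl => //; rewrite ltey_eq fin_num_measure.
  by rewrite Q0 Q1 QA01.
have QT : \sum_(i <oo) Q (A i.+2) <= (B * s)%:E.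
  rewrite EFinM fineK// -nneseriesZl//; apply: lee_nneseries => // i _.
  by rewrite QA muleC lee_wpmul2r// lee_fin.
apply: (@le_trans _ _ ((a * x 0%N + c * x 1%N - c * (x 0%N * x 1%N))%:E + (B * s)%:E)).
  by rewrite QU leeD2l.
rewrite -EFinD lee_fin.
(* The left side is nondecreasing in [x 0] because [c <= a], then in [x 1] because [B <= 1]; both
   may be raised to [B]. *)
have step1 : (a * x 0%N + c * x 1%N - c * (x 0%N * x 1%N) <= a * B + c * B - c * (B * B))%R.
  have h1 : (0 <= (B - x 0%N) * (a - c * x 1%N))%R.
    rewrite mulr_ge0 ?subr_ge0//; apply: le_trans ca.
    by rewrite ler_piMr// (le_trans (xB 1%N)).
  have h2 : (0 <= c * (B - x 1%N) * (1 - B))%R.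
    by rewrite mulr_ge0 ?mulr_ge0 ?subr_ge0.
  move: h1 h2; rewrite !mulrBl !mulrBr !mulr1; lra.
apply: (@le_trans _ _ (B - c * (B * B))%R).
  have h : (B * (a + c + s) = B)%R by rewrite acs mulr1.
  lra.
have E0 : (0 < 1 + n.+1%:R * c)%R by rewrite ltr_pwDl// mulr_ge0.
rewrite -[leRHS]mul1r ler_pdivlMr//.
(* In terms of inverses the recursion is additive: [B - c B ^ 2 <= 1 / (B^-1 + c)], because the
   product of the left side with [B^-1 + c] is [1 - (c B) ^ 2]. *)
have -> : (1 + n.+1%:R * c = B^-1 + c)%R by rewrite /B invrK -natr1 mulrDl mul1r addrA.
have Bn0 : (B != 0)%R by rewrite invr_eq0 lt0r_neq0.
have -> : ((B - c * (B * B)) * (B^-1 + c) = 1 - (c * B) ^+ 2)%R by field.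
by rewrite lerBlDr lerDl sqr_ge0.
Qed.

End galton_watson.

Definition fcard (T : choiceType) (A : set T) : nat := #|` fset_set A|%fset.

Lemma fcard_image (T U : choiceType) (f : T -> U) (A : set T) :
  finite_set A -> set_inj A f -> fcard (f @` A) = fcard A.
Proof.
move=> fA fI; rewrite /fcard fset_set_image//; apply: card_in_imfset => x y.
by rewrite !in_fset_set//; exact: fI.
Qed.

Lemma fcard_sub (T : choiceType) (A B : set T) :
  finite_set B -> A `<=` B -> (fcard A <= fcard B)%N.
Proof.
move=> fB AB; have fA := sub_finite_set AB fB.
apply: fsubset_leq_card; apply/fsubsetP => x.
by rewrite !in_fset_set// => /set_mem/AB ?; apply/mem_set.
Qed.

Lemma esum_indicator (R : realType) (T : choiceType) (A : set T) (B : T -> Prop) :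
  finite_set [set x | A x /\ B x] ->
  (\esum_(x in A) (\1_B x)%:E = (fcard [set x | A x /\ B x])%:R%:E :> \bar R)%E.
Proof.
move=> fAB; rewrite -esum_card// [RHS]esum_mkcond [LHS]esum_mkcond.
apply: eq_esum => x _; rewrite indicE.
have [Ax|nAx] := pselect (A x); have [Bx|nBx] := pselect (B x).
- by rewrite !mem_set.
- by rewrite (mem_set Ax) (memNset nBx) memNset// => -[].
- by rewrite (memNset nAx) memNset// => -[].
- by rewrite (memNset nAx) memNset// => -[].
Qed.

Section ball_counts.
Variables (R : realType) (k : nat) (Xi : mark_space R).

Lemma fcard_ball_iso K (S1 S2 : pointed_space k Xi) (f : S1 -> S2)
    (A1 : set S1) (A2 : set S2) : integral_space S1 ->
  (forall x y, nball K x -> nball K y -> ndist (f x) (f y) = ndist x y) ->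
  (forall y : S2, nball K y -> exists2 x : S1, nball K x & f x = y) ->
  A1 `<=` @nball _ _ _ S1 K -> A2 `<=` @nball _ _ _ S2 K ->
  (forall x, nball K x -> A1 x <-> A2 (f x)) -> fcard A1 = fcard A2.
Proof.
move=> I1 fd fo A1K A2K A12.
have <- : f @` A1 = A2.
  apply/seteqP; split=> [_ [x Ax <-]|y Ay]; first by apply/A12 => //; exact: A1K.
  by have [x xK fx] := fo y (A2K y Ay); exists x => //; apply/A12 => //; rewrite fx.
apply/esym/fcard_image; first exact: sub_finite_set A1K (finite_nball I1 _ _).
move=> x y /set_mem/A1K xK /set_mem/A1K yK xy; apply: (ndist_eq0 I1).
by rewrite -fd// xy ndistxx.
Qed.

End ball_counts.

(** * Generation sizes as random variables *)

Section generations.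
Variable R : realType.
Local Notation X := (no_mark R).
Implicit Types (S : pointed_space 0 X) (j : nat).

Definition sphere_card j S : nat := fcard [set x : S | ndist (origin S) x = j].

Lemma local_sphere_card j q : local_predicate j (fun S => sphere_card j S = q).
Proof.
move=> S1 S2 I1 I2 _ _ [f [fd fo fp]]; suff -> : sphere_card j S1 = sphere_card j S2 by [].
have foo : f (origin S1) = origin S2 := isomorphic_origin fp.
have oK : nball j (origin S1) by rewrite /nball/= ndistxx.
apply: (fcard_ball_iso I1 (fun x y xK yK => (fd x y xK yK).1) fo).
- by move=> x /= xj; rewrite /nball/= xj.
- by move=> x /= xj; rewrite /nball/= xj.
- by move=> x xK /=; rewrite -foo (fd _ _ oK xK).1.
Qed.

(* [0] is a junk value: only integral spaces matter. *)
Definition generation j (c : D_star R) : nat :=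
  if `[< integral_space (representative c) >] then sphere_card j (representative c) else 0.

Lemma generation_class j S : integral_space S -> generation j (class S) = sphere_card j S.
Proof.
move=> IS; have iS := representative_class S.
have IS' := integral_iso iS IS; rewrite /generation asboolT//.
by apply: (@local_sphere_card j (sphere_card j S) S _ IS IS' _ _ _ erefl);
  [exact: within0|exact: within0|exact: isomorphic_ball_iso].
Qed.

Lemma measurable_local_nat K (f : pointed_space 0 X -> nat) :
  (forall q, local_predicate K (fun S => f S = q)) ->
  measurable_fun [set: D_star R] (fun c : D_star R =>
    if `[< integral_space (representative c) >] then f (representative c) else 0%N).
Proof.
move=> lf _ B _; rewrite setTI.
have mq q : measurable [set c : D_star R | integral_space (representative c) /\
    f (representative c) = q].
  exact: measurable_local0 (lf q).
rewrite (_ : _ @^-1` _ = (\bigcup_(q in B) [set c : D_star R |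
    integral_space (representative c) /\ f (representative c) = q]) `|`
    (if `[< B 0%N >] then ~` [set c : D_star R | integral_space (representative c)] else set0)).
  apply: measurableU; first exact: bigcup_measurable.
  by case: ifP => _; [exact: (measurableC (@measurable_integral R 0))|exact: measurable0].
apply/seteqP; split=> c /=.
  case: asboolP => [Ic Bc|nIc B0]; first by left; exists (f (representative c)).
  by right; rewrite asboolT.
case=> [[q Bq [Ic sq]]|]; first by rewrite asboolT// sq.
by case: asboolP => // B0 nIc; rewrite asboolF.
Qed.

Lemma measurable_generation j : measurable_fun [set: D_star R] (generation j).
Proof. exact: measurable_local_nat (@local_sphere_card j). Qed.

End generations.

Section galton_watson_generations.
Local Open Scope ereal_scope.
Variables (R : realType) (d : measure_display) (Omega : measurableType d).
Variables (Q : probability Omega R) (p : probability nat R).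
Variable N : seq nat -> Omega -> nat.
Hypothesis iidN : iid_offspring Q p N.

(** Links classes of trees to Ulam-Harris words: moments of generation sizes become sums of
    probabilities of [alive]. *)
Lemma gw_generation j w : ((generation j (class (gw_tree R (N ^~ w))))%:R%:E : \bar R) =
  \esum_(u in words j) (\1_(alive N [::] u) w)%:E.
Proof.
set M := N ^~ w.
have gw_ndist (x y : gw_space R M) : ndist x y = word_dist (sval x) (sval y).
  by rewrite /ndist natrK.
have IM : integral_space (gw_tree R M) by move=> x y; rewrite gw_ndist.
rewrite generation_class// /sphere_card.
have -> : [set x : gw_tree R M | ndist (origin (gw_tree R M)) x = j] =
    [set x : gw_tree R M | size (sval x) = j].
  by apply/seteqP; split=> x /=; rewrite gw_ndist /word_dist /= !subn0.
have sI : set_inj [set x : gw_tree R M | size (sval x) = j] sval.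
  by move=> [a Aa] [b Ab] _ _ /= ab; exact: eq_exist.
have fin : finite_set [set x : gw_tree R M | size (sval x) = j].
  apply: sub_finite_set (finite_nball IM (origin (gw_tree R M)) j) => x /=.
  by rewrite gw_ndist /word_dist /= !subn0 => ->.
rewrite -(fcard_image fin sI).
have E : sval @` [set x : gw_tree R M | size (sval x) = j] =
    [set u | words j u /\ gw_vertex M u].
  apply/seteqP; split=> [_ [[u Mu] /= uj <-]|u [uj Mu]]; first by split.
  by exists (exist _ u Mu).
rewrite E -esum_indicator; last by rewrite -E; exact: finite_image.
by apply: eq_esum => u _; rewrite !indicE.
Qed.

Let measurable_alive u : measurable (alive N [::] u).
Proof. exact: (determined_measurable iidN (@determined_alive _ _ N [::] u)). Qed.

Let m1 u : measurable_fun [set: Omega] (fun w => (\1_(alive N [::] u) w)%:E : \bar R).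
Proof.
exact: measurable_EFin_indic.
Qed.

Let int1 (A : set Omega) : measurable A -> \int[Q]_w (\1_A w)%:E = Q A.
Proof. by move=> mA; rewrite integral_indic// setIT. Qed.

Lemma measurable_gw_generation j :
  measurable_fun [set: Omega] (fun w => generation j (class (gw_tree R (N ^~ w)))).
Proof.
have mg : measurable_fun [set: Omega]
    (fun w => \esum_(u in words j) (\1_(alive N [::] u) w)%:E : \bar R).
  by apply: measurable_esum => //; exact: countable_words.
move=> _ B _; rewrite setTI.
rewrite (_ : _ @^-1` _ = \bigcup_(q in B) ((fun w => \esum_(u in words j) (\1_(alive N [::] u) w)%:E)
    @^-1` [set (q%:R%:E : \bar R)])).
  apply: bigcup_measurable => q _; rewrite -[X in measurable X]setTI; exact: mg.
apply/seteqP; split=> [w Bw|w [q Bq]] /=.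
  by exists (generation j (class (gw_tree R (N ^~ w)))) => //=; rewrite -gw_generation.
by rewrite /preimage/= -gw_generation => -[/eqP]; rewrite eqr_nat => /eqP ->.
Qed.

Lemma mean_gw_generation1 :
  \int[Q]_w (generation 1 (class (gw_tree R (N ^~ w))))%:R%:E =
  \esum_(i in [set: nat]) prob_gt p i.
Proof.
under eq_integral do rewrite gw_generation.
rewrite integral_esum//; last exact: countable_words.
rewrite esum_words; last by move=> u; apply: integral_ge0 => w _; rewrite lee_fin.
apply: eq_esum => i _; rewrite (_ : words 0 = [set [::]]); last first.
  by apply/seteqP; split=> u; rewrite /words /=; [move/size0nil|move=> ->].
rewrite esum_set1; last by apply: integral_ge0 => w _; rewrite lee_fin.
by rewrite int1// alive_cons alive_nil setIT (prob_offspring iidN).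
Qed.

Lemma square_gw_generation j :
  \int[Q]_w ((generation j (class (gw_tree R (N ^~ w))))%:R ^+ 2)%:E =
  \esum_(u in words j) \esum_(u' in words j) Q (alive N [::] u `&` alive N [::] u').
Proof.
transitivity (\int[Q]_w \esum_(u in words j) \esum_(u' in words j)
    ((\1_(alive N [::] u) w)%:E * (\1_(alive N [::] u') w)%:E : \bar R)).
  apply: eq_integral => w _; set g := generation _ _.
  rewrite (@eq_esum _ _ _ _ (fun u => g%:R%:E * (\1_(alive N [::] u) w)%:E)); last first.
    move=> u _; rewrite esumZl//; last exact: countable_words.
    by rewrite -gw_generation muleC.
  rewrite esumZl//; last exact: countable_words.
  by rewrite -gw_generation -EFinM expr2.
have mm u u' : measurable_fun [set: Omega] (fun w =>
    (\1_(alive N [::] u) w)%:E * (\1_(alive N [::] u') w)%:E : \bar R).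
  exact: emeasurable_funM.
have cw := countable_words j.
rewrite integral_esum//; last 2 first.
- by move=> u; apply: measurable_esum => // u' w; rewrite mule_ge0 ?lee_fin.
- by move=> u w; apply: esum_ge0 => u' _; rewrite mule_ge0 ?lee_fin.
apply: eq_esum => u _; rewrite integral_esum//.
apply: eq_esum => u' _; rewrite -int1; last exact: measurableI.
by apply: eq_integral => w _; rewrite -EFinM indicI.
Qed.

Lemma gw_generation_gt0 j :
  [set w | (0 < generation j (class (gw_tree R (N ^~ w))))%N] = reaches N [::] j.
Proof.
apply/seteqP; split=> w /=.
  move=> g0; apply: contrapT => nr.
  have := gw_generation j w; rewrite esum1 => [[/eqP]|u uj].
    by rewrite pnatr_eq0 => /eqP g; rewrite g in g0.
  by rewrite indicE memNset// => Au; apply: nr; exists u.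
case=> u uj Au; rewrite lt0n; apply/eqP => g0.
have : (\1_(alive N [::] u) w)%:E <= (0%:R%:E : \bar R).
  rewrite -[in leRHS]g0 gw_generation -(@esum_set1 _ _ u (fun u => (\1_(alive N [::] u) w)%:E)) ?lee_fin//.
  rewrite esum_mkcond [leRHS]esum_mkcond; apply: le_esum => u' _.
  rewrite in_set1; case: eqVneq => [->|_]; first by rewrite mem_set.
  by case: ifP; rewrite ?lee_fin.
by rewrite indicE mem_set// lee_fin ler10.
Qed.

Lemma variance_second_moment : 'V_p[fun k : nat => k%:R : R] < +oo ->
  second_moment_gt p \is a fin_num.
Proof.
move=> Vfin.
have mnat (f : nat -> \bar R) : measurable_fun [set: nat] f by [].
have -> : second_moment_gt p = \int[p]_k ((k%:R : R) ^+ 2)%:E.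
  transitivity (\int[p]_k \esum_(i in [set: nat]) \esum_(j in [set: nat])
      ((\1_[set k | (i < k)%N] k)%:E * (\1_[set k | (j < k)%N] k)%:E : \bar R)).
    rewrite integral_esum; last 3 first.
    - exact: countableP.
    - by [].
    - by move=> i k; apply: esum_ge0 => j _; rewrite mule_ge0 ?lee_fin.
    apply: eq_esum => i _; rewrite integral_esum; last 3 first.
    - exact: countableP.
    - by [].
    - by move=> j k; rewrite mule_ge0 ?lee_fin.
    apply: eq_esum => j _.
    rewrite (_ : (fun k => _) = fun k => (\1_[set k | (maxn i j < k)%N] k)%:E); last first.
      apply/funext => k; rewrite -EFinM !indicE -natrM mulnb; congr (_%:R%:E); congr nat_of_bool.
      apply/idP/idP; first by move=> /andP[/set_mem/= ik /set_mem/= jk]; apply/mem_set; rewrite /= gtn_max ik.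
      by move=> /set_mem/=; rewrite gtn_max => /andP[ik jk]; apply/andP; split; apply/mem_set.
    by rewrite integral_indic// setIT.
  apply: eq_integral => k _.
  have cnt : \esum_(i in [set: nat]) (\1_[set k | (i < k)%N] k)%:E = (k%:R%:E : \bar R).
    rewrite (@eq_esum _ _ _ _ (fun i => (\1_(`I_k) i)%:E)); last by move=> i _; rewrite !indicE.
    rewrite esum_indicator; last by apply: sub_finite_set (finite_II k) => i [].
    congr (_%:R%:E); rewrite /fcard; apply: card_fset_set.
    by rewrite (_ : mkset _ = `I_k)//; apply/seteqP; split=> // i [].
  rewrite (@eq_esum _ _ _ _ (fun i => k%:R%:E * (\1_[set k | (i < k)%N] k)%:E)); last first.
    move=> i _; rewrite esumZl//; last exact: countableP.
    by rewrite cnt muleC.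
  rewrite esumZl//; last exact: countableP.
  by rewrite cnt -EFinM expr2.
rewrite ge0_fin_numE; last by apply: integral_ge0 => k _; rewrite lee_fin sqr_ge0.
set m := fine 'E_p[fun k : nat => k%:R : R].
have VE : 'V_p[fun k : nat => k%:R : R] = \int[p]_k (((k%:R : R) - m) ^+ 2)%:E.
  rewrite /variance covariance.unlock /m expectation.unlock.
  by apply: eq_integral => k _; rewrite expr2.
(* From [k ^ 2 <= 2 (k - m) ^ 2 + 2 m ^ 2], valid for any real [m], here the one that centres the
   variance. *)
apply: (@le_lt_trans _ _ (\int[p]_k (2%:E * (((k%:R : R) - m) ^+ 2)%:E + (2 * m ^+ 2)%:E))).
  apply: ge0_le_integralT => k; rewrite lee_fin ?sqr_ge0//.
  rewrite -subr_ge0 (_ : _ - _ = (k%:R - 2 * m) ^+ 2)%R ?sqr_ge0//.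
  by ring.
rewrite ge0_integralD//; last 2 first.
  by move=> k _; rewrite mule_ge0// lee_fin sqr_ge0.
  by move=> k _; rewrite lee_fin mulr_ge0// sqr_ge0.
rewrite ge0_integralZl//; last by move=> k _; rewrite lee_fin sqr_ge0.
rewrite -VE integral_cst// [X in _ + X](_ : _ = (2 * m ^+ 2)%:E); last first.
  by rewrite -[RHS]mule1; congr (_ * _); exact: probability_setT.
rewrite lte_add_pinfty ?ltry// lte_mul_pinfty// lee_fin.
Qed.

End galton_watson_generations.

(** * Mass transport along ancestor lines *)

Lemma fcardU_le (T : choiceType) (A B : set T) : finite_set A -> finite_set B ->
  (fcard (A `|` B) <= fcard A + fcard B)%N.
Proof.
by move=> fA fB; rewrite /fcard fset_setU// cardfsU leq_subr.
Qed.

Lemma fcard_bigcup_le (T : choiceType) (F : nat -> set T) n :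
  (forall i, finite_set (F i)) ->
  (fcard (\bigcup_(i in `I_n) F i) <= \sum_(i < n) fcard (F i))%N.
Proof.
move=> fF; elim: n => [|n IH].
  by rewrite II0 bigcup_set0 /fcard fset_set0 cardfs0.
rewrite big_ord_recr IIS bigcup_setU bigcup_set1.
apply: leq_trans (fcardU_le _ (fF n)) _; first exact: bigcup_finite.
by rewrite leq_add2r.
Qed.

Section end_structures.
Variables (R : realType) (D : discrete_space R) (F : D -> D) (b : D -> int).
Hypothesis FbD : end_structure F b.
Implicit Types x y o u v : D.

Lemma end_integral : integral_space D.
Proof. by case: FbD. Qed.

Lemma end_busemann x y : busemann x y (b x - b y).
Proof. by case: FbD => _ _ _ h _; exact: h. Qed.

Lemma end_has_busemann : has_busemann D.
Proof.
case: (FbD) => ID FD _ _ _; split=> // [x n|x y].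
  by exists (iter n F x); exact: (FD x n).1.
by exists (b x - b y); exact: end_busemann.
Qed.

Lemma end_busemannE x y c : busemann x y c <-> c = b x - b y.
Proof.
split=> [h|->]; last exact: end_busemann.
exact: (busemann_unique end_has_busemann h (end_busemann x y)).
Qed.

(** Rewrites the iterates of [F] in purely metric terms, the form in which the relation is
    measurable on classes. *)
Lemma end_ancestorE r x y : (ndist x y = r /\ busemann x y r%:Z) <-> y = iter r F x.
Proof.
case: (FbD) => _ FD up _ _; rewrite end_busemannE; split=> [[xy rb]|->].
  by rewrite (up x y) xy.
by have [-> ->] := FD x r; split=> //; lia.
Qed.

End end_structures.

Section ancestors.
Variable R : realType.
Local Notation X := (no_mark R).

Lemma sphere_busemann_ball k (S1 S2 : pointed_space k X) (f : S1 -> S2) K m x y c :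
  integral_space S1 -> integral_space S2 ->
  (forall x y, nball K x -> nball K y -> ndist (f x) (f y) = ndist x y) ->
  (forall y : S2, nball K y -> exists2 x : S1, nball K x & f x = y) ->
  f (origin S1) = origin S2 -> (ndist (origin S1) x + m <= K)%N -> nball K y ->
  sphere_busemann m x y c <-> sphere_busemann m (f x) (f y) c.
Proof.
move=> I1 I2 fd fo foo xm yK.
have oK : nball K (origin S1) by rewrite /nball/= ndistxx.
have xK : nball K x by rewrite /nball/=; lia.
split=> -[w [xw wc]].
  have wK : nball K w by have := ndist_tri I1 x (origin S1) w; rewrite /nball/=; lia.
  by exists (f w); rewrite !fd.
have [|w' w'K fw] := fo w.
  have := ndist_tri I2 (f x) (origin S2) w.
  by rewrite /nball/= -foo fd// xw; lia.
by exists w'; rewrite -!fd ?fw.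
Qed.

Definition snd_point (S : pointed_space 1 X) : S := tnth (points S) ord_max.

Definition ancestor_pair (r : nat) (S : pointed_space 1 X) : Prop :=
  ndist (origin S) (snd_point S) = r /\ busemann (origin S) (snd_point S) r%:Z.

Definition ancestor_pairs (r : nat) : set (D_star_star R) :=
  [set c | has_busemann (representative c) /\ ancestor_pair r (representative c)].

Lemma measurable_ancestor_pairs r : measurable (ancestor_pairs r).
Proof.
apply: (@measurable_limit R 1 (fun m => r + m)%N (fun m S =>
  ndist (origin S) (snd_point S) = r /\
  sphere_busemann m (origin S) (snd_point S) r%:Z)).
- move=> m S1 S2 I1 I2 w1 _ [f [fd fo fp]] [ov sb].
  have foo : f (origin S1) = origin S2 := isomorphic_origin fp.
  have fv : f (snd_point S1) = snd_point S2 := isomorphic_tnth _ fp.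
  have oK : nball (r + m) (origin S1) by rewrite /nball/= ndistxx.
  have vK : nball (r + m) (snd_point S1) by exact: w1.
  split; first by rewrite -foo -fv (fd _ _ oK vK).1.
  rewrite -foo -fv.
  apply/(sphere_busemann_ball _ I1 I2 (fun x y xK yK => (fd x y xK yK).1) fo foo _ vK) => //.
  by rewrite ndistxx; lia.
- move=> m S [ov _] i; rewrite /nball/=.
  have [->|->] : i = ord0 \/ i = ord_max.
    by case: i => [[|[|//]] ?]; [left|right]; apply/val_inj.
    by rewrite -/(origin S) ndistxx.
  by rewrite -/(snd_point S) ov leq_addr.
- move=> S gS; have [M MP] := sphere_busemann_eventually gS (origin S) (snd_point S).
  by exists M => m Mm; rewrite /ancestor_pair MP.
Qed.

Lemma ancestor_pairs_class r (D : discrete_space R) (o v : D) :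
  ancestor_pairs r (class (pointed2 o v)) <->
  [/\ has_busemann D, ndist o v = r & busemann o v r%:Z].
Proof.
have [f [[g fK gK] fd fp _]] := representative_class (pointed2 o v).
have gd x y : dist (g x) (g y) = dist x y by rewrite -fd !gK.
have fo := isomorphic_origin fp; have fv := isomorphic_tnth ord_max fp.
split=> [[gS [ov bov]]|[gD ov bov]].
  split; first exact: (has_busemann_isometry fK gd gS).
    by rewrite -(isomorphic_ndist fd) -ov /snd_point -fo -fv.
  have := busemann_isometry fK gd bov.
  by rewrite /snd_point -fo -fv !fK.
split; first exact: (has_busemann_isometry gK fd gD).
split; rewrite /snd_point -fo -fv; first by rewrite (isomorphic_ndist fd).
exact: (busemann_isometry gK fd bov).
Qed.

Definition descendant_set j (D : discrete_space R) (o : D) : set D :=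
  [set u | ndist u o = j /\ busemann u o j%:Z].

Lemma descendant_set_finite j (D : discrete_space R) (o : D) :
  integral_space D -> finite_set (descendant_set j o).
Proof.
by move=> ID; apply: sub_finite_set (finite_nball ID o j) => u [uo _] /=; rewrite ndistC uo.
Qed.

Definition descendant_count j (c : D_star R) : nat :=
  if `[< has_busemann (representative c) >]
  then fcard (descendant_set j (origin (representative c))) else 0%N.

Lemma descendant_count_class j (D : discrete_space R) (o : D) : has_busemann D ->
  descendant_count j (class (pointed1 o)) = fcard (descendant_set j o).
Proof.
move=> gD; rewrite /descendant_count.
have [f [[g fK gK] fd fp _]] := representative_class (pointed1 o).
have gd x y : dist (g x) (g y) = dist x y by rewrite -fd !gK.
have gS := has_busemann_isometry gK fd gD.
rewrite asboolT//; have fo := isomorphic_origin fp.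
have <- : f @` descendant_set j o = descendant_set j (origin (representative (class (pointed1 o)))).
  apply/seteqP; split=> [_ [u [uo bu] <-]|u [uo bu]].
    rewrite /descendant_set /= -fo; split; first by rewrite (isomorphic_ndist fd).
    exact: (busemann_isometry gK fd bu).
  exists (g u) => //; split; first by rewrite -(isomorphic_ndist fd) gK -uo -fo.
  by have := busemann_isometry fK gd bu; rewrite -fo fK.
apply: fcard_image; first by apply: descendant_set_finite; case: gD.
by move=> x y _ _ /(can_inj fK).
Qed.

Lemma measurable_descendant_count j : measurable_fun [set: D_star R] (descendant_count j).
Proof.
move=> _ B _; rewrite setTI.
have mq q : measurable [set c : D_star R | has_busemann (representative c) /\
    fcard (descendant_set j (origin (representative c))) = q].
  apply: (@measurable_limit R 0 (fun m => j + m)%N (fun m S =>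
    fcard [set u : S | ndist u (origin S) = j /\ sphere_busemann m u (origin S) j%:Z] = q)
    (fun S => fcard (descendant_set j (origin S)) = q)).
  - move=> m S1 S2 I1 I2 _ _ [f [fd fo fp]].
    have foo : f (origin S1) = origin S2 := isomorphic_origin fp.
    have oK : nball (j + m) (origin S1) by rewrite /nball/= ndistxx.
    suff -> : fcard [set u : S1 | ndist u (origin S1) = j /\ sphere_busemann m u (origin S1) j%:Z] =
      fcard [set u : S2 | ndist u (origin S2) = j /\ sphere_busemann m u (origin S2) j%:Z] by [].
    have fd' x y : nball (j + m) x -> nball (j + m) y -> ndist (f x) (f y) = ndist x y.
      by move=> xK yK; exact: (fd x y xK yK).1.
    apply: (fcard_ball_iso I1 fd' fo).
    + by move=> u [uo _]; rewrite /nball/= ndistC uo leq_addr.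
    + by move=> u [uo _]; rewrite /nball/= ndistC uo leq_addr.
    + move=> u uK /=; rewrite -foo fd'//; split=> -[uo sb]; split=> //.
        apply/(sphere_busemann_ball _ I1 I2 fd' fo foo) => //.
        by rewrite ndistC uo.
      apply/(sphere_busemann_ball _ I1 I2 fd' fo foo) => //.
      by rewrite ndistC uo.
  - by move=> m S _; exact: within0.
  - move=> S gS; have IS : integral_space S by case: gS.
    have [M MP] := sphere_busemann_uniform gS (finite_nball IS (origin S) j).
    exists M => m Mm; rewrite (_ : mkset _ = descendant_set j (origin S))//.
    apply/seteqP; split=> u /= [uo bu]; split=> //.
      by apply/(MP m Mm) => //=; rewrite ?ndistxx// ndistC uo.
    by apply/(MP m Mm) => //=; rewrite ?ndistxx// ndistC uo.
rewrite (_ : _ @^-1` _ = (\bigcup_(q in B) [set c : D_star R |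
    has_busemann (representative c) /\
    fcard (descendant_set j (origin (representative c))) = q]) `|`
    (if `[< B 0%N >] then ~` [set c : D_star R | has_busemann (representative c)] else set0)).
  apply: measurableU; first exact: bigcup_measurable.
  by case: ifP => _; [exact: (measurableC (@measurable_has_busemann R 0))|exact: measurable0].
apply/seteqP; split=> c; rewrite /descendant_count /=.
  case: asboolP => [Ic Bc|nIc B0]; first by left; exists (fcard (descendant_set j (origin (representative c)))).
  by right; rewrite asboolT.
case=> [[q Bq [Ic sq]]|]; first by rewrite asboolT// sq.
by case: asboolP => // B0 nIc; rewrite asboolF.
Qed.

End ancestors.

Lemma countable_space (R : realType) (D : discrete_space R) : countable [set: D].
Proof.
have [oP|no] := pselect (exists o : D, True); last first.
  by rewrite (_ : setT = set0)//; apply/seteqP; split=> // x _; case: no; exists x.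
case: oP => o _; have -> : [set: D] = \bigcup_n [set y | dist o y <= n%:R].
  apply/seteqP; split=> // y _; exists (Num.truncn (dist o y)).+1 => //=.
  exact/ltW/truncnS_gt.
apply: bigcup_countable; first exact: countableP.
by move=> n _; exact/finite_set_countable/finite_closed_ball.
Qed.

Section mass_transport.
Local Open Scope ereal_scope.
Variables (R : realType) (d : measure_display) (Omega : measurableType d).
Variables (P : probability Omega R) (T : {RV P >-> D_star R}) (p : probability nat R).
Hypothesis unimodT : unimodular T.
Hypothesis treeT : {ae P, forall w, is_tree (representative (T w)) /\
  one_ended (representative (T w))}.
Variable Y : {RV P >-> D_star R}.
Hypothesis YE : {ae P, forall w, Y w =
  class (descendant_tree (origin (representative (T w))))}.
Hypothesis Ygw : is_galton_watson p Y.

Local Notation S w := (representative (T w)).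
Local Notation desc j w := (fcard (descendant_set j (origin (S w)))).

Lemma ae_end_structure :
  {ae P, forall w, exists (F : S w -> S w) (b : S w -> int), end_structure F b}.
Proof. by apply: filterS treeT => w [tw ow]; exact: one_ended_tree_structure. Qed.

Lemma ae_generation : {ae P, forall w, forall j, generation j (Y w) = desc j w}.
Proof.
apply: filterS2 ae_end_structure YE => w [F [b FbD]] -> j.
set D := S w; set o := origin D.
have ID : integral_space D := end_integral FbD.
have nE (x y : subspace (descendants o)) : ndist x y = ndist (sval x) (sval y) by [].
have IS : integral_space (descendant_tree o) by move=> x y; exact: ID.
rewrite generation_class// /sphere_card.
have sI : set_inj [set x : descendant_tree o | ndist (origin (descendant_tree o)) x = j] sval.
  by move=> [a Aa] [c Ac] _ _ /= ac; exact: eq_exist.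
rewrite -(fcard_image _ sI); last first.
  by apply: sub_finite_set (finite_nball IS (origin (descendant_tree o)) j) => x /= ->.
congr fcard; case: (FbD) => _ _ _ _ [_ dE].
apply/seteqP; split=> [_ [[x ox] /= xj <-]|u [uo bu]].
  have oxj : ndist o x = j by exact: xj.
  split; first by rewrite ndistC.
  by apply/(end_busemannE FbD); rewrite -oxj ndistC; exact/dE.
have ou : descendants o u by apply/dE; rewrite uo; exact/(end_busemannE FbD).
by exists (exist _ u ou) => //=; rewrite nE /= ndistC.
Qed.

(** Mass transport: each point sends a unit mass to its [r]-th ancestor, so it sends 1 and receives
    the number of its descendants [r] generations below. *)
Lemma mean_descendants r : \int[P]_w (desc r w)%:R%:E = 1.
Proof.
have g0 (c : D_star_star R) : (0 <= (\1_(@ancestor_pairs R r) c : R))%R by rewrite indicE.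
have mg : measurable_fun [set: D_star_star R] (\1_(@ancestor_pairs R r) : D_star_star R -> R).
  by apply: measurable_indic; exact: measurable_ancestor_pairs.
transitivity (\int[P]_w (cst 1 w : \bar R)); last first.
  rewrite integral_cst; last exact: measurableT.
  rewrite mul1e.
  exact: probability_setT.
transitivity (\int[P]_w (\esum_(v in [set: S w])
    (\1_(ancestor_pairs r) (class (pointed2 v (origin (S w)))) : R)%:E)).
  apply: ge0_ae_eq_integralT.
  - by move=> w; rewrite lee_fin.
  - by move=> w; apply: esum_ge0 => v _; rewrite lee_fin.
  apply: filterS ae_end_structure => w [F [b FbD]].
  have fin := descendant_set_finite r (origin (S w)) (end_integral FbD).
  rewrite (@eq_esum _ _ _ _ (fun v => (\1_(descendant_set r (origin (S w))) v)%:E)).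
    rewrite esum_indicator; last by apply: sub_finite_set fin => v [].
    by congr (_%:R%:E); congr fcard; apply/seteqP; split=> [//|v []].
  move=> v _; rewrite !indicE; congr (_%:R%:E); congr nat_of_bool.
  apply/idP/idP => /set_mem h; apply/mem_set.
    by move/ancestor_pairs_class : h => [].
  apply/ancestor_pairs_class; split; [exact: end_has_busemann FbD|exact: h.1|exact: h.2].
transitivity (\int[P]_w (\esum_(v in [set: S w])
    (\1_(ancestor_pairs r) (class (pointed2 (origin (S w)) v)) : R)%:E)).
  exact/esym/(unimodT mg g0).
apply: ge0_ae_eq_integralT.
- by move=> w; apply: esum_ge0 => v _; rewrite lee_fin.
- by move=> w; rewrite lee_fin.
apply: filterS ae_end_structure => w [F [b FbD]].
rewrite (@eq_esum _ _ _ _ (fun v => if v == iter r F (origin (S w)) then 1 else 0)).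
  by rewrite esum_delta.
move=> v _; rewrite indicE; case: eqVneq => [vE|vn].
  rewrite mem_set//; apply/ancestor_pairs_class.
  have [ov bov] := (end_ancestorE FbD r (origin (S w)) v).2 vE.
  by split=> //; exact: end_has_busemann FbD.
rewrite memNset// => /ancestor_pairs_class[_ ov bov].
by move/eqP: vn; apply; exact: (end_ancestorE FbD r (origin (S w)) v).1.
Qed.

(** Only the law of [Y] is known to be that of a Galton-Watson tree; generation sizes, measurable on
    both sides, are compared through their image measures on [nat]. *)
Lemma generation_law (d' : measure_display) (Omega' : measurableType d')
    (Q : probability Omega' R) (N : seq nat -> Omega' -> nat) j (phi : nat -> \bar R) :
  iid_offspring Q p N ->
  (forall A : set (D_star R), measurable A ->
     P (Y @^-1` A) = Q [set w | A (class (gw_tree R (N ^~ w)))]) ->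
  (forall k, 0 <= phi k) ->
  \int[P]_w phi (generation j (Y w)) =
  \int[Q]_w phi (generation j (class (gw_tree R (N ^~ w)))).
Proof.
move=> iidN law phi0.
have mg := @measurable_generation R j.
have mY : measurable_fun [set: Omega] (fun w => generation j (Y w)).
  exact: measurableT_comp.
have mN := measurable_gw_generation iidN j.
have e1 := @ge0_integral_pushforward _ _ _ nat _ _ mY P setT phi measurableT.
have e2 := @ge0_integral_pushforward _ _ _ nat _ _ mN Q setT phi measurableT.
rewrite -[LHS]e1// -[RHS]e2//.
apply: eq_measure_integral => A _ _; apply: (law (generation j @^-1` A)).
by rewrite -[X in measurable X]setTI; exact: mg.
Qed.

(** The mean offspring number of the root is computed in two ways: by mass transport it is 1, by the
    Galton-Watson law it is the sum of the tail probabilities. *)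
Lemma offspring_critical : \esum_(i in [set: nat]) prob_gt p i = 1.
Proof.
have [d' [E' [Q [N [iidN law]]]]] := Ygw.
rewrite -(mean_gw_generation1 iidN).
rewrite -(generation_law 1 (phi := fun k => k%:R%:E) iidN law); last by move=> k; rewrite lee_fin.
rewrite -(mean_descendants 1); apply: ge0_ae_eq_integralT.
- by move=> w; rewrite lee_fin.
- by move=> w; rewrite lee_fin.
by apply: filterS ae_generation => w ->.
Qed.

Lemma prob_tall n :
  \int[P]_w (\1_[set x | tall n x] (origin (S w)) : R)%:E <=
  ((1 + n%:R * fine (prob_gt p 1))^-1)%:E.
Proof.
have [d' [E' [Q [N [iidN law]]]]] := Ygw.
pose phi k : \bar R := (0 < k)%N%:R%:E.
have phi0 k : 0 <= phi k by rewrite lee_fin.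
apply: le_trans (survival_bound iidN offspring_critical n [::]).
have mr : measurable (reaches N [::] n).
  exact: (determined_measurable iidN (@determined_reaches _ _ N [::] n)).
have -> : Q (reaches N [::] n) = \int[P]_w phi (generation n (Y w)).
  rewrite (generation_law n iidN law)//.
  rewrite -[in LHS](setIT (reaches N [::] n)) -integral_indic//.
  apply: eq_integral => w _; rewrite -(gw_generation_gt0 R) indicE /phi; congr (_%:R%:E).
  by congr nat_of_bool; apply/idP/idP => [/set_mem|h]//; exact/mem_set.
apply: ge0_ae_le_integralT; [by move=> w; rewrite lee_fin|by move=> w; exact: phi0|].
apply: filterS2 ae_end_structure ae_generation => w [F [b FbD]] /(_ n) ->.
rewrite indicE lee_fin ler_nat.
have [[u un bu]|nt] := pselect (tall n (origin (S w))); last by rewrite memNset.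
rewrite mem_set; last by exists u.
rewrite /= lt0b; apply/fset_card_gt0; last by exists u.
exact: descendant_set_finite (end_integral FbD).
Qed.

Definition ball_card (r : nat) (D : pointed_space 0 (no_mark R)) : nat :=
  fcard [set x : D | (ndist (origin D) x <= r)%N].

Let square (k : nat) : \bar R := ((k%:R : R) ^+ 2)%:E.

Let measurable_square j :
  measurable_fun [set: Omega] (fun w => square (generation j (Y w))).
Proof.
have mg := @measurable_generation R j.
have mY : measurable_fun [set: Omega] (fun w => generation j (Y w)).
  exact: measurableT_comp.
exact: (@measurableT_comp _ _ _ _ _ _ square).
Qed.

Hypothesis Vfin : second_moment_gt p \is a fin_num.
Let V := fine (second_moment_gt p).

Lemma mean_square_generation j :
  \int[P]_w square (generation j (Y w)) <= (1 + j%:R * V)%:E.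
Proof.
have [d' [E' [Q [N [iidN law]]]]] := Ygw.
rewrite (generation_law j (phi := square) iidN law); last first.
  by move=> k; rewrite lee_fin sqr_ge0.
rewrite (square_gw_generation iidN j) EFinD EFinM fineK//.
exact: second_moment iidN offspring_critical _ _ Vfin.
Qed.

End mass_transport.

Lemma esum_finite_if (R : realType) (T : choiceType) (A : set T) (C : R) :
  finite_set A -> 0 <= C ->
  (\esum_(x in [set: T]) (\1_A x * C)%:E = ((fcard A)%:R * C)%:E :> \bar R)%E.
Proof.
move=> fA C0; rewrite (@eq_esum _ _ _ _ (fun x => if x \in A then C%:E else 0%E)).
  rewrite -esum_mkcond esum_fset//.
  by rewrite fsbig_finite//= sumEFin big_const_seq count_predT iter_addr_0 mulr_natl.
by move=> x _; rewrite indicE; case: ifP; rewrite ?mul1r ?mul0r.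
Qed.

(** * Mean volume of balls *)

Section mean_ball.
Local Open Scope ereal_scope.
Variables (R : realType) (d : measure_display) (Omega : measurableType d).
Variables (P : probability Omega R) (T : {RV P >-> D_star R}) (p : probability nat R).
Hypothesis unimodT : unimodular T.
Hypothesis treeT : {ae P, forall w, is_tree (representative (T w)) /\
  one_ended (representative (T w))}.
Variable Y : {RV P >-> D_star R}.
Hypothesis YE : {ae P, forall w, Y w =
  class (descendant_tree (origin (representative (T w))))}.
Hypothesis Ygw : is_galton_watson p Y.
Hypothesis Vfin : second_moment_gt p \is a fin_num.

Local Notation S w := (representative (T w)).
Local Notation V := (fine (second_moment_gt p)).

Let descendants_upto r (c : D_star R) : R := (\sum_(j < (2 * r).+1) descendant_count j c)%:R.

Let g r (c : D_star_star R) : R :=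
  (\1_(@ancestor_pairs R r) c * descendants_upto r (recenter ord_max c))%R.

Let g_ge0 r c : (0 <= g r c)%R.
Proof. by rewrite mulr_ge0// indicE. Qed.

Let measurable_g r : measurable_fun [set: D_star_star R] (g r).
Proof.
apply: measurable_funM; first by apply: measurable_indic; exact: measurable_ancestor_pairs.
apply: (@measurableT_comp _ _ _ _ _ _ (descendants_upto r)); last exact: measurable_recenter.
rewrite (_ : descendants_upto r = fun c => (\sum_(j < (2 * r).+1) (descendant_count j c)%:R)%R).
  apply: measurable_sum => j.
  apply: (@measurableT_comp _ _ _ _ _ _ (fun k : nat => k%:R : R)) => //.
  exact: measurable_descendant_count.
by apply/funext => c; rewrite /descendants_upto natr_sum.
Qed.

Lemma recenter_pair (D : discrete_space R) (o v : D) :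
  recenter ord_max (class (pointed2 o v)) = class (pointed1 v).
Proof. by rewrite recenter_class. Qed.

Let g_pair r (D : discrete_space R) (F : D -> D) (b : D -> int) (o v : D) :
  end_structure F b -> g r (class (pointed2 o v)) =
  (\1_(descendant_set r v) o * (\sum_(j < (2 * r).+1) fcard (descendant_set j v))%:R)%R.
Proof.
move=> FbD; have gD := end_has_busemann FbD.
rewrite /g recenter_pair /descendants_upto.
congr (_ * _)%R; last by congr (_%:R); apply: eq_bigr => j _; rewrite descendant_count_class.
rewrite !indicE; congr (_%:R); congr nat_of_bool.
apply/idP/idP => /set_mem h; apply/mem_set; first by move/ancestor_pairs_class : h => [].
by apply/ancestor_pairs_class; split; [exact: gD|exact: h.1|exact: h.2].
Qed.

(** A point within [r] of [o] lies below the [r]-th ancestor of [o], and by the triangle inequality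
    at most [2 r] generations below it. *)
Let ball_le r (D : discrete_space R) (F : D -> D) (b : D -> int) (o : D) :
  end_structure F b ->
  (fcard [set x : D | (ndist o x <= r)%N] <=
   \sum_(j < (2 * r).+1) fcard (descendant_set j (iter r F o)))%N.
Proof.
move=> FbD; have ID := end_integral FbD; set a := iter r F o.
have fin j : finite_set (descendant_set j a) := descendant_set_finite j a ID.
apply: leq_trans (fcard_bigcup_le _ fin); apply: fcard_sub.
  by apply: bigcup_finite => //; exact: finite_II.
case: (FbD) => _ FD _ _ [near _] u /= our.
have oa : ndist o a = r := (FD o r).1.
exists (ndist u a); last by split=> //; apply/(end_busemannE FbD); exact: near.
by rewrite /= ltnS; have := ndist_tri ID o u a; rewrite (ndistC u o) oa; lia.
Qed.

Let square (k : nat) : \bar R := ((k%:R : R) ^+ 2)%:E.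

Let measurable_square j :
  measurable_fun [set: Omega] (fun w => square (generation j (Y w))).
Proof.
have mg := @measurable_generation R j.
have mY : measurable_fun [set: Omega] (fun w => generation j (Y w)).
  exact: measurableT_comp.
exact: (@measurableT_comp _ _ _ _ _ _ square).
Qed.

(** The root sends to its [r]-th ancestor the number of points at most [2 r] generations below that
    ancestor, a bound for its ball. After transport the root is the ancestor, and it receives the
    size of generation [r] times the size of the first [2 r] generations. *)
Lemma mean_ball r : \int[P]_w (ball_card r (S w))%:R%:E <=
  ((2 * r).+1%:R * (1 + (2 * r)%:R * V))%:E.
Proof.
have V0 : (0 <= V)%R.
  by rewrite fine_ge0//; apply: esum_ge0 => i _; apply: esum_ge0 => j _; exact: measure_ge0.
apply: (@le_trans _ _ (\int[P]_w (\esum_(v in [set: S w])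
    (g r (class (pointed2 (origin (S w)) v)))%:E))).
  apply: ge0_ae_le_integralT.
  - by move=> w; rewrite lee_fin.
  - by move=> w; apply: esum_ge0 => v _; rewrite lee_fin.
  apply: filterS (ae_end_structure treeT) => w [F [b FbD]].
  set o := origin (S w); set a := iter r F o.
  apply: (@le_trans _ _ (\sum_(j < (2 * r).+1) fcard (descendant_set j a))%N%:R%:E).
    by rewrite lee_fin ler_nat; exact: ball_le FbD.
  have oa : descendant_set r a o by exact: (end_ancestorE FbD r o a).2.
  rewrite -(@esum_delta _ _ a (_%:R%:E)); last by rewrite lee_fin.
  apply: le_esum => v _; case: eqVneq => [->|_]; last by rewrite lee_fin.
  by rewrite (g_pair r o a FbD) indicE mem_set// mul1r.
have -> : \int[P]_w (\esum_(v in [set: S w]) (g r (class (pointed2 (origin (S w)) v)))%:E) =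
    \int[P]_w (\esum_(v in [set: S w]) (g r (class (pointed2 v (origin (S w)))))%:E).
  exact: (unimodT (@measurable_g r) (@g_ge0 r)).
(* Each product of generation sizes is at most half the sum of the squares, which leaves second
   moments of single generations. *)
apply: (@le_trans _ _ (\int[P]_w (\sum_(j < (2 * r).+1) 
    (2^-1%:E * (square (generation r (Y w)) + square (generation j (Y w))))))).
  apply: ge0_ae_le_integralT.
  - by move=> w; apply: esum_ge0 => v _; rewrite lee_fin.
  - move=> w; apply: sume_ge0 => j _; by apply: mule_ge0; rewrite ?lee_fin ?invr_ge0 ?addr_ge0 ?sqr_ge0//.
  apply: filterS2 (ae_end_structure treeT) (ae_generation treeT YE) => w [F [b FbD]] gE.
  set o := origin (S w).
  have fin := descendant_set_finite r o (end_integral FbD).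
  rewrite (@eq_esum _ _ _ _ (fun v => (\1_(descendant_set r o) v *
      (\sum_(j < (2 * r).+1) fcard (descendant_set j o))%:R)%:E)); last first.
    by move=> v _; rewrite (g_pair r v o FbD).
  rewrite esum_finite_if// -(gE r).
  rewrite (eq_bigr (fun j : 'I_(2 * r).+1 => generation j (Y w))); last by move=> j _; rewrite gE.
  rewrite natr_sum mulr_sumr -sumEFin; apply: lee_sum => j _.
  rewrite /square -EFinD -EFinM lee_fin.
  set x := _%:R; set y := _%:R.
  by have := sqr_ge0 (x - y)%R; rewrite sqrrB; lra.
rewrite ge0_integral_sum//; last 2 first.
- move=> j; apply: emeasurable_funM => //; exact: emeasurable_funD.
- by move=> j w _; apply: mule_ge0; rewrite ?lee_fin ?invr_ge0 ?addr_ge0 ?sqr_ge0//.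
apply: (@le_trans _ _ (\sum_(j < (2 * r).+1) (1 + (2 * r)%:R * V)%:E)); last first.
  by rewrite sumEFin sumr_const card_ord -[X in X%:E <= _]mulr_natl.
apply: lee_sum => j _.
rewrite ge0_integralZl//; last 2 first.
- exact: emeasurable_funD.
- by move=> w _; rewrite lee_fin addr_ge0 ?sqr_ge0.
rewrite ge0_integralD//; last 2 first.
- by move=> w _; rewrite lee_fin sqr_ge0.
- by move=> w _; rewrite lee_fin sqr_ge0.
have hr := mean_square_generation unimodT treeT YE Ygw Vfin r.
have hj := mean_square_generation unimodT treeT YE Ygw Vfin j.
apply: (@le_trans _ _ (2^-1%:E * ((1 + r%:R * V)%:E + (1 + j%:R * V)%:E))).
  by rewrite lee_wpmul2l ?lee_fin ?invr_ge0// leeD.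
rewrite -EFinD -EFinM lee_fin.
have h1 : (r%:R * V <= (2 * r)%:R * V)%R by rewrite ler_wpM2r// ler_nat; lia.
have h2 : (j%:R * V <= (2 * r)%:R * V)%R by rewrite ler_wpM2r// ler_nat -ltnS.
lra.
Qed.

End mean_ball.

(** * Light points and lower bounds *)

Lemma measurable_fun_nat_family (d1 d2 : measure_display) (T1 : measurableType d1)
    (T2 : measurableType d2) (n : T1 -> nat) (f : nat -> T1 -> T2) :
  measurable_fun setT n -> (forall k, measurable_fun setT (f k)) ->
  measurable_fun setT (fun x => f (n x) x).
Proof.
move=> mn mf _ B mB; rewrite setTI.
rewrite (_ : _ @^-1` _ = \bigcup_k (n @^-1` [set k] `&` (f k @^-1` B))); last first.
  by apply/seteqP; split=> [x Bx|x [k _ [/= <- ]]] //; exists (n x).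
apply: bigcupT_measurable => k; apply: measurableI.
  by rewrite -[X in measurable X]setTI; exact: mn.
by rewrite -[X in measurable X]setTI; exact: mf.
Qed.

Section ball_numbers.
Variable R : realType.
Local Notation X := (no_mark R).
Implicit Types (S : pointed_space 0 X).

Lemma local_ball_card r q : local_predicate r (fun S => ball_card r S = q).
Proof.
move=> S1 S2 I1 I2 _ _ [f [fd fo fp]].
suff -> : ball_card r S1 = ball_card r S2 by [].
have foo : f (origin S1) = origin S2 := isomorphic_origin fp.
have oK : nball r (origin S1) by rewrite /nball/= ndistxx.
apply: (fcard_ball_iso I1 (fun x y xK yK => (fd x y xK yK).1) fo) => //.
by move=> x xK /=; rewrite -foo (fd _ _ oK xK).1.
Qed.

Definition ball_number r (c : D_star R) : nat :=
  if `[< integral_space (representative c) >] then ball_card r (representative c) else 0%N.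

Lemma ball_number_class r S : integral_space S -> ball_number r (class S) = ball_card r S.
Proof.
move=> IS; have iS := representative_class S.
have IS' := integral_iso iS IS; rewrite /ball_number asboolT//.
apply: (@local_ball_card r (ball_card r S) S _ IS IS' _ _ _ erefl);
  [exact: within0|exact: within0|exact: isomorphic_ball_iso].
Qed.

Lemma measurable_ball_number r : measurable_fun [set: D_star R] (ball_number r).
Proof. exact: measurable_local_nat (@local_ball_card r). Qed.

Lemma class_pointed1 S : class (pointed1 (origin S)) = class S.
Proof.
apply: class_eq; exists id; split=> //; first by exists id.
  by rewrite map_id; case: S => D [[|x [|//]] //= it] m.
by move=> x y /=; case: (mark _ _).
Qed.

Definition pair_distance (c : D_star_star R) : nat :=
  if `[< integral_space (representative c) >]
  then ndist (origin (representative c)) (snd_point (representative c)) else 0%N.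

Lemma pair_distance_class (D : discrete_space R) (o v : D) :
  integral_space D -> pair_distance (class (pointed2 o v)) = ndist o v.
Proof.
move=> ID; have iS := representative_class (pointed2 o v).
have IS := integral_iso iS ID; rewrite /pair_distance asboolT//.
have [f [fb fd fp _]] := iS.
by rewrite /snd_point -(isomorphic_origin fp) -(isomorphic_tnth ord_max fp) (isomorphic_ndist fd).
Qed.

Lemma measurable_pair_distance : measurable_fun [set: D_star_star R] pair_distance.
Proof.
move=> _ B _; rewrite setTI.
have mq q : measurable [set c : D_star_star R | [/\ integral_space (representative c),
    within q (representative c) &
    ndist (origin (representative c)) (snd_point (representative c)) = q]].
  apply: (@measurable_local R 1 q (fun S : pointed_space 1 X =>
    ndist (origin S) (snd_point S) = q)).
  move=> S1 S2 I1 I2 w1 w2 [f [fd fo fp]] <-.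
  rewrite -(isomorphic_origin fp) /snd_point -(isomorphic_tnth ord_max fp).
  by apply: (fd _ _ _ _).1; [exact: (w1 ord0)|exact: (w1 ord_max)].
rewrite (_ : _ @^-1` _ = (\bigcup_(q in B) [set c : D_star_star R |
    [/\ integral_space (representative c), within q (representative c) &
    ndist (origin (representative c)) (snd_point (representative c)) = q]]) `|`
    (if `[< B 0%N >] then ~` [set c : D_star_star R | integral_space (representative c)] else set0)).
  apply: measurableU; first exact: bigcup_measurable.
  by case: ifP => _; [exact: (measurableC (@measurable_integral R 1))|exact: measurable0].
apply/seteqP; split=> c; rewrite /pair_distance /=.
  case: asboolP => [Ic Bc|nIc B0]; last by right; rewrite asboolT.
  left; exists (ndist (origin (representative c)) (snd_point (representative c))) => //.
  split=> // i; have [->|->] : i = ord0 \/ i = ord_max.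
    by case: i => [[|[|//]] ?]; [left|right]; apply/val_inj.
    by rewrite /nball/= -/(origin _) ndistxx.
  by rewrite /nball/= -/(snd_point _).
case=> [[q Bq [Ic _ sq]]|]; first by rewrite asboolT// sq.
by case: asboolP => // B0 nIc; rewrite asboolF.
Qed.

End ball_numbers.

Section light_points.
Variables (R : realType) (C : R) (B : nat) (alpha : R).
Hypotheses (C0 : 0 < C) (B2 : (1 < B)%N) (Balpha : 2 <= B%:R `^ (alpha - 2)).
Hypothesis alpha2 : 2 < alpha.

(** With mean volume at most [C (B ^ j) ^ 2], Markov's inequality gives probability at most
    [2 ^ -(j + 2)] to exceed this value; the sum over [j] is 1/2. *)
Definition threshold (j : nat) : R := 4 * C * (B ^ j)%:R ^+ 2 * 2 ^+ j.

Definition light : set (D_star R) :=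
  [set c | forall j, (ball_number (B ^ j) c)%:R <= threshold j].

Lemma threshold_gt0 j : 0 < threshold j.
Proof.
have Bj0 : 0 < (B ^ j)%:R :> R by rewrite ltr0n expn_gt0 (ltnW B2).
by rewrite /threshold; do ?[apply: mulr_gt0]; rewrite ?exprn_gt0.
Qed.

Lemma measurable_light : measurable light.
Proof.
rewrite (_ : light = \bigcap_j (ball_number (B ^ j) @^-1` [set q | q%:R <= threshold j])).
  apply: bigcapT_measurable => j; rewrite -[X in measurable X]setTI.
  exact: measurable_ball_number.
by apply/seteqP; split=> [c lc j _|c lc j]; [exact: lc|exact: (lc j I)].
Qed.

(** [B] is chosen so large that the factor [2 ^ j] is absorbed by [(B ^ j) ^ (alpha - 2)]. *)
Lemma threshold_le j : threshold j <= 4 * C * (B ^ j)%:R `^ alpha.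
Proof.
have Bj0 : 0 < (B ^ j)%:R :> R by rewrite ltr0n expn_gt0 (ltnW B2).
have -> : alpha = 2%:R + (alpha - 2) by lra.
rewrite powRD; last by rewrite (gt_eqF Bj0) implybT.
rewrite powR_mulrn ?(ltW Bj0)// /threshold -!mulrA ler_pM2l// ler_pM2l//.
rewrite ler_pM2l ?exprn_gt0//.
have -> : (B ^ j)%:R `^ (alpha - 2) = (B%:R `^ (alpha - 2)) ^+ j.
  by rewrite natrX -powR_mulrn// -powRrM mulrC powRrM powR_mulrn ?powR_ge0.
by rewrite ler_pM2l//; apply: lerXn2r => //; rewrite nnegrE ?powR_ge0.
Qed.

(** The ball itself may be crowded around a heavy centre. But if it contains a light point [u], then
    all its light points are within [2 r] of [u], and the volume around [u] is controlled. *)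
Lemma light_ball (D : discrete_space R) (o : D) (r : R) : integral_space D -> 1 <= r ->
  (fcard [set v : D | dist v o <= r /\ light (class (pointed1 v))])%:R <=
  4 * C * (2 * B%:R) `^ alpha * r `^ alpha.
Proof.
move=> ID r1; set A := mkset _.
have r0 : 0 < r by lra.
have B0 : 0 < B%:R :> R by rewrite ltr0n (ltnW B2).
have rhs0 : 0 <= 4 * C * (2 * B%:R) `^ alpha * r `^ alpha.
  by rewrite !mulr_ge0 ?powR_ge0// ltW.
have [[u [ur lu]]|nA] := pselect (exists u, A u); last first.
  rewrite (_ : A = set0); last by apply/seteqP; split=> // v Av; case: nA; exists v.
  by rewrite /fcard fset_set0 cardfs0.
have exj : exists j, 2 * r <= (B ^ j)%:R.
  exists (Num.truncn (2 * r)).+1; apply: le_trans (ltW (truncnS_gt _)) _.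
  by rewrite ler_nat ltnW// ltn_expl.
have [j jP jmin] := ex_minnP exj.
(* By minimality of [j] the scale overshoots [2 r] by a factor at most [B]; for [j = 0] the claim
   follows from [r >= 1]. *)
have Bj : (B ^ j)%:R <= 2 * r * B%:R.
  case: j jP jmin => [|j] jP jmin.
    rewrite expn0; have : 1 <= B%:R :> R by rewrite ler1n (ltnW B2).
    by nra.
  rewrite expnS natrM mulrC ler_pM2r// leNgt; apply/negP => /ltW/jmin.
  by rewrite ltnn.
have := lu j; rewrite ball_number_class// => ball_u.
apply: (@le_trans _ _ (ball_card (B ^ j) (pointed1 u))%:R).
  rewrite ler_nat; apply: fcard_sub; first exact: finite_nball.
  move=> v [vr _]; suff h : dist u v <= (B ^ j)%:R by move: h; rewrite ID ler_nat.
  have h1 := dist_tri o u v; have h2 := distC o v; apply: le_trans jP; lra.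
apply: (le_trans ball_u); apply: (le_trans (threshold_le j)).
rewrite -[leRHS]mulrA -powRM ?mulr_ge0 ?(ltW r0) ?(ltW B0)//.
rewrite ler_pM2l ?mulr_gt0//; apply: ge0_ler_powR.
- by apply: ltW; apply: lt_trans alpha2.
- by rewrite nnegrE.
- by rewrite nnegrE !mulr_ge0// ltW.
- by apply: le_trans Bj _; rewrite mulrAC.
Qed.

End light_points.

Section light_mass.
Local Open Scope ereal_scope.
Variables (R : realType) (d : measure_display) (Omega : measurableType d).
Variables (P : probability Omega R) (T : {RV P >-> D_star R}).
Hypothesis unimodT : unimodular T.
Hypothesis intT : {ae P, forall w, integral_space (representative (T w))}.
Variables (C : R) (B : nat).
Hypotheses (C0 : (0 < C)%R) (B2 : (1 < B)%N).
Hypothesis mean_ballT : forall r : nat, (0 < r)%N ->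
  \int[P]_w (ball_number r (T w))%:R%:E <= (C * r%:R ^+ 2)%:E.

Local Notation S w := (representative (T w)).
Local Notation lightS := (light C B).

Lemma prob_light : (2^-1)%:E <= P (T @^-1` lightS).
Proof.
have mL : measurable (T @^-1` lightS).
  by rewrite -[X in measurable X]setTI; apply: measurable_funPT => //; exact: measurable_light.
have t0 j : (0 < threshold C B j)%R := threshold_gt0 C0 B2 j.
suff bad : P (~` (T @^-1` lightS)) <= (2^-1)%:E.
  have Pfin : P (T @^-1` lightS) \is a fin_num by exact: fin_num_measure.
  have : 1 - P (T @^-1` lightS) <= (2^-1)%:E by apply: le_trans bad; rewrite probability_setC.
  by rewrite -(fineK Pfin) -EFinB !lee_fin; lra.
have mb j : measurable_fun [set: Omega] (fun w => (ball_number (B ^ j) (T w))%:R%:E : \bar R).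
  apply: (@measurableT_comp _ _ _ _ _ _ (fun k : nat => k%:R%:E : \bar R)) => //.
  by apply: measurableT_comp => //; exact: measurable_ball_number.
rewrite -[X in P X]setIT -integral_indic//; last exact: measurableC.
(* Markov's inequality and the union bound at once: at a point that is not light some term exceeds
   1. *)
apply: (@le_trans _ _ (\int[P]_w \esum_(j in [set: nat])
    ((threshold C B j)^-1%:E * (ball_number (B ^ j) (T w))%:R%:E))).
  apply: ge0_le_integralT => w; first by rewrite lee_fin.
  have [Lw|nLw] := pselect (lightS (T w)).
    rewrite indicE memNset//=.
    by apply: esum_ge0 => j _; rewrite mule_ge0// lee_fin invr_ge0 ltW.
  have [j tj] : exists j, (threshold C B j < (ball_number (B ^ j) (T w))%:R)%R.
    apply: contrapT => nj; apply: nLw => j; rewrite leNgt; apply/negP => h.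
    by apply: nj; exists j.
  apply: (@le_trans _ _ 1); first by rewrite indicE lee_fin; case: (_ \in _).
  rewrite -(@esum_delta _ _ j 1)//; apply: le_esum => i _; case: eqVneq => [->|_].
    by rewrite -EFinM lee_fin mulrC ler_pdivlMr// mul1r ltW.
  by rewrite mule_ge0// lee_fin invr_ge0 ltW.
rewrite integral_esum; last 3 first.
- exact: countableP.
- by move=> j; apply: emeasurable_funM => //; exact: mb.
- by move=> j w; rewrite mule_ge0// lee_fin invr_ge0 ltW.
rewrite -nneseries_esumT; last first.
  by move=> j; apply: integral_ge0 => w _; rewrite mule_ge0// lee_fin invr_ge0 ltW.
(* The [j]-th integral is at most [2^-1 / 2 ^ j.+1], and these bounds add up to 1/2. *)
apply: le_trans (epsilon_trick0 xpredT (_ : (0 <= 2^-1 :> R)%R)) => //.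
apply: lee_nneseries => [j _ _|j _].
  by apply: integral_ge0 => w _; rewrite mule_ge0// lee_fin invr_ge0 ltW.
rewrite ge0_integralZl//; last by rewrite lee_fin invr_ge0 ltW.
have Bj0 : (0 < B ^ j)%N by rewrite expn_gt0 (ltnW B2).
apply: (@le_trans _ _ ((threshold C B j)^-1%:E * (C * (B ^ j)%:R ^+ 2)%:E)).
  by apply: lee_wpmul2l; [rewrite lee_fin invr_ge0 ltW|exact: mean_ballT].
rewrite -EFinM lee_fin /threshold.
have h1 : (0 < (B ^ j)%:R :> R)%R by rewrite ltr0n.
have h2 : (0 < 2 ^+ j :> R)%R by rewrite exprn_gt0.
have -> : ((2 ^ j.+1)%:R = 2 * 2 ^+ j :> R)%R by rewrite natrX exprS.
move: h1 h2; set x := (B ^ j)%:R; set y := (2 ^+ j)%R => h1 h2.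
rewrite le_eqVlt; apply/orP; left; apply/eqP.
by field; rewrite !gt_eqF.
Qed.

Section transport.
Variable h : nat -> D_star R -> R.
Hypothesis mh : forall k, measurable_fun [set: D_star R] (h k).
Hypothesis h0 : forall k c, (0 <= h k c)%R.

Let g (c : D_star_star R) : R :=
  (\1_lightS (recenter ord0 c) * h (pair_distance c) (recenter ord_max c))%R.

Let g0 c : (0 <= g c)%R.
Proof. by rewrite mulr_ge0// indicE. Qed.

Let mg : measurable_fun [set: D_star_star R] g.
Proof.
apply: measurable_funM.
  apply: (@measurableT_comp _ _ _ _ _ _ (\1_lightS : D_star R -> R)).
    by apply: measurable_indic; exact: measurable_light.
  exact: measurable_recenter.
apply: (measurable_fun_nat_family (f := fun k c => h k (recenter ord_max c))).
  exact: measurable_pair_distance.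
by move=> k; apply: measurableT_comp; [exact: mh|exact: measurable_recenter].
Qed.

Let g_pair (D : discrete_space R) (o v : D) : integral_space D ->
  g (class (pointed2 o v)) =
  (\1_lightS (class (pointed1 o)) * h (ndist o v) (class (pointed1 v)))%R.
Proof. by move=> ID; rewrite /g !recenter_class pair_distance_class. Qed.

(* Mass [h (d(o, v)) [D, v]] is sent from [v] to each light [o]: a covering makes every
   light point receive at least [1]. *)
Lemma light_mass_transport :
  {ae P, forall w, 1 <= \esum_(v in [set: S w])
    (h (ndist (origin (S w)) v) (class (pointed1 v)))%:E} ->
  (2^-1)%:E <= \int[P]_w \esum_(v in [set: S w])
    (\1_lightS (class (pointed1 v)) * h (ndist v (origin (S w))) (T w))%:E.
Proof.
move=> covered; apply: (le_trans prob_light).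
have mL : measurable (T @^-1` lightS).
  by rewrite -[X in measurable X]setTI; apply: measurable_funPT => //; exact: measurable_light.
have TE w : class (pointed1 (origin (S w))) = T w.
  by rewrite class_pointed1 class_representative.
rewrite -[X in P X]setIT -integral_indic//.
apply: (@le_trans _ _ (\int[P]_w (\esum_(v in [set: S w])
    (g (class (pointed2 (origin (S w)) v)))%:E))).
  apply: ge0_ae_le_integralT.
  - by move=> w; rewrite lee_fin indicE.
  - by move=> w; apply: esum_ge0 => v _; rewrite lee_fin.
  apply: filterS2 intT covered => w IS cw.
  have [Lw|nLw] := pselect (lightS (T w)); last first.
    rewrite indicE memNset//=.
    by apply: esum_ge0 => v _; rewrite lee_fin.
  apply: (@le_trans _ _ 1); first by rewrite indicE lee_fin; case: (_ \in _).
  apply: (le_trans cw); apply: le_esum => v _; rewrite g_pair// TE indicE mem_set//.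
  by rewrite mul1r.
have -> : \int[P]_w (\esum_(v in [set: S w]) (g (class (pointed2 (origin (S w)) v)))%:E) =
    \int[P]_w (\esum_(v in [set: S w]) (g (class (pointed2 v (origin (S w)))))%:E).
  exact: (unimodT mg g0).
apply: ge0_ae_le_integralT.
- by move=> w; apply: esum_ge0 => v _; rewrite lee_fin.
- by move=> w; apply: esum_ge0 => v _; rewrite lee_fin mulr_ge0// indicE.
apply: filterS intT => w IS; apply: le_esum => v _.
by rewrite g_pair// TE.
Qed.

End transport.

End light_mass.

Lemma ae_mono d (T : measurableType d) (R : realType) (mu : {measure set T -> \bar R})
    (A B : T -> Prop) : (forall x, A x -> B x) ->
  {ae mu, forall x, A x} -> {ae mu, forall x, B x}.
Proof. by move=> AB; apply: filterS. Qed.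

(** * Events on the mark of one point *)

Definition mark_borel (R : realType) (Xi : mark_space R) : set (set Xi) :=
  <<s [set U : set Xi | mark_open U] >>.

Lemma mark_borel_open (R : realType) (Xi : mark_space R) (U : set Xi) :
  mark_open U -> mark_borel U.
Proof. by move=> oU; exact: sub_gen_smallest. Qed.

Lemma mark_open_true (R : realType) : mark_open [set x : bool_mark R | x = true].
Proof. by move=> x xt; exists 1 => // y; rewrite /= /bool_dist; case: eqVneq => [<- //|_]; rewrite ltxx. Qed.

Lemma mark_open_radius_gt (R : realType) (t : R) : mark_open [set x : radius_mark R | t < radius x].
Proof.
move=> x tx; exists (radius x - t); first by rewrite subr_gt0.
by move=> y; rewrite /= /radius_dist /radius => /ltr_normlW; rewrite /= /radius in tx *; lra.
Qed.

Lemma mark_open_radius_lt (R : realType) (t : R) : mark_open [set x : radius_mark R | radius x < t].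
Proof.
move=> x xt; exists (t - radius x); first by rewrite subr_gt0.
by move=> y; rewrite /= /radius_dist /radius distrC => /ltr_normlW; rewrite /= /radius in xt *; lra.
Qed.

Lemma cover_pow_ge0 (R : realType) (alpha x : R) : 0 <= cover_pow alpha x.
Proof. by rewrite /cover_pow; case: ifP => // _; exact: powR_ge0. Qed.

Section mark_events.
Variables (R : realType) (Xi : mark_space R).

Definition origin_mark_event (V : set Xi) : set (D'_star Xi) :=
  [set c | V (mark (origin (representative c)) (origin (representative c)))].

Lemma origin_mark_event_class (V : set Xi) (S : pointed_space 0 Xi) :
  origin_mark_event V (class S) <-> V (mark (origin S) (origin S)).
Proof.
have [f [_ _ fp fm]] := representative_class S.
by rewrite /origin_mark_event /= -(isomorphic_origin fp) fm.
Qed.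

Lemma measurable_origin_mark_event V : mark_borel V -> measurable (origin_mark_event V).
Proof.
pose G := [set V : set Xi | measurable (origin_mark_event V)].
suff : @mark_borel R Xi `<=` G by exact.
apply: smallest_sub; first split.
- by rewrite /G /=; exact: measurable0.
- move=> A; rewrite /G /= => mA.
  rewrite (_ : origin_mark_event _ = ~` origin_mark_event A); first exact: measurableC.
  by apply/seteqP; split=> c; rewrite /origin_mark_event /= => h; [case: h|split].
- move=> F mF; rewrite /G /=.
  rewrite (_ : origin_mark_event _ = \bigcup_i origin_mark_event (F i)); first exact: bigcupT_measurable.
  by apply/seteqP; split=> c; rewrite /origin_mark_event /= => -[i _ h]; exists i.
move=> U oU; rewrite /G /=; apply: measurable_class_open; apply: class_openI => S.
move=> /origin_mark_event_class/oU[e e0 eU]; exists (Num.min e 1).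
  by rewrite lt_min e0 ltr01.
move=> S' e' e'0; rewrite lt_min => /andP[e'e _] [f [_ fp _ fm]] _.
apply/origin_mark_event_class; apply: eU.
have B : dist (origin S) (origin S) <= e'^-1 by rewrite distxx invr_ge0 ltW.
have := fm _ _ B B; rewrite (fp ord0 B) => h.
by case: (mark_distance Xi) => _ -> _; exact: le_lt_trans h e'e.
Qed.

Lemma measurable_mark_at V (D : discrete_space R) (v : D) : mark_borel V ->
  measurable ([set z | V (z v v)] : set (markings D Xi)).
Proof.
pose G := [set V : set Xi | measurable ([set z | V (z v v)] : set (markings D Xi))].
suff : @mark_borel R Xi `<=` G by exact.
apply: smallest_sub; first split.
- by rewrite /G /=; exact: measurable0.
- move=> A; rewrite /G /= => mA.
  rewrite (_ : mkset _ = ~` [set z | A (z v v)]); first exact: measurableC.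
  by apply/seteqP; split=> c /= h; [case: h|split].
- move=> F mF; rewrite /G /=.
  rewrite (_ : mkset _ = \bigcup_i [set z | F i (z v v)]); first exact: bigcupT_measurable.
  by apply/seteqP; split=> c /= => -[i _ h]; exists i.
move=> U oU; rewrite /G /=; apply: sub_sigma_algebra.
by exists v, v, U.
Qed.

Variable Z : equivariant_process Xi.

Definition point_law (V : set Xi) (c : D_star R) : \bar R :=
  law Z (representative c)
    [set z | V (z (origin (representative c)) (origin (representative c)))].

Lemma measurable_point_law V : mark_borel V -> measurable_fun [set: D_star R] (point_law V).
Proof.
move=> /measurable_origin_mark_event/(law_measurable Z).
rewrite (_ : (fun c => _) = point_law V)//; apply/funext => c; rewrite /point_law.
congr (law _ _ _); apply/seteqP; split=> z; first by move/origin_mark_event_class.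
by move=> h; apply/origin_mark_event_class.
Qed.

(** By invariance under isometries, the law of the mark at any [v] is a function of the class
    pointed at [v]; this makes it usable in mass transport. *)
Lemma point_law_class V (D : discrete_space R) (v : D) : mark_borel V ->
  point_law V (class (pointed1 v)) = law Z D [set z | V (z v v)].
Proof.
move=> bV; have [f [[g fK gK] fd fp _]] := representative_class (pointed1 v).
rewrite /point_law -(law_isometry Z fK gK fd); last exact: measurable_mark_at.
by rewrite -(isomorphic_origin fp) /= !fK.
Qed.

End mark_events.

(** * Lower bounds for all coverings *)

Section covering_lower_bound.
Local Open Scope ereal_scope.
Variables (R : realType) (d : measure_display) (Omega : measurableType d).
Variables (P : probability Omega R) (T : {RV P >-> D_star R}).
Hypothesis unimodT : unimodular T.
Hypothesis intT : {ae P, forall w, integral_space (representative (T w))}.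
Variables (C : R) (B : nat) (alpha : R).
Hypotheses (C0 : (0 < C)%R) (B2 : (1 < B)%N) (Balpha : (2 <= B%:R `^ (alpha - 2))%R).
Hypothesis alpha2 : (2 < alpha)%R.
Hypothesis mean_ballT : forall r : nat, (0 < r)%N ->
  \int[P]_w (ball_number r (T w))%:R%:E <= (C * r%:R ^+ 2)%:E.

Local Notation S w := (representative (T w)).
Local Notation lightS := (light C B).
Let K : R := (4 * C * (2 * B%:R) `^ alpha)%R.

Let K0 : (0 < K)%R.
Proof. by rewrite /K !mulr_gt0// powR_gt0// mulr_gt0// ltr0n (ltnW B2). Qed.

(* [V k] is meant to be the set of marks whose ball has radius at least [k]. *)
Lemma covering_transport (Xi : mark_space R) (Z : equivariant_process Xi)
    (V : nat -> set Xi) :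
  (forall k, mark_borel (V k)) ->
  {ae P, forall w, {ae law Z (S w), forall z, exists v : S w,
     V (ndist (origin (S w)) v) (z v v)}} ->
  (2^-1)%:E <= \int[P]_w \esum_(v in [set: S w])
    (\1_lightS (class (pointed1 v)) * fine (point_law Z (V (ndist v (origin (S w)))) (T w)))%:E.
Proof.
move=> bV cov.
have fin k c : point_law Z (V k) c \is a fin_num.
  by apply: fin_num_measure; exact: measurable_mark_at.
apply: (light_mass_transport unimodT intT C0 B2 mean_ballT
  (h := fun k c => fine (point_law Z (V k) c))).
- by move=> k; apply: measurableT_comp => //; exact: measurable_point_law.
- by move=> k c; rewrite fine_ge0.
apply: filterS cov => w; set D := S w; set o := origin D; move=> cw.
pose E (v : D) : set (markings D Xi) := [set z | V (ndist o v) (z v v)].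
have mE v : measurable (E v) by exact: measurable_mark_at.
rewrite (@eq_esum _ _ _ _ (fun v => \int[law Z D]_z (\1_(E v) z)%:E)); last first.
  move=> v _; rewrite fineK// point_law_class// integral_indic ?setIT//.
rewrite -integral_esum//; last 2 first.
- exact: countable_space.
- by move=> v; exact: measurable_EFin_indic.
apply: (@le_trans _ _ (\int[law Z D]_z (cst 1 z))).
  rewrite integral_cst; last exact: measurableT.
  rewrite mul1e le_eqVlt; apply/orP; left; apply/eqP/esym; exact: probability_setT.
apply: ge0_ae_le_integralT => //.
- by move=> z; apply: esum_ge0 => v _; rewrite lee_fin.
apply: ae_mono cw => z [v vz].
rewrite -(@esum_delta _ _ v 1)//; apply: le_esum => u _; case: eqVneq => [->|_].
  by rewrite indicE mem_set.
by rewrite lee_fin.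
Qed.

Let card_bound w (r : R) : integral_space (S w) -> (1 <= r)%R ->
  \esum_(v in [set: S w]) (\1_[set v : S w | (dist v (origin (S w)) <= r)%R /\
    lightS (class (pointed1 v))] v)%:E <= (K * r `^ alpha)%:E.
Proof.
move=> IS r1; rewrite esum_indicator.
  rewrite lee_fin (_ : mkset _ = [set v : S w | (dist v (origin (S w)) <= r)%R /\
    lightS (class (pointed1 v))]); last by apply/seteqP; split=> [v []|v].
  exact: light_ball.
apply: sub_finite_set (finite_closed_ball (origin (S w)) r) => v [_ [vr _]].
by rewrite /= distC.
Qed.

Lemma intensity_lower_bound (r : R) (Z : equivariant_process (bool_mark R)) : (1 <= r)%R ->
  is_r_covering T r Z -> (2^-1)%:E <= (K * r `^ alpha)%:E * intensity T Z.
Proof.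
move=> r1 cov; have r0 : (0 < r)%R by rewrite (lt_le_trans _ r1).
(* The radius is the constant [r], so the dependence on [k] is a deterministic condition. *)
pose V k : set (bool_mark R) := [set x : bool | x = true /\ (k%:R <= r)%R].
have bV k : mark_borel (V k).
  apply: mark_borel_open => x [/mark_open_true[e e0 xe] kr]; exists e => // y /xe yt.
  by split.
have fin k c : point_law Z (V k) c \is a fin_num.
  by apply: fin_num_measure; exact: measurable_mark_at.
apply: (le_trans (covering_transport (Z := Z) bV _)).
  apply: filterS2 intT cov => w IS; apply: ae_mono => z /(_ (origin (S w)))[v zv].
  rewrite /dist_ball (gt_eqF r0) /= => ov; exists v; split=> //.
  by rewrite -IS.
apply: (@le_trans _ _ (\int[P]_w ((K * r `^ alpha)%:E *
    law Z (S w) [set z | z (origin (S w)) (origin (S w)) = true]))); last first.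
  apply: ge0_integralZl_le; first by rewrite mulr_gt0// powR_gt0.
  by move=> w; exact: measure_ge0.
apply: ge0_ae_le_integralT.
- by move=> w; apply: esum_ge0 => v _; rewrite lee_fin mulr_ge0 ?fine_ge0 ?measure_ge0// indicE.
- by move=> w; rewrite mule_ge0 ?measure_ge0// lee_fin mulr_ge0 ?powR_ge0// ltW.
apply: filterS intT => w IS; set o := origin (S w).
set I := law Z (S w) _.
have Ifin : I \is a fin_num.
  apply: fin_num_measure.
  rewrite (_ : mkset _ = [set z : markings (S w) (bool_mark R) | V 0%N (z o o)]).
    exact: measurable_mark_at.
  by apply/seteqP; split=> [z zo|z []//]; split=> //; exact: ltW.
rewrite (@eq_esum _ _ _ _ (fun v => (fine I)%:E * (\1_[set v : S w | (dist v o <= r)%R /\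
    lightS (class (pointed1 v))] v)%:E)); last first.
  move=> v _; rewrite -EFinM mulrC /point_law -/o.
  have [vr|nvr] := pselect (dist v o <= r)%R.
    congr (_ * _)%:E.
      congr (fine (law _ _ _)); apply/seteqP; split=> [z [//]|z zo]; split=> //.
      by rewrite -IS.
    rewrite !indicE; congr (_%:R); congr nat_of_bool.
    by apply/idP/idP => /set_mem h; apply/mem_set; [split|case: h].
  rewrite (_ : mkset _ = set0); last first.
    by apply/seteqP; split=> [z [_]|//]; rewrite -IS.
  by rewrite measure0 /= mul0r indicE memNset ?mulr0// => -[].
rewrite esumZl ?fine_ge0 ?measure_ge0//; last exact: countable_space.
rewrite fineK// muleC; apply: lee_wpmul2r; first exact: measure_ge0.
exact: card_bound.
Qed.

Lemma measurable_cover_pow (D : discrete_space R) (o : D) : measurable_fun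
  [set: markings D (radius_mark R)] (fun z => (cover_pow alpha (radius (z o o)))%:E).
Proof.
apply: (@measurableT_comp _ _ _ _ _ _ (@EFin R)) => //.
apply: (@measurableT_comp _ _ _ _ _ _ (cover_pow alpha)).
  apply: measurable_fun_if => //.
  - by apply: measurable_fun_eqr.
  - by apply: measurable_funTS; exact: measurable_powR.
apply: (measurability _ (RGenOInfty.measurableE R)).
move=> _ [_ [t ->] <-]; rewrite setTI.
rewrite (_ : _ @^-1` _ = [set z | [set x : radius_mark R | (t < radius x)%R] (z o o)]).
  by apply: measurable_mark_at; apply: mark_borel_open; exact: mark_open_radius_gt.
by apply/seteqP; split=> z /=; rewrite in_itv /= andbT.
Qed.

Lemma mean_pow_lower_bound (Z : equivariant_process (radius_mark R)) :
  is_covering T Z -> (2^-1)%:E <= K%:E * mean_pow T alpha Z.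
Proof.
move=> cov.
(* Radius 0 stands for an empty ball and must not cover its own centre, hence the condition
   [0 < radius], which matters for [k = 0]. *)
pose V k : set (radius_mark R) := [set x | (0 < radius x)%R] `&` ~` [set x | (radius x < k%:R)%R].
have bV k : mark_borel (V k).
  have b1 : mark_borel [set x : radius_mark R | (0 < radius x)%R].
    by apply: mark_borel_open; exact: mark_open_radius_gt.
  have b2 : mark_borel [set x : radius_mark R | (radius x < k%:R)%R].
    by apply: mark_borel_open; exact: mark_open_radius_lt.
  have [h0 hC hU] := smallest_sigma_algebra setT [set U : set (radius_mark R) | mark_open U].
  rewrite /V -[_ `&` _]setCK setCI setCK -setTD; refine (hC _ _); rewrite -bigcup2E; apply: hU.
  by move=> [|[|i]] //=; rewrite -setTD; exact: hC.
have VE k x : V k x <-> (0 < radius x)%R /\ (k%:R <= radius x)%R.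
  by rewrite /V /=; split=> -[x0 kx]; split=> //; [rewrite leNgt; exact/negP|apply/negP; rewrite -leNgt].
have radP (x : radius_mark R) : radius x = 0%R \/ (1 <= radius x)%R by case: (svalP x); [left|right].
have fin k c : point_law Z (V k) c \is a fin_num.
  by apply: fin_num_measure; exact: measurable_mark_at.
have cp0 := cover_pow_ge0 alpha.
apply: (le_trans (covering_transport (Z := Z) bV _)).
  apply: filterS2 intT cov => w IS; apply: ae_mono => z /(_ (origin (S w)))[v].
  rewrite /dist_ball; case: eqVneq => [//|zv0] /= ov; exists v; apply/VE; rewrite -IS; split=> //.
  by have [z0|/(lt_le_trans ltr01)//] := radP (z v v); rewrite z0 eqxx in zv0.
apply: (@le_trans _ _ (\int[P]_w (K%:E * \int[law Z (S w)]_z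
     (cover_pow alpha (radius (z (origin (S w)) (origin (S w)))))%:E))); last first.
  apply: ge0_integralZl_le => // w; apply: integral_ge0 => z _; by rewrite lee_fin.
apply: ge0_ae_le_integralT.
- by move=> w; apply: esum_ge0 => v _; rewrite lee_fin mulr_ge0 ?fine_ge0 ?measure_ge0// indicE.
- move=> w; rewrite mule_ge0// ?lee_fin ?(ltW K0)//; apply: integral_ge0 => z _; by rewrite lee_fin.
apply: filterS intT => w IS; set o := origin (S w).
pose E (v : S w) : set (markings (S w) (radius_mark R)) := [set z | V (ndist v o) (z o o)].
have mE v : measurable (E v) by exact: measurable_mark_at.
rewrite (@eq_esum _ _ _ _ (fun v => \int[law Z (S w)]_z
    (\1_lightS (class (pointed1 v)) * \1_(E v) z)%:E)); last first.
  move=> v _; under eq_integral do rewrite EFinM.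
  rewrite ge0_integralZl//; last first.
    exact: measurable_EFin_indic.
  by rewrite integral_indic// setIT EFinM fineK.
rewrite -integral_esum; last 3 first.
- exact: countable_space.
- move=> v; apply: (@measurableT_comp _ _ _ _ _ _ (@EFin R)) => //.
  by apply: measurable_funM => //; exact: measurable_indic.
- by move=> v z; rewrite lee_fin mulr_ge0// indicE.
rewrite -ge0_integralZl//; last 3 first.
- exact: measurable_cover_pow.
- by move=> z _; rewrite lee_fin.
- by rewrite lee_fin ltW.
apply: ge0_le_integralT => z.
  by apply: esum_ge0 => v _; rewrite lee_fin mulr_ge0// indicE.
have [z0|z1] := radP (z o o).
  rewrite esum1; first by rewrite mule_ge0// lee_fin ?(ltW K0).
  move=> v _; rewrite [X in (_ * X)%R]indicE memNset ?mulr0//.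
  by move=> /VE[]; rewrite z0 ltxx.
rewrite /cover_pow gt_eqF; last exact: lt_le_trans ltr01 z1.
rewrite -EFinM; apply: le_trans (card_bound IS z1); apply: le_esum => v _.
rewrite lee_fin.
have [lv|nlv] := pselect (lightS (class (pointed1 v))); last first.
  by rewrite indicE memNset// mul0r indicE.
rewrite indicE mem_set// mul1r !indicE.
have [Ev|nEv] := pselect (E v z); last by rewrite memNset.
rewrite (mem_set Ev) mem_set//; split=> //; rewrite IS.
by move/VE : Ev => [].
Qed.

End covering_lower_bound.

(** * Upper bounds and the dimensions *)

Lemma bigcapT_countable_measurable (d : measure_display) (T : measurableType d) (U : choiceType)
    (F : U -> set T) : countable [set: U] -> (forall x, measurable (F x)) ->
  measurable (\bigcap_x F x).
Proof.
move=> cU mF; rewrite -[X in measurable X]setCK setC_bigcap; apply: measurableC.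
by apply: countable_bigcupT_measurable => // x; exact: measurableC.
Qed.

Section level_covering.
Variables (R : realType) (Xi : mark_space R) (n : nat) (a b : Xi) (D : discrete_space R).
Local Notation lawD := (law (level_process n a b) D).

(** The law is a uniform sum of Dirac masses, so it suffices to check each residue. *)
Lemma level_law_ae (o : D) (phi : markings D Xi -> Prop) : has_busemann D ->
  measurable [set z | phi z] -> (forall i : 'I_n.+1, phi (level_marking a b o i)) ->
  {ae lawD, forall z, phi z}.
Proof.
move=> gD mphi allphi; exists (~` [set z | phi z]); split=> //; first exact: measurableC.
rewrite /= (level_lawE _ _ _ o _ gD) big1 ?mule0// => i _.
by rewrite indicE memNset//= => /(_ (allphi i)).
Qed.

Lemma level_marking_origin (o : D) (i : 'I_n.+1) : level_marking a b o i o o =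
  if `[< selected o i o >] then a else b.
Proof. by rewrite /level_marking /set_marking; congr (if _ then _ else _); apply/asboolP/asboolP => [[]|]. Qed.

Lemma selected_origin (o : D) (i : 'I_n.+1) : has_busemann D ->
  selected o i o -> i = 0 /\ tall n o.
Proof.
move=> gD [[c oc <-] to]; split=> //.
by rewrite (busemann_unique gD oc (busemannxx o)) level0.
Qed.

(** Relative to itself the point [o] has height 0, so among the [n.+1] residues only 0 can select
    it. *)
Lemma level_law_origin (o : D) (V : set Xi) : has_busemann D -> ~ V b ->
  (lawD [set z | V (z o o)] <= (n.+1%:R^-1)%:E * (\1_[set x | tall n x] o)%:E)%E.
Proof.
move=> gD nVb; rewrite /= (level_lawE _ _ _ o _ gD); apply: lee_wpmul2l.
  by rewrite lee_fin invr_ge0.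
rewrite sumEFin lee_fin (bigD1 (0 : 'I_n.+1))//= [X in _ + X <= _]big1 ?addr0.
  have [to|nto] := pselect (tall n o).
    by rewrite [leRHS]indicE mem_set// indicE; case: (_ \in _).
  rewrite indicE memNset ?ler0n//= level_marking_origin; case: asboolP => //.
  by move=> /(selected_origin gD)[].
move=> i i0; rewrite indicE memNset//= level_marking_origin; case: asboolP => //.
by move=> /(selected_origin gD)[] h; rewrite h eqxx in i0.
Qed.

Lemma level_covering (F : D -> D) (bus : D -> int) (o : D) (V : set Xi) :
  end_structure F bus -> mark_open V -> V a ->
  {ae lawD, forall z, forall u : D, exists2 v : D, V (z v v) & (ndist u v <= 2 * n)%N}.
Proof.
move=> FbD oV Va; have gD := end_has_busemann FbD.
apply: (level_law_ae (o := o)) => //.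
  pose G (u v : D) : set (markings D Xi) := [set z | V (z v v) /\ (ndist u v <= 2 * n)%N].
  rewrite (_ : mkset _ = \bigcap_u \bigcup_v G u v); last first.
    apply/seteqP; split=> [z h u _|z h u].
      by have [v Vv uv] := h u; exists v.
    by have [v _ [Vv uv]] := h u I; exists v.
  apply: bigcapT_countable_measurable; first exact: countable_space.
  move=> u; apply: countable_bigcupT_measurable; first exact: countable_space.
  move=> v; have [uv|nuv] := boolP (ndist u v <= 2 * n)%N.
    rewrite (_ : G u v = [set z | V (z v v)]); last by apply/seteqP; split=> z // [].
    by apply: sub_sigma_algebra; exists v, v, V.
  rewrite (_ : G u v = set0); first exact: measurable0.
  by apply/seteqP; split=> z // [_ uv]; rewrite uv in nuv.
(* [s <= n] is the number of generations to climb from [u] so that the vertex [n] generations higher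
   has residue [i]; that vertex is tall because of [u'], and is at distance [n + s] from [u]. *)
move=> i u; pose s : 'I_n.+1 := level n (bus u - bus o - n%:Z) - i.
have FD : forall x k, ndist x (iter k F x) = k /\ bus (iter k F x) = bus x - k%:Z.
  by case: FbD.
pose u' := iter s F u; pose v := iter n F u'.
have vE : v = iter (n + s) F u by rewrite /v /u' iterD.
exists v; last first.
  by rewrite vE (FD u _).1; have := ltn_ord s; lia.
rewrite /level_marking /set_marking; case: asboolP => //; case; split=> //; split.
  exists (bus v - bus o); first exact: end_busemann FbD _ _.
  rewrite vE (FD u _).2.
  apply: (addIr s); rewrite -[X in _ + X]level_ord -levelD.
  rewrite (_ : _ + _ = bus u - bus o - n%:Z); last by lia.
  by rewrite [RHS]addrC /s subrK.
exists u'; first exact: (FD u' n).1.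
by apply/(end_busemannE FbD); rewrite (FD u' n).2; lia.
Qed.

End level_covering.

Section covering_upper_bound.
Local Open Scope ereal_scope.
Variables (R : realType) (d : measure_display) (Omega : measurableType d).
Variables (P : probability Omega R) (T : {RV P >-> D_star R}) (p : probability nat R).
Hypothesis unimodT : unimodular T.
Hypothesis treeT : {ae P, forall w, is_tree (representative (T w)) /\
  one_ended (representative (T w))}.
Variable Y : {RV P >-> D_star R}.
Hypothesis YE : {ae P, forall w, Y w =
  class (descendant_tree (origin (representative (T w))))}.
Hypothesis Ygw : is_galton_watson p Y.
Variable n : nat.
Local Notation S w := (representative (T w)).

Let c := fine (prob_gt p 1).
Let q := ((n.+1%:R * (1 + n%:R * c))^-1)%R.

Let mean_origin : \int[P]_w ((n.+1%:R^-1)%:E * (\1_[set x | tall n x] (origin (S w)))%:E) <= q%:E.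
Proof.
apply: le_trans (ge0_integralZl_le _ _ _) _; first by rewrite invr_gt0.
  by move=> w; rewrite lee_fin indicE.
rewrite /q invfM EFinM; apply: lee_wpmul2l; first by rewrite lee_fin invr_ge0.
exact: (prob_tall unimodT treeT YE Ygw).
Qed.

Lemma lambda_le (r : R) : (1 <= r)%R -> ((2 * n)%:R <= r)%R -> lambda T r <= q%:E.
Proof.
move=> r1 nr; have r0 : (0 < r)%R by rewrite (lt_le_trans _ r1).
pose Z := level_process n (true : bool_mark R) (false : bool_mark R).
apply: (@le_trans _ _ (intensity T Z)).
  apply: ereal_inf_lbound; exists Z => //.
  apply: filterS (ae_end_structure treeT) => w [F [bus FbD]].
  have := level_covering n (false : bool_mark R) (origin (S w)) (V := [set x : bool_mark R | x = true :> bool]) FbD _ erefl.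
  move/(_ (@mark_open_true R)); apply: ae_mono => z h u.
  have [v vt uv] := h u; exists v => //; rewrite /dist_ball (gt_eqF r0) /=.
  by rewrite (end_integral FbD) (le_trans _ nr)// ler_nat.
apply: le_trans mean_origin; apply: ge0_ae_le_integralT.
- by move=> w; exact: measure_ge0.
- by move=> w; rewrite mule_ge0// lee_fin ?invr_ge0// indicE.
apply: filterS (ae_end_structure treeT) => w [F [bus FbD]].
by apply: (@level_law_origin R (bool_mark R) n true false _ _ [set x : bool | x = true]) => //; exact: end_has_busemann FbD.
Qed.

Lemma H1_le (alpha : R) : (0 <= alpha)%R ->
  H1 T alpha <= ((2 * n).+1%:R `^ alpha * q)%:E.
Proof.
(* The value [2 n + 1] is an admissible radius even for [n = 0], and it satisfies [2 n < radius], an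
   open condition on marks as [level_covering] requires. *)
move=> a0; set r : R := (2 * n).+1%:R.
have r1 : (1 <= r)%R by rewrite ler1n.
have r0 : (0 < r)%R by rewrite ltr0n.
pose rr : radius_mark R := exist _ r (or_intror r1).
pose Z := level_process n rr (radius_point R : radius_mark R).
apply: (@le_trans _ _ (mean_pow T alpha Z)).
  apply: ereal_inf_lbound; exists Z => //.
  apply: filterS (ae_end_structure treeT) => w [F [bus FbD]].
  have := level_covering n (radius_point R : radius_mark R) (origin (S w))
    (a := rr) (V := [set x : radius_mark R | ((2 * n)%:R < radius x)%R]) FbD
    (@mark_open_radius_gt R _) _.
  move=> cov; apply: ae_mono (cov _) => [z h u|].
  - have [v vt uv] := h u; exists v; rewrite /dist_ball gt_eqF /=.
      by rewrite (end_integral FbD) (le_trans _ (ltW vt))// ler_nat.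
    by apply: le_lt_trans vt.
  - by rewrite /= /radius /= /r ltr_nat.
apply: (@le_trans _ _ (\int[P]_w ((r `^ alpha)%:E * ((n.+1%:R^-1)%:E *
    (\1_[set x | tall n x] (origin (S w)))%:E)))); last first.
  apply: le_trans (ge0_integralZl_le _ _ _) _; first by rewrite powR_gt0.
    by move=> w; rewrite mule_ge0// lee_fin ?invr_ge0// indicE.
  by rewrite EFinM; apply: lee_wpmul2l; [rewrite lee_fin powR_ge0|exact: mean_origin].
have cp0 := cover_pow_ge0 alpha.
apply: ge0_ae_le_integralT.
- by move=> w; apply: integral_ge0 => z _; rewrite lee_fin.
- by move=> w; rewrite !mule_ge0// lee_fin ?powR_ge0 ?invr_ge0// indicE.
apply: filterS (ae_end_structure treeT) => w [F [bus FbD]].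
have gD := end_has_busemann FbD; set o := origin (S w).
pose V := [set x : radius_mark R | (0 < radius x)%R].
pose E : set (markings (S w) (radius_mark R)) := [set z | V (z o o)].
have mE : measurable E.
  by apply: measurable_mark_at; apply: mark_borel_open; exact: mark_open_radius_gt.
apply: (@le_trans _ _ (\int[law Z (S w)]_z ((r `^ alpha)%:E * (\1_E z)%:E))).
  apply: ge0_ae_le_integralT.
  - by move=> z; rewrite lee_fin.
  - by move=> z; rewrite mule_ge0// lee_fin ?powR_ge0// indicE.
  pose V' := [set x : radius_mark R | (r < radius x)%R].
  pose W : set (markings (S w) (radius_mark R)) := [set z | V' (z o o)].
  have mW : measurable W.
    by apply: measurable_mark_at; apply: mark_borel_open; exact: mark_open_radius_gt.
  have : {ae law Z (S w), forall z, ~ W z}.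
    apply: (level_law_ae (o := o)) => //; first exact: (measurableC mW).
    move=> i; rewrite /W /V' /= level_marking_origin; case: ifP => _; rewrite /radius /= ?ltxx//.
    by apply/negP; rewrite -leNgt ltW.
  apply: ae_mono => z /negP; rewrite -leNgt => zr; rewrite -EFinM lee_fin.
  rewrite /cover_pow; case: eqVneq => [_|z0].
    by rewrite mulr_ge0 ?powR_ge0// indicE.
  have z1 : (0 < radius (z o o))%R.
    by case: (svalP (z o o)) => [h|/(lt_le_trans ltr01)//]; rewrite /radius h eqxx in z0.
  by rewrite indicE mem_set// mulr1 ge0_ler_powR// nnegrE ltW.
rewrite ge0_integralZl//; last 2 first.
- exact: measurable_EFin_indic.
- by rewrite lee_fin powR_ge0.
rewrite integral_indic// setIT; apply: lee_wpmul2l; first by rewrite lee_fin powR_ge0.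
by apply: (@level_law_origin R (radius_mark R) n rr (radius_point R) _ o V) => //; rewrite /V /radius /= ltxx.
Qed.

End covering_upper_bound.

(** * From power bounds to dimensions *)

Section dimension_criteria.
Variables (R : realType) (d : measure_display) (Omega : measurableType d).
Variables (P : probability Omega R) (T : {RV P >-> D_star R}) (a : R).

Lemma has_udimM_power (c : R) : 0 < c ->
  (forall r : R, 1 <= r -> (lambda T r <= (c * r `^ (- a))%:E)%E) ->
  (forall b : R, a < b -> exists2 k : R, 0 < k &
     forall r, 1 <= r -> ((k * r `^ (- b))%:E <= lambda T r)%E) ->
  has_udimM T a%:E.
Proof.
move=> c0 ub lb; rewrite /has_udimM.
have lnE b (k r l : R) : 0 < k -> 1 < r -> l = k * r `^ (- b) ->
    ln l * (ln r)^-1 = ln k / ln r - b.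
  move=> k0 r1 ->; have r0 : 0 < r by rewrite (lt_trans _ r1).
  have lr0 : 0 < ln r by rewrite ln_gt0.
  rewrite lnM ?posrE ?powR_gt0// ln_powR mulrDl mulfK ?gt_eqF//.
have lam r : 1 < r -> exists2 l : R, 0 < l & lambda T r = l%:E.
  move=> r1; have r0 : 0 < r by rewrite (lt_trans _ r1).
  have [|k k0 /(_ r (ltW r1)) kl] := lb (a + 1); first by rewrite ltrDl.
  have := ub r (ltW r1); case E : (lambda T r) kl => [l| |] // kl _.
  exists l => //; move: kl; rewrite lee_fin; apply: lt_le_trans.
  by rewrite mulr_gt0// powR_gt0.
have fE r l : 1 < r -> 0 < l -> lambda T r = l%:E ->
    (- lne (lambda T r) * ((ln r)^-1)%:E)%E = (- ln l / ln r)%:E.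
  by move=> r1 l0 ->; rewrite lne_EFin// -EFinN -EFinM.
apply: cvg_EFin.
  near=> r; have r1 : 1 < r by near: r; exact: nbhs_pinfty_gt.
  by have [l l0 le] := lam r r1; rewrite (fE r l).
apply/cvgrPdist_le => e e0.
have [|k k0 kP] := lb (a + e / 2); first by rewrite ltrDl divr_gt0.
near=> r.
have r1 : 1 < r by near: r; exact: nbhs_pinfty_gt.
have r0 : 0 < r by rewrite (lt_trans _ r1).
have lr0 : 0 < ln r by rewrite ln_gt0.
(* The error [e] is shared: half is the loss in the exponent, half bounds the constants divided by
   [ln r]. *)
have lnbig (x : R) : expR (2 * `|x| / e) < r -> `|x / ln r| <= e / 2.
  move=> xr; rewrite normrM normfV (gtr0_norm lr0) ler_pdivrMr//.
  have : 2 * `|x| / e <= ln r.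
    by rewrite -[leLHS]expRK; apply/ltW; rewrite ltr_ln// posrE ?expR_gt0.
  by rewrite ler_pdivrMr//; lra.
have /lnbig ck : expR (2 * `|ln c| / e) < r by near: r; exact: nbhs_pinfty_gt.
have /lnbig kk : expR (2 * `|ln k| / e) < r by near: r; exact: nbhs_pinfty_gt.
have [l l0 le] := lam r r1; rewrite /= (fE r l)//=.
have := ub r (ltW r1); have := kP r (ltW r1); rewrite le !lee_fin => kl lc.
have cr0 : 0 < c * r `^ (- a) by rewrite mulr_gt0// powR_gt0.
have kr0 : 0 < k * r `^ (- (a + e / 2)) by rewrite mulr_gt0// powR_gt0.
have h1 : ln l * (ln r)^-1 <= ln c / ln r - a.
  by rewrite -(lnE a c r _ c0 r1 erefl) ler_pM2r ?invr_gt0// ler_ln.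
have h2 : ln k / ln r - (a + e / 2) <= ln l * (ln r)^-1.
  by rewrite -(lnE _ k r _ k0 r1 erefl) ler_pM2r ?invr_gt0// ler_ln.
move: ck kk; rewrite !ler_norml mulNr => /andP[c1 c2] /andP[k1 k2].
by apply/andP; split; lra.
Unshelve. all: by end_near. Qed.

Lemma udimH_threshold : 0 < a ->
  (forall b : R, 0 <= b -> b < a -> H1 T b = 0%E) ->
  (forall b : R, a < b -> H1 T b <> 0%E) ->
  udimH T = a%:E.
Proof.
move=> a0 H1z H1p; rewrite /udimH /=; case: eqVneq => [A0|_].
  suff : (@set0 (\bar R)) 0%E by [].
  by rewrite -A0; exists 0 => //; split=> //; exact: H1z.
apply/eqP; rewrite eq_le; apply/andP; split.
  apply: ge_ereal_sup => _ [b [b0 b1] <-]; rewrite lee_fin leNgt; apply/negP => ab.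
  exact: H1p ab b1.
apply/lee_addgt0Pr => e e0; apply: (@le_trans _ _ ((Num.max 0 (a - e))%:E + e%:E)%E).
  by rewrite -EFinD lee_fin -lerBlDr le_max lexx orbT.
rewrite leeD2r//; apply: ereal_sup_ubound; exists (Num.max 0 (a - e)) => //.
have h : 0 <= Num.max 0 (a - e) by rewrite le_max lexx.
by split=> //; apply: H1z => //; rewrite gt_max a0 /=; lra.
Qed.

End dimension_criteria.

Section prob_gts.
Local Open Scope ereal_scope.
Variables (R : realType) (p : probability nat R).

(** If no point had two offspring, mean 1 would force exactly one offspring almost surely, the
    excluded trivial case. *)
Lemma prob_gt1_gt0 : \esum_(i in [set: nat]) prob_gt p i = 1 -> p [set 1%N] <> 1 ->
  (0 < fine (prob_gt p 1))%R.
Proof.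
move=> crit p1; have mnat (A : set nat) : measurable A by [].
have pf i : prob_gt p i \is a fin_num by exact: fin_num_measure.
rewrite fine_gt0// -ge0_fin_numE ?pf ?andbT; last exact: measure_ge0.
rewrite lt_neqAle measure_ge0 andbT; apply/eqP => /esym p0; apply: p1.
have pi0 i : (0 < i)%N -> prob_gt p i = 0.
  move=> i0; apply/eqP; rewrite eq_le measure_ge0 andbT -p0.
  by apply: le_measure; [exact/mem_set|exact/mem_set|move=> k /= ik; lia].
have p01 : prob_gt p 0 = 1.
  rewrite -crit -[LHS](@esum_delta _ _ 0%N); last exact: measure_ge0.
  by apply: eq_esum => -[|i] _ //=; rewrite pi0.
move: p01; rewrite /prob_gt (_ : [set k | (0 < k)%N] = [set 1%N] `|` [set k | (1 < k)%N]).
  rewrite measureU//; first by rewrite [X in _ + X](_ : _ = 0) ?adde0.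
  by apply/seteqP; split=> // k /= [->].
apply/seteqP; split=> k /=; last by case=> [->|] //; lia.
by case: k => [|[|k]] // _; [left|right].
Qed.

End prob_gts.

Section eternal_galton_watson_bounds.
Local Open Scope ereal_scope.
Variables (R : realType) (d : measure_display) (Omega : measurableType d).
Variables (P : probability Omega R) (T : {RV P >-> D_star R}) (p : probability nat R).
Hypothesis unimodT : unimodular T.
Hypothesis treeT : {ae P, forall w, is_tree (representative (T w)) /\
  one_ended (representative (T w))}.
Variable Y : {RV P >-> D_star R}.
Hypothesis YE : {ae P, forall w, Y w =
  class (descendant_tree (origin (representative (T w))))}.
Hypothesis Ygw : is_galton_watson p Y.

Let c := fine (prob_gt p 1).
Hypothesis c0 : (0 < c)%R.

Let c1 : (c <= 1)%R.
Proof.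
rewrite -lee_fin /c fineK; first exact: probability_le1.
exact: fin_num_measure.
Qed.

(* [c <= 1] gives [1 + n c >= c (n + 1)]. *)
Let inverse_square_bound (n : nat) (x : R) : (0 < x)%R -> (x <= 2 * n.+1%:R)%R ->
  ((n.+1%:R * (1 + n%:R * c))^-1 <= 4 / c * x `^ (- 2))%R.
Proof.
move=> x0 xn; rewrite powRN powR_mulrn ?(ltW x0)//.
have -> : (4 / c * (x ^+ 2)^-1 = (c * (x ^+ 2) / 4)^-1)%R.
  by field; rewrite !gt_eqF.
rewrite lef_pV2 ?posrE; last 2 first.
- by rewrite mulr_gt0// ltr_wpDr// mulr_ge0// ltW.
- by rewrite divr_gt0// mulr_gt0// exprn_gt0.
have n0 : (0 <= n%:R :> R)%R by [].
have h : (c * n.+1%:R <= 1 + n%:R * c)%R by rewrite -(natr1 n); move: c1; lra.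
apply: (@le_trans _ _ (n.+1%:R * (c * n.+1%:R))%R); last by rewrite ler_pM2l.
have : (x ^+ 2 <= (2 * n.+1%:R) ^+ 2)%R by rewrite ler_pXn2r// nnegrE ?(ltW x0)// mulr_ge0.
move/(ler_wpM2l (ltW c0)); lra.
Qed.

Lemma lambda_upper_bound (r : R) : (1 <= r)%R -> lambda T r <= (4 / c * r `^ (- 2))%:E.
Proof.
move=> r1; have r0 : (0 < r)%R by rewrite (lt_le_trans _ r1).
(* The largest [n] for which the covering radius [2 n] does not exceed [r]. *)
pose n := Num.truncn (r / 2).
have nr : (n%:R <= r / 2)%R by rewrite truncn_le// divr_ge0// ltW.
have rn : (r / 2 < n.+1%:R)%R by exact: truncnS_gt.
apply: le_trans (lambda_le unimodT treeT YE Ygw (n := n) r1 _) _.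
  by rewrite natrM; lra.
by rewrite lee_fin; apply: inverse_square_bound => //; lra.
Qed.

Lemma H1_eq0 (alpha : R) : (0 <= alpha)%R -> (alpha < 2)%R -> H1 T alpha = 0.
Proof.
move=> a0 a2; apply/eqP; rewrite eq_le; apply/andP; split; last first.
  apply: le_ereal_inf_tmp => _ [Z _ <-]; apply: integral_ge0 => w _.
  apply: integral_ge0 => z _; rewrite lee_fin; exact: cover_pow_ge0.
apply/lee_addgt0Pr => e e0; rewrite add0e.
(* The cost is at most [4 / c * x ^ (alpha - 2)] with [x = 2 n + 1]; this [n] makes it at most
   [e]. *)
pose n := Num.truncn ((4 / c / e) `^ (2 - alpha)^-1).
apply: le_trans (H1_le unimodT treeT YE Ygw n a0) _; rewrite lee_fin.
set x : R := ((2 * n).+1%:R)%R.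
have x0 : (0 < x)%R by rewrite ltr0n.
have xn : (x <= 2 * n.+1%:R)%R by rewrite -natrM ler_nat; lia.
apply: le_trans (ler_wpM2l (powR_ge0 _ _) (inverse_square_bound x0 xn)) _.
rewrite mulrCA -powRD; last by rewrite (gt_eqF x0) implybT.
rewrite (_ : alpha + - 2 = - (2 - alpha))%R; last by lra.
have b0 : (0 < 4 / c / e)%R by rewrite !divr_gt0.
have xb : (4 / c / e <= x `^ (2 - alpha))%R.
  have -> : (4 / c / e = ((4 / c / e) `^ (2 - alpha)^-1) `^ (2 - alpha))%R.
    by rewrite -powRrM mulVf ?powRr1// ?(ltW b0)// gt_eqF// subr_gt0.
  apply: ge0_ler_powR; rewrite ?nnegrE ?powR_ge0 ?(ltW x0)//; first by lra.
  apply: (@le_trans _ _ n.+1%:R); first exact/ltW/truncnS_gt.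
  by rewrite ler_nat; lia.
rewrite powRN ler_pdivrMr ?powR_gt0//.
by rewrite [leRHS]mulrC -ler_pdivrMr.
Qed.

Hypothesis Vfin : second_moment_gt p \is a fin_num.
Let V := fine (second_moment_gt p).

Let V0 : (0 <= V)%R.
Proof. by rewrite fine_ge0//; apply: esum_ge0 => i _; apply: esum_ge0 => j _; exact: measure_ge0. Qed.

Let intT : {ae P, forall w, integral_space (representative (T w))}.
Proof. by apply: filterS treeT => w [tw _]; exact: tree_integral. Qed.

(** For [r >= 1], both [2 r + 1 <= 3 r] and [1 + 2 r V <= r (1 + 2 V)] hold, so that the bound of
    [mean_ball] is at most [C r ^ 2]. *)
Let C : R := (3 * (1 + 2 * V))%R.
Let C0 : (0 < C)%R. Proof. by rewrite mulr_gt0// ltr_pwDl// mulr_ge0. Qed.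

Let mean_ball_number (r : nat) : (0 < r)%N ->
  \int[P]_w (ball_number r (T w))%:R%:E <= (C * r%:R ^+ 2)%:E.
Proof.
move=> r0; apply: (@le_trans _ _ (\int[P]_w (ball_card r (representative (T w)))%:R%:E)).
  apply: ge0_le_integralT => w; rewrite lee_fin// ler_nat /ball_number.
  by case: ifP.
apply: le_trans (mean_ball unimodT treeT YE Ygw Vfin r) _; rewrite lee_fin -/V /C.
have r1 : (1 <= r%:R :> R)%R by rewrite ler1n.
rewrite -(natr1 (2 * r)) natrM; set x : R := r%:R in r1 *.
have x0 : (0 <= x)%R by lra.
have -> : (3 * (1 + 2 * V) * x ^+ 2 = (3 * x) * (x * (1 + 2 * V)))%R by ring.
apply: ler_pM; [lra|by rewrite addr_ge0// !mulr_ge0|lra|].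
by nra.
Qed.

Let constants (alpha : R) : (2 < alpha)%R ->
  exists2 B : nat, (1 < B)%N & (2 <= B%:R `^ (alpha - 2) :> R)%R.
Proof.
move=> a2; pose n := Num.truncn ((2 : R) `^ (alpha - 2)^-1); exists n.+2 => //.
have {1}-> : (2 = ((2 : R) `^ (alpha - 2)^-1) `^ (alpha - 2))%R.
  by rewrite -powRrM mulVf ?powRr1// gt_eqF// subr_gt0.
apply: ge0_ler_powR; rewrite ?nnegrE ?powR_ge0//; first by lra.
apply: (@le_trans _ _ n.+1%:R); first exact/ltW/truncnS_gt.
by rewrite ler_nat.
Qed.

Lemma dimension_lower_bound (alpha : R) : (2 < alpha)%R -> exists2 k : R, (0 < k)%R &
  (forall r, (1 <= r)%R -> (k * r `^ (- alpha))%:E <= lambda T r) /\ k%:E <= H1 T alpha.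
Proof.
move=> a2; have [B B2 Ba] := constants a2.
pose K : R := (4 * C * (2 * B%:R) `^ alpha)%R.
have K0 : (0 < K)%R by apply: mulr_gt0; [exact: mulr_gt0|rewrite powR_gt0// mulr_gt0// ltr0n (ltnW B2)].
(* The constant [K] counts light points in a ball, and 1/2 bounds below the probability that the
   root is light. *)
exists (K^-1 * 2^-1)%R; first by rewrite mulr_gt0 ?invr_gt0.
split=> [r r1|]; apply: le_ereal_inf_tmp => _ [Z cov <-].
  have r0 : (0 < r)%R by rewrite (lt_le_trans _ r1).
  rewrite powRN -mulrA (mulrC 2^-1%R) mulrA -invfM EFinM lee_pdivrMl; last exact: (mulr_gt0 K0 (powR_gt0 _ r0)).
  exact: (intensity_lower_bound unimodT intT C0 B2 Ba a2 mean_ball_number r1 cov).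
rewrite EFinM lee_pdivrMl//.
exact: (mean_pow_lower_bound unimodT intT C0 B2 Ba a2 mean_ball_number cov).
Qed.

End eternal_galton_watson_bounds.

Theorem proposition4p9 (R : realType) (d : measure_display)
    (Omega : measurableType d) (P : probability Omega R)
    (T : {RV P >-> D_star R}) (p : probability nat R) :
  is_eternal_galton_watson p T ->
  p [set 1%N] <> 1%E ->
  ('V_p[fun n : nat => n%:R : R] < +oo)%E ->
  has_udimM T 2%:E /\ udimH T = 2%:E.
Proof.
move=> [unimodT treeT [Y YE Ygw]] p1 /variance_second_moment Vfin.
have c0 := prob_gt1_gt0 (offspring_critical unimodT treeT YE Ygw) p1.
have lb := dimension_lower_bound unimodT treeT YE Ygw Vfin.
split.
  apply: (@has_udimM_power _ _ _ _ _ _ (4 / fine (prob_gt p 1))).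
  - by rewrite divr_gt0.
  - by move=> r; exact: (lambda_upper_bound unimodT treeT YE Ygw c0).
  - by move=> b /lb[k k0 [kl _]]; exists k.
apply: udimH_threshold => // [b b0 b2|b /lb[k k0 [_ kH]] H0].
  exact: (H1_eq0 unimodT treeT YE Ygw c0).
by move: kH; rewrite H0 lee_fin leNgt k0.
Qed.
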